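(* Let $d\ge 2$ be an integer and let $p\in(1,\infty)$. Let $\Phi\in C^{\infty}(\mathbb{R}^d\setminus\{0\},\mathbb{R})$ be homogeneous of degree $0$ and such that its restriction $\Phi\vert_{S^{d-1}}$ to the unit sphere has a nondegenerate local minimum or a nondegenerate local maximum. Then there exists a constant $c_{d,p,\Phi}>0$, independent of $t$, such that for all $t\in\mathbb{R}$ $$\lVert T_{\Phi}^{t}\rVert_{L^p(\mathbb{R}^d)\to L^p(\mathbb{R}^d)}\ \ge\ c_{d,p,\Phi}\,\langle t\rangle^{d\left|\frac12-\frac1p\right|}.$$
   Context: $S^{d-1}$ is the unit sphere centered at $0$ in $\mathbb{R}^d$, and $\langle t\rangle:=(1+|t|^2)^{1/2}$. A function $\Phi$ on $\mathbb{R}^d\setminus\{0\}$ is homogeneous of degree $0$ if $\Phi(\lambda\xi)=\Phi(\xi)$ for all $\lambda>0$ and $\xi\ne0$. The Fourier transform is normalized as $\widehat f(\xi):=\frac{1}{(2\pi)^d}\int_{\mathbb{R}^d}f(x)e^{-i\xi\cdot x}\,dx$. For $\Phi\in C^\infty(\mathbb{R}^d\setminus\{0\},\mathbb{R})$ homogeneous of degree $0$ and $t\in\mathbb{R}$, the Fourier multiplier operator $T_\Phi^t$ is defined on Schwartz functions $f\in\mathcal{S}(\mathbb{R}^d)$ by $$T_\Phi^t f(x):=\int_{\mathbb{R}^d}e^{it\Phi(\xi)+i\xi\cdot x}\,\widehat f(\xi)\,d\xi .$$ By Calderón–Zygmund theory it extends to a bounded operator on $L^p(\mathbb{R}^d)$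 for every $p\in(1,\infty)$, and $\lVert T_\Phi^t\rVert_{L^p(\mathbb{R}^d)\to L^p(\mathbb{R}^d)}$ denotes its operator norm (equivalently, the supremum of $\lVert T_\Phi^tf\rVert_{L^p}/\lVert f\rVert_{L^p}$ over nonzero Schwartz $f$). For a manifold $M$, a function $f:M\to\mathbb{R}$ has a nondegenerate critical point at $q\in M$ if for some local chart $\psi$ at $q$ one has $\nabla(f\circ\psi^{-1})(\psi(q))=0$ and the Hessian matrix of $f\circ\psi^{-1}$ at $\psi(q)$ is invertible (this does not depend on the chart). A nondegenerate local minimum (maximum) is a local minimum (maximum) point that is a nondegenerate critical point. *)

(* Defs.v *)
(* Over R : realType, R^n is 'rV[R]_n and the complex numbers are R[i]. *)
From HB Require Import structures.
From mathcomp Require Import all_boot all_order all_algebra.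
From mathcomp Require Import complex.
From mathcomp Require Import all_classical all_reals all_analysis.

Set Implicit Arguments.
Unset Strict Implicit.
Unset Printing Implicit Defensive.

Import Order.TTheory GRing.Theory Num.Theory.
Import numFieldNormedType.Exports.

Local Open Scope classical_set_scope.
Local Open Scope ring_scope.

Definition rV_display : measure_display. Proof. exact: default_measure_display. Qed.

(* The product sigma-algebra on R^n, i.e. the one generated by the coordinates
   (this is the Borel sigma-algebra). *)
Section rV_measurable.
Context {R : realType} (n : nat).

Definition rV_coord (i : 'I_n) (x : 'rV[R]_n) : measurableTypeR R := x 0 i.

Let rV_set0 : g_sigma_preimage rV_coord set0.
Proof. exact: sigma_algebra0. Qed.

Let rV_setC A : g_sigma_preimage rV_coord A -> g_sigma_preimage rV_coord (~` A).
Proof. exact: sigma_algebraC. Qed.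

Let rV_bigcup (F : (set 'rV[R]_n)^nat) :
  (forall i, g_sigma_preimage rV_coord (F i)) ->
  g_sigma_preimage rV_coord (\bigcup_i (F i)).
Proof. exact: sigma_algebra_bigcup. Qed.

HB.instance Definition _ := @isMeasurable.Build rV_display
  'rV[R]_n (g_sigma_preimage rV_coord) rV_set0 rV_setC rV_bigcup.

Lemma measurable_rV_coord (i : 'I_n) : measurable_fun [set: 'rV[R]_n] (rV_coord i).
Proof.
move=> _ Y mY; rewrite setTI; apply: sub_sigma_algebra => /=.
rewrite -bigcup_seq/=; exists i => /=; first by rewrite mem_index_enum.
by exists Y => //; rewrite setTI.
Qed.

Lemma measurable_fun_rV d (T : measurableType d) (f : T -> 'rV[R]_n) :
  (forall i, measurable_fun [set: T] (rV_coord i \o f)) ->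
  measurable_fun [set: T] f.
Proof.
move=> mf _ A mA.
have : g_sigma_preimage rV_coord `<=` [set B | measurable ([set: T] `&` f @^-1` B)].
  apply: smallest_sub.
    split => /=.
    - by rewrite preimage_set0 setI0.
    - move=> B; rewrite !setTI setTD => mB; rewrite preimage_setC.
      exact: measurableC.
    - move=> F mF; rewrite setTI preimage_bigcup; apply: bigcupT_measurable => k.
      by have := mF k; rewrite setTI.
  rewrite -bigcup_seq/=; apply: bigcup_sub => i _ B [C mC <-] /=.
  rewrite setTI -comp_preimage.
  by have := mf i measurableT C mC.
by apply.
Qed.

End rV_measurable.

(* Lebesgue measure on R^n, by recursion on n: the Dirac mass on the one-point
   space R^0, and the image of the product measure under
   R * R^n = R^(n+1). *)
Definition rV_cons (R : realType) n (z : measurableTypeR R * 'rV[R]_n) : 'rV[R]_n.+1 :=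
  row_mx (z.1%:M : 'rV[R]_1) z.2.

Section rV_cons_measure.
Context {R : realType} (n : nat).
Variable mu : {sigma_finite_measure set 'rV[R]_n -> \bar R}.

Lemma measurable_rV_cons : measurable_fun setT (@rV_cons R n).
Proof.
apply: measurable_fun_rV => i.
have [j ij|j ij] := splitP (i : 'I_(1 + n)).
  rewrite (_ : _ \o _ = fst); first exact: measurable_fst.
  apply/funext => z /=; rewrite /rV_coord /rV_cons.
  rewrite (_ : i = lshift n j); last exact/val_inj.
  by rewrite (row_mxEl (z.1%:M : 'rV_1)) (ord1 j) mxE eqxx mulr1n.
rewrite (_ : _ \o _ = rV_coord j \o snd).
  apply: measurableT_comp; [exact: measurable_rV_coord|exact: measurable_snd].
apply/funext => z /=; rewrite /rV_coord /rV_cons.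
rewrite (_ : i = rshift 1 j); last exact/val_inj.
by rewrite (row_mxEr (z.1%:M : 'rV_1)).
Qed.

Definition rV_cons_measure :=
  pushforward (@lebesgue_measure R \x mu)%E (@rV_cons R n).

Let rV_cons_measure0 : rV_cons_measure set0 = 0%E.
Proof. by rewrite /rV_cons_measure /pushforward preimage_set0 measure0. Qed.

Let rV_cons_measure_ge0 A : (0 <= rV_cons_measure A)%E.
Proof. exact: (measure_ge0 (@lebesgue_measure R \x mu)%E). Qed.

Let rV_cons_measure_sigma_additive : semi_sigma_additive rV_cons_measure.
Proof.
move=> F mF tF mUF; rewrite /rV_cons_measure /pushforward preimage_bigcup.
have mcons A : measurable A -> measurable (@rV_cons R n @^-1` A).
  by move=> mA; rewrite -[X in measurable X]setTI; exact: measurable_rV_cons.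
apply: measure_semi_sigma_additive.
- by move=> k; exact: mcons.
- apply/trivIsetP => i j _ _ ij; rewrite -preimage_setI.
  by move/trivIsetP : tF => /(_ _ _ _ _ ij) ->//; rewrite preimage_set0.
- by rewrite -preimage_bigcup; exact: mcons.
Qed.

HB.instance Definition _ := isMeasure.Build _ _ _ rV_cons_measure
  rV_cons_measure0 rV_cons_measure_ge0 rV_cons_measure_sigma_additive.

Let rV_cons_measure_sigma_finite : sigma_finite setT rV_cons_measure.
Proof.
have [F FT Foo] : sigma_finite setT (@lebesgue_measure R \x mu)%E.
  have /sigma_finiteP[F [FT ndF Foo]] := sigma_finiteT (@lebesgue_measure R).
  have /sigma_finiteP[G [GT ndG Goo]] := sigma_finiteT mu.
  exists (fun k => F k `*` G k) => [|k].
    rewrite -setXTT FT GT predeqE => -[x y]; split.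
      move=> [/= [k _ Fkx] [l _ Gly]]; exists (maxn k l) => //; split.
      - by move: x Fkx; exact/subsetPset/ndF/leq_maxl.
      - by move: y Gly; exact/subsetPset/ndG/leq_maxr.
    by move=> [k _ []/= ? ?]; split; exists k.
  have [? ?] := Foo k; have [? ?] := Goo k; split; first exact: measurableX.
  by rewrite product_measure1E// lte_mul_pinfty// ge0_fin_numE.
pose uncons (x : 'rV[R]_n.+1) : measurableTypeR R * 'rV[R]_n :=
  (rV_coord ord0 x, \row_j rV_coord (lift ord0 j) x).
have unconsK z : uncons (rV_cons z) = z.
  case: z => a v; congr pair.
    rewrite /rV_coord /rV_cons (_ : ord0 = lshift n (ord0 : 'I_1)); last exact/val_inj.
    by rewrite (row_mxEl (a%:M : 'rV_1)) mxE eqxx mulr1n.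
  apply/rowP => j; rewrite mxE /rV_coord /rV_cons.
  rewrite (_ : lift ord0 j = rshift 1 j); last exact/val_inj.
  by rewrite (row_mxEr (a%:M : 'rV_1)).
have muncons : measurable_fun setT uncons.
  apply: measurable_fun_pair; first exact: measurable_rV_coord.
  apply: measurable_fun_rV => j.
  rewrite (_ : _ \o _ = rV_coord (lift ord0 j)); first exact: measurable_rV_coord.
  by apply/funext => x; rewrite /= /rV_coord mxE.
exists (fun k => uncons @^-1` F k).
  by rewrite -preimage_bigcup -FT preimage_setT.
move=> k; have [mF Fk] := Foo k; split.
  by rewrite -[X in measurable X]setTI; exact: muncons.
rewrite /rV_cons_measure /pushforward -comp_preimage.
by rewrite (_ : _ \o _ = id) ?preimage_id//; apply/funext => z /=; exact: unconsK.
Qed.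

HB.instance Definition _ := Measure_isSigmaFinite.Build _ _ _ rV_cons_measure
  rV_cons_measure_sigma_finite.

End rV_cons_measure.

Fixpoint lebesgue_rV (R : realType) (n : nat) :
    {sigma_finite_measure set 'rV[R]_n -> \bar R} :=
  match n with
  | 0 => \d_(0 : 'rV[R]_0)
  | m.+1 => rV_cons_measure (lebesgue_rV R m)
  end.

Lemma lebesgue_rV_box (R : realType) (n : nat) (a b : 'I_n -> R) :
  (forall i, a i <= b i) ->
  lebesgue_rV R n [set x | forall i, a i <= x 0 i <= b i] =
  (\prod_(i < n) (b i - a i))%:E.
Proof.
elim: n a b => [|n IHn] a b ab.
  by rewrite big_ord0 /= diracE mem_set// => -[].
rewrite big_ord_recl /= /rV_cons_measure /pushforward.
rewrite [X in product_measure1 _ _ X](_ : _ = (`[a ord0, b ord0] : set (measurableTypeR R)) `*`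
  [set v : 'rV[R]_n | forall i : 'I_n, a (lift ord0 i) <= v 0 i <= b (lift ord0 i)]).
  rewrite product_measure1E//=.
  - rewrite IHn// EFinM lebesgue_measure_itv/= lte_fin -EFinB.
    by case: ltgtP (ab ord0) => // ->; rewrite subrr.
  - rewrite (_ : mkset _ = \bigcap_(i in [set: 'I_n])
      (rV_coord i @^-1` `[a (lift ord0 i), b (lift ord0 i)])).
      apply: fin_bigcap_measurable => // i _.
      by rewrite -[X in measurable X]setTI; exact: measurable_rV_coord.
    apply/seteqP; split=> v /= H i; last by have := H i I; rewrite /= in_itv.
    by move=> _; rewrite /= in_itv/=; exact: H.
apply/seteqP; split => -[u v] /= H.
  split => [|i].
    have := H ord0; rewrite /rV_cons in_itv/= (_ : ord0 = lshift n (ord0 : 'I_1)); last exact/val_inj.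
    by rewrite (row_mxEl (u%:M : 'rV_1)) mxE eqxx mulr1n.
  have := H (lift ord0 i); rewrite /rV_cons (_ : lift ord0 i = rshift 1 i); last exact/val_inj.
  by rewrite (row_mxEr (u%:M : 'rV_1)).
move=> i; have [j ->|->] := unliftP ord0 i.
  have := H.2 j; rewrite /rV_cons (_ : lift ord0 j = rshift 1 j); last exact/val_inj.
  by rewrite (row_mxEr (u%:M : 'rV_1)).
have := H.1; rewrite in_itv/= /rV_cons (_ : ord0 = lshift n (ord0 : 'I_1)); last exact/val_inj.
by rewrite (row_mxEl (u%:M : 'rV_1)) mxE eqxx mulr1n.
Qed.

Section calculus.
Context {R : realType} {n : nat}.
Implicit Types (g : 'rV[R]_n -> R) (U : set 'rV[R]_n) (s : seq 'I_n).

(* partials [:: i1; ...; ik] g = d_i1 (... (d_ik g)) *)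
Definition partials s g : 'rV[R]_n -> R :=
  foldr (fun i h => 'D_(delta_mx 0 i) h) g s.

(* g is C^oo on the open set U: the iterated partial derivatives of all orders
   exist and are continuous at the points of U.  Values of g outside U do not
   matter. *)
Definition smooth_on U g : Prop :=
  forall s x, U x ->
    {for x, continuous (partials s g)} /\
    forall i, derivable (partials s g) x (delta_mx 0 i).

Definition dotp (x y : 'rV[R]_n) : R := \sum_i x 0 i * y 0 i.

Definition sphere : set 'rV[R]_n := [set x | dotp x x = 1].

Definition schwartz_real g : Prop :=
  smooth_on setT g /\
  forall (alpha : 'I_n -> nat) s, exists C : R, forall x : 'rV[R]_n,
    `|(\prod_i x 0 i ^+ alpha i) * partials s g x| <= C.

Definition schwartz (f : 'rV[R]_n -> R[i]) : Prop :=
  schwartz_real (fun x => complex.Re (f x)) /\ schwartz_real (fun x => complex.Im (f x)).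

End calculus.
Arguments sphere {R} n.

Section sphere_charts.
Context {R : realType} {d : nat}.

Definition smooth_map_on {m n} (U : set 'rV[R]_m) (F : 'rV[R]_m -> 'rV[R]_n) :=
  forall j, smooth_on U (fun x => F x 0 j).

(* psi : U `&` S^(d-1) -> V is a smooth chart of S^(d-1) with inverse phi.
   Requiring psi to be smooth on the ambient open set U loses no chart: a chart
   psi0 defined on an open subset W of the sphere extends smoothly to the open
   cone over W as x |-> psi0 (x / |x|). *)
Record sphere_chart (U : set 'rV[R]_d) (V : set 'rV[R]_d.-1)
    (psi : 'rV[R]_d -> 'rV[R]_d.-1) (phi : 'rV[R]_d.-1 -> 'rV[R]_d) : Prop := {
  chart_dom_open : open U ;
  chart_codom_open : open V ;
  chart_psi_in : forall x, (U `&` sphere d) x -> V (psi x) ;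
  chart_phi_in : forall y, V y -> (U `&` sphere d) (phi y) ;
  chart_psiK : forall x, (U `&` sphere d) x -> phi (psi x) = x ;
  chart_phiK : forall y, V y -> psi (phi y) = y ;
  chart_psi_smooth : smooth_map_on U psi ;
  chart_phi_smooth : smooth_map_on V phi }.

(* In the four definitions below, f stands for its restriction to the sphere. *)
Definition nondegenerate_critical (f : 'rV[R]_d -> R) (q : 'rV[R]_d) : Prop :=
  sphere d q /\
  exists U V psi phi, [/\ @sphere_chart U V psi phi, U q,
    forall i, partials [:: i] (f \o phi) (psi q) = 0 &
    (\matrix_(i, j) partials [:: i; j] (f \o phi) (psi q)) \in unitmx].

Definition sphere_local_min (f : 'rV[R]_d -> R) (q : 'rV[R]_d) : Prop :=
  sphere d q /\ \forall x \near q, sphere d x -> f q <= f x.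

Definition sphere_local_max (f : 'rV[R]_d -> R) (q : 'rV[R]_d) : Prop :=
  sphere d q /\ \forall x \near q, sphere d x -> f x <= f q.

Definition has_nondegenerate_local_extremum (f : 'rV[R]_d -> R) : Prop :=
  exists q, nondegenerate_critical f q /\
    (sphere_local_min f q \/ sphere_local_max f q).

Definition homogeneous0 (Phi : 'rV[R]_d -> R) : Prop :=
  forall (lambda : R) xi, 0 < lambda -> xi != 0 -> Phi (lambda *: xi) = Phi xi.

End sphere_charts.

Section fourier_multipliers.
Context {R : realType} {d : nat}.
Local Notation Rd := 'rV[R]_d.
Implicit Types (f : Rd -> R[i]) (Phi : Rd -> R) (t p : R).

Definition Cintegral f : R[i] :=
  Complex (\int[lebesgue_rV R d]_x complex.Re (f x)) (\int[lebesgue_rV R d]_x complex.Im (f x)).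

(* e^(i theta) *)
Definition expi (theta : R) : R[i] := Complex (cos theta) (sin theta).

Definition fourier f (xi : Rd) : R[i] :=
  real_complex R (((2 * pi) ^+ d)^-1) *
  Cintegral (fun x => f x * expi (- dotp xi x)).

Definition multiplier Phi t f (x : Rd) : R[i] :=
  Cintegral (fun xi => expi (t * Phi xi + dotp xi x) * fourier f xi).

Definition Lp_norm p f : \bar R :=
  Lnorm (lebesgue_rV R d) p%:E (fun x => (ComplexField.Normc.normc (f x))%:E).

(* The operator norm L^p -> L^p of the continuous extension of T, as a supremum
   over the dense subspace of Schwartz functions. *)
Definition Lp_opnorm p (T : (Rd -> R[i]) -> (Rd -> R[i])) : \bar R :=
  ereal_sup [set r | exists f,
    [/\ schwartz f, f <> (fun=> 0) & r = (Lp_norm p (T f) / Lp_norm p f)%E]].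

End fourier_multipliers.

Definition japanese {R : realType} (t : R) : R := Num.sqrt (1 + `|t| ^+ 2).

(* Main.v *)
Require Import Defs.
From mathcomp Require Import all_boot all_order all_algebra.
From mathcomp Require Import complex.
From mathcomp Require Import all_classical all_reals all_analysis.
From mathcomp Require Import measurable_realfun zify ring lra.

(* Near a point [xi0 <> 0] where the full Hessian of [Phi] is invertible, take a
   bump [chi] and the wave packets [G s] with Fourier transform
   [chi e^(i s Phi)], up to a constant.  The multiplier at time [t] maps [G s]
   to a multiple of [G (s + t)], Plancherel makes the L^2 norm of [G s]
   independent of [s], and a dispersive estimate gives [|G s| <= C <s>^(-d/2)].
   Interpolating between L^2 and L^oo, the ratio of the L^p norms of [G t] and
   [G 0] (for [p <= 2]) or of [G 0] and [G (-t)] (for [p > 2]) is at least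
   [c <t>^(d |1/2 - 1/p|)].

   The point [xi0] exists although the Hessian is degenerate on the ray of the
   extremum [q]: there the gradient vanishes and the tangential block [A] of
   the Hessian is the invertible Hessian in the chart.  At [q + s w], with [w]
   tangent of coordinates [y], Euler's relations make the Hessian congruent to
   a matrix that tends to [[0, -yA], [-A y^T, A]] as [s -> 0], whose
   determinant is [- y A y^T det A]; choose [y] with [y A y^T <> 0].

   For the dispersive estimate, [|G s (x)|^2] is the integral over [h] of an
   oscillatory integral in [xi] with phase [s (Phi (xi + h) - Phi xi)], up to a
   constant, which is non-stationary at scale [s |h|]; repeated integration by
   parts bounds it by [C prod_i (1 + s^2 h_i^2)^(-1)]. *)

Set Implicit Arguments.
Unset Strict Implicit.
Unset Printing Implicit Defensive.

Import Order.TTheory GRing.Theory Num.Theory.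
Import numFieldNormedType.Exports.

Local Open Scope classical_set_scope.
Local Open Scope ring_scope.

(** * Lebesgue measure and integration on R^n *)

Section rV_measure.
Context {R : realType}.

(** The exponent calls for the decay [<s>^(-d/2)], hence for a point where the full d by d Hessian
    is invertible. Homogeneity of degree 0 gives [D^2 Phi(xi) xi = - grad Phi(xi)], so the Hessian
    is singular at every critical point: the packets cannot be centred on the ray of the extremum
    and must live where the gradient is non-zero. The sup bound has to be uniform in [x], whereas
    the stationary points of [s Phi(xi) + x.xi] move with [x]. Squaring removes this: in the product
    of two copies shifted by [h], the linear term leaves only the constant phase [x.h]. With [I] the
    p-th moment of [|G s|] and [E] its squared L^2 norm, the interpolation reads [E <= sup^(2-p) I]
    for p <= 2 and [I <= sup^(p-2) E] for p > 2; the factor [<s>^(-d |2-p| / 2)] becomes the stated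
    power after a p-th root. For p > 2 the packet starts spread out and focuses at time 0. The
    constant [kappa] of Fourier inversion stays implicit: only its being non-zero is used, and this
    follows from [E > 0]. *)

Lemma measurable_box n (a b : 'I_n -> R) :
  measurable [set x : 'rV[R]_n | forall i, a i < x 0 i < b i].
Proof.
rewrite (_ : mkset _ = \bigcap_(i in [set: 'I_n])
  (rV_coord i @^-1` [set` `]a i, b i[])).
  apply: fin_bigcap_measurable => // i _.
  by rewrite -[X in measurable X]setTI; exact: measurable_rV_coord.
apply/seteqP; split=> v /= H i; last by have := H i I; rewrite /= in_itv.
by move=> _; rewrite /= in_itv/=; exact: H.
Qed.

Lemma measurable_cbox n (a b : 'I_n -> R) :
  measurable [set x : 'rV[R]_n | forall i, a i <= x 0 i <= b i].
Proof.
rewrite (_ : mkset _ = \bigcap_(i in [set: 'I_n])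
  (rV_coord i @^-1` [set` `[a i, b i]])).
  apply: fin_bigcap_measurable => // i _.
  by rewrite -[X in measurable X]setTI; exact: measurable_rV_coord.
apply/seteqP; split=> v /= H i; last by have := H i I; rewrite /= in_itv.
by move=> _; rewrite /= in_itv/=; exact: H.
Qed.

(** The sigma-algebra is generated by the coordinates, so openness enters through a countable cover:
    the boxes with rational centre and half-width [1/(k+1)] that are contained in [A]. *)
Lemma measurable_open_rV n (A : set 'rV[R]_n) : open A -> measurable A.
Proof.
move=> oA.
pose B (qk : 'rV[rat]_n * nat) : set 'rV[R]_n :=
  [set x | forall i, ratr (qk.1 0 i) - (qk.2.+1%:R)^-1 < x 0 i < ratr (qk.1 0 i) + (qk.2.+1%:R)^-1].
have -> : A = \bigcup_(qk in [set qk | B qk `<=` A]) B qk.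
  apply/seteqP; split => [x Ax|x [qk /= qkA]]; last exact: qkA.
  have [e e0 eA] : exists2 e : R, 0 < e & ball x e `<=` A.
    by have /nbhs_ballP[e e0 eA] := open_nbhs_nbhs (conj oA Ax); exists e.
  (* With half-width [1/(k+1) < e/2], a box containing [x] has all its points within [e] of [x],
     although its rational centre need not be [x]. *)
  pose k := Num.trunc (2 / e).
  have ke : (k.+1%:R)^-1 < e / 2.
    by rewrite invf_plt ?posrE ?divr_gt0 // invf_div truncnS_gt ?divr_ge0 ?ltW.
  have k0 : 0 < (k.+1%:R)^-1 :> R by rewrite invr_gt0.
  have Q i : exists q : rat, x 0 i - (k.+1%:R)^-1 < ratr q < x 0 i + (k.+1%:R)^-1.
    have [|q] := @rat_in_itvoo R (x 0 i - (k.+1%:R)^-1) (x 0 i + (k.+1%:R)^-1).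
      by rewrite ltrD2l (lt_trans _ k0)// oppr_lt0.
    by rewrite in_itv/= => ?; exists q.
  exists (\row_i sval (cid (Q i)), k) => [y /= yB|i] /=.
    apply: eA; split => // i j; rewrite ord1 {i}.
    have := yB j; rewrite mxE; case: cid => q /= qx yq.
    move: ke k0 qx yq; move: (k.+1%:R^-1) => c ke k0 qx yq.
    rewrite /ball/= ltr_norml; lra.
  rewrite mxE; case: cid => q /= qx.
  move: qx; move: (k.+1%:R^-1) => c qx; lra.
(* [unpickle] turns the countable index type into a sequence, with [set0] at the integers that code
   no admissible box. *)
pose F n := if unpickle n is Some qk then
  if `[< B qk `<=` A >] then B qk else set0 else set0.
rewrite (_ : \bigcup_(qk in _) _ = \bigcup_n F n).
  apply: bigcupT_measurable => k; rewrite /F.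
  case: unpickle => [qk|//]; case: asboolP => // _; exact: measurable_box.
apply/seteqP; split => x [].
  move=> qk /= BA Bx; exists (pickle qk) => //.
  by rewrite /F pickleK; case: asboolP.
move=> k _; rewrite /F; case: unpickle => [qk|//]; case: asboolP => // BA Bx.
by exists qk.
Qed.

Lemma continuous_measurable_rV n (f : 'rV[R]_n -> R) :
  continuous f -> measurable_fun setT f.
Proof.
move=> /continuousP cf; apply: (measurability _ (RGenOInfty.measurableE R)).
move=> _ [_ [a ->] <-]; rewrite setTI.
have oa : open (`]a, +oo[%classic : set R) by exact: interval_open.
exact: measurable_open_rV (cf _ oa).
Qed.

End rV_measure.

(** * Tonelli, dilations, translations and reflections on R^n *)

Section rV_integral.
Context {R : realType}.
Local Open Scope ereal_scope.
Local Notation leb := (@lebesgue_measure R).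

Lemma measurable_fun_rV0 (f : 'rV[R]_0 -> \bar R) : measurable_fun setT f.
Proof.
rewrite (_ : f = cst (f 0%R)); first exact: measurable_cst.
by apply/funext => x; rewrite (thinmx0 x).
Qed.

Lemma integral_rV0 (f : 'rV[R]_0 -> \bar R) :
  \int[lebesgue_rV R 0]_x f x = f 0%R.
Proof.
rewrite /= integral_dirac//; last exact: measurable_fun_rV0.
by rewrite diracT mul1e.
Qed.

(** The recursion defining [lebesgue_rV], read through change of variables for a pushforward and
    Tonelli; it drives the inductions on the dimension. *)
Lemma integral_rVS n (f : 'rV[R]_n.+1 -> \bar R) : measurable_fun setT f ->
  (forall x, 0 <= f x) ->
  \int[lebesgue_rV R n.+1]_x f x =
  \int[leb]_a \int[lebesgue_rV R n]_v f (rV_cons (a, v)).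
Proof.
move=> mf f0 /=.
have mc : measurable_fun setT (@rV_cons R n) by exact: measurable_rV_cons.
rewrite /rV_cons_measure ge0_integral_pushforward//=.
rewrite preimage_setT fubini_tonelli1//=; first exact: measurableT_comp.
Qed.

Lemma measurable_affine1 (c h : R) :
  measurable_fun setT ((fun a => c * a + h)%R : measurableTypeR R -> measurableTypeR R).
Proof. by apply: measurable_funD => //; exact: measurable_funM. Qed.

(** Uniqueness of Lebesgue measure: the rescaled image measure gives each half-open interval its
    length. *)
Lemma lebesgue_affine1 (c h : R) (A : set R) : measurable A -> (0 < c)%R ->
  leb A = c%:E * pushforward leb ((fun a => c * a + h)%R : measurableTypeR R -> measurableTypeR R) A.
Proof.
move=> mA c0.
pose m0 := [the measure _ _ of pushforward leb ((fun a => c * a + h)%R : measurableTypeR R -> measurableTypeR R)].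
pose m := m0 (measurable_affine1 c h).
pose k := NngNum (ltW c0).
apply: (@lebesgue_measure_unique R (mscale k m)) mA => _ [[a b] _ <-] /=.
rewrite /mscale/= /pushforward.
rewrite (_ : _ @^-1` _ = `]((a - h) / c), ((b - h) / c)]%classic)%R; last first.
  apply/seteqP; split => x /=; rewrite !in_itv/= ltr_pdivrMr// ler_pdivlMr//;
   rewrite ltrBlDr lerBrDr mulrC//.
rewrite !lebesgue_measure_itv/= !lte_fin ltr_pM2r ?invr_gt0// ltrD2r.
case: ifPn => // _; last by rewrite mule0.
rewrite -!EFinB -EFinM; congr EFin; field. exact: lt0r_neq0.
Qed.

Lemma affine_integral1 (c h : R) (f : R -> \bar R) : measurable_fun setT f ->
  (forall x, 0 <= f x) -> (0 < c)%R ->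
  c%:E * \int[leb]_a f (c * a + h)%R = \int[leb]_a f a.
Proof.
move=> mf f0 c0.
pose m0 := [the measure _ _ of pushforward leb ((fun a => c * a + h)%R : measurableTypeR R -> measurableTypeR R)].
pose m := m0 (measurable_affine1 c h).
pose k := NngNum (ltW c0).
have := ge0_integral_pushforward (measurable_affine1 c h) leb measurableT mf (fun y _ => f0 y).
rewrite preimage_setT /comp/= => <-.
rewrite -[LHS](@ge0_integral_mscale _ _ R m setT _ k)//.
by apply: eq_measure_integral => A mA _; rewrite [RHS](lebesgue_affine1 h mA c0).
Qed.

Lemma opp_integral1 (f : R -> \bar R) : measurable_fun setT f ->
  (forall x, 0 <= f x) ->
  \int[leb]_a f (- a)%R = \int[leb]_a f a.
Proof.
move=> mf f0.
have mN : measurable_fun setT (-%R : measurableTypeR R -> measurableTypeR R) by [].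
have := ge0_integral_pushforward mN leb measurableT mf (fun y _ => f0 y).
rewrite preimage_setT /comp/= => <-.
by apply: eq_measure_integral => A mA _; exact: lebesgue_measureN.
Qed.

Lemma rV_cons_lin n (c : R) (a h : R) (v w : 'rV[R]_n) :
  (c *: rV_cons (a, v) + rV_cons (h, w))%R = rV_cons (c * a + h, c *: v + w)%R.
Proof.
rewrite /rV_cons/= (scale_row_mx c (a%:M : 'rV_1)) (add_row_mx (_ *: _ : 'rV_1)).
by rewrite scale_scalar_mx raddfD.
Qed.

Lemma rV_consK n (x : 'rV[R]_n.+1) :
  exists a v, x = rV_cons (a, v).
Proof.
exists (x 0 0)%R, (\row_j x 0 (lift ord0 j))%R.
apply/rowP => i; rewrite /rV_cons /=.
have [j|j] := splitP (i : 'I_(1 + n)) => ij.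
  rewrite (_ : i = lshift n j); last exact/val_inj.
  by rewrite (row_mxEl (_%:M : 'rV_1)) mxE !ord1 eqxx mulr1n; congr (x _ _); apply/val_inj.
rewrite (_ : i = rshift 1 j); last exact/val_inj.
by rewrite (row_mxEr (_%:M : 'rV_1)) mxE; congr (x _ _); apply/val_inj.
Qed.

Lemma measurable_affine n (c : R) (h : 'rV[R]_n) :
  measurable_fun setT (fun x : 'rV[R]_n => c *: x + h)%R.
Proof.
apply: measurable_fun_rV => i.
rewrite (_ : _ \o _ = (fun x : 'rV[R]_n => c * rV_coord i x + h 0 i)%R); last first.
  by apply/funext => x; rewrite /rV_coord /= !mxE.
apply: measurable_funD => //; apply: measurable_funM => //; exact: measurable_rV_coord.
Qed.

Lemma measurable_rV_consr n (a : R) : measurable_fun setT (fun v : 'rV[R]_n => rV_cons (a, v)).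
Proof.
apply: (measurableT_comp (@measurable_rV_cons R n)).
exact: measurable_pair1.
Qed.

Lemma measurable_int_cons n (f : 'rV[R]_n.+1 -> \bar R) : measurable_fun setT f ->
  (forall x, 0 <= f x) ->
  measurable_fun setT (fun a => \int[lebesgue_rV R n]_v f (rV_cons (a, v))).
Proof.
move=> mf f0.
apply: (@measurable_fun_fubini_tonelli_F _ _ _ _ R (lebesgue_rV R n) (f \o @rV_cons R n)) => //.
exact: (measurableT_comp mf (@measurable_rV_cons R n)).
by move=> z; exact: f0.
Qed.

Lemma affine_integral n (c : R) (h : 'rV[R]_n) (f : 'rV[R]_n -> \bar R) : measurable_fun setT f ->
  (forall x, 0 <= f x) -> (0 < c)%R ->
  (c ^+ n)%:E * \int[lebesgue_rV R n]_x f (c *: x + h)%R = \int[lebesgue_rV R n]_x f x.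
Proof.
move=> mf f0 c0; elim: n h f mf f0 => [|n IH] h f mf f0.
  by rewrite !integral_rV0 expr0 mul1e; congr (f _); rewrite [LHS]thinmx0.
have [h0 [h' hE]] := rV_consK h.
rewrite !integral_rVS//; last first.
  exact: (measurableT_comp mf (measurable_affine c h)).
have E a (v : 'rV[R]_n) :
  (c *: rV_cons (a, v) + h = rV_cons (c * a + h0, c *: v + h'))%R.
  by rewrite hE rV_cons_lin.
under eq_integral do (under eq_integral do rewrite E).
have mfc a := measurableT_comp mf (@measurable_rV_consr n a).
rewrite exprS EFinM -muleA -ge0_integralZl//; first last.
- by rewrite lee_fin exprn_ge0// ltW.
- by move=> a _; apply: integral_ge0.
- rewrite (_ : (fun x => _) = fun a => \int[lebesgue_rV R n]_v f (c *: rV_cons (a, v) + h)%R).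
    exact: (measurable_int_cons (measurableT_comp mf (measurable_affine c h)) (fun v => f0 _)).
  by apply/funext => a; apply: eq_integral => v _; rewrite E.
have E2 a : (c ^+ n)%:E * \int[lebesgue_rV R n]_v f (rV_cons (a, c *: v + h')%R) =
    \int[lebesgue_rV R n]_v f (rV_cons (a, v)) by exact: (IH h' _ (mfc a) (fun v => f0 _)).
under eq_integral do rewrite E2.
rewrite (affine_integral1 _ (f := fun a => \int[lebesgue_rV R n]_v f (rV_cons (a, v))))//.
- exact: measurable_int_cons.
- by move=> a; exact: integral_ge0.
Qed.

Lemma opp_integral n (f : 'rV[R]_n -> \bar R) : measurable_fun setT f ->
  (forall x, 0 <= f x) ->
  \int[lebesgue_rV R n]_x f (- x)%R = \int[lebesgue_rV R n]_x f x.
Proof.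
elim: n f => [|n IH] f mf f0.
  by rewrite !integral_rV0 oppr0.
have mN : measurable_fun setT (fun x : 'rV[R]_n.+1 => - x)%R.
  rewrite (_ : (fun x => _) = (fun x => (-1) *: x + 0)%R); first exact: measurable_affine.
  by apply/funext => x; rewrite scaleN1r addr0.
rewrite !integral_rVS//; last exact: (measurableT_comp mf mN).
have E a (v : 'rV[R]_n) : (- rV_cons (a, v) = rV_cons (- a, - v))%R.
  by rewrite /rV_cons (opp_row_mx (_%:M : 'rV_1))/= raddfN.
under eq_integral do (under eq_integral do rewrite E).
have mfc a := measurableT_comp mf (@measurable_rV_consr n a).
have E2 a : \int[lebesgue_rV R n]_v f (rV_cons (a, - v)%R) =
    \int[lebesgue_rV R n]_v f (rV_cons (a, v)) by exact: (IH _ (mfc a) (fun v => f0 _)).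
under eq_integral do rewrite E2.
rewrite (opp_integral1 (f := fun a => \int[lebesgue_rV R n]_v f (rV_cons (a, v))))//.
- exact: measurable_int_cons.
- by move=> a; exact: integral_ge0.
Qed.

End rV_integral.

Notation L1 mu f := (mu.-integrable setT (EFin \o f)).

(** * Integrable real functions: domination, limits and Fubini *)

Section L1_theory.
Context d (T : measurableType d) {R : realType} (mu : {measure set T -> \bar R}).
Implicit Types f g : T -> R.

Lemma L1_measurable f : L1 mu f -> measurable_fun setT f.
Proof. by move=> /measurable_int/measurable_EFinP. Qed.

Lemma L1_dom f g : measurable_fun setT f -> (forall x, `|f x| <= g x) ->
  L1 mu g -> L1 mu f.
Proof.
move=> mf fg Lg; apply: (@le_integrable _ _ R mu setT measurableT _ (EFin \o g)) => //.
  exact/measurable_EFinP.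
move=> x _ /=; rewrite lee_fin (le_trans (fg x))// ler_norm//.
Qed.

Lemma L1D f g : L1 mu f -> L1 mu g -> L1 mu (fun x => f x + g x).
Proof.
by move=> Lf Lg; apply: eq_integrable (integrableD measurableT Lf Lg).
Qed.

Lemma L1Z (k : R) f : L1 mu f -> L1 mu (fun x => k * f x).
Proof.
by move=> Lf; apply: eq_integrable (integrableZl measurableT k Lf).
Qed.

Lemma L1_abs f : L1 mu f -> L1 mu (fun x => `|f x|).
Proof. by move=> /integrable_norm. Qed.

Lemma Rint_abs_le f g : measurable_fun setT f -> L1 mu g -> (forall x, `|f x| <= g x) ->
  `|\int[mu]_x f x| <= \int[mu]_x g x.
Proof.
move=> mf Lg fg; have Lf := L1_dom mf fg Lg.
apply: le_trans (le_normr_Rintegral measurableT Lf) _.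
by apply: le_Rintegral => //; exact: L1_abs.
Qed.

Lemma RintE f : L1 mu f -> ((\int[mu]_x f x)%:E = \int[mu]_x (f x)%:E)%E.
Proof. by move=> Lf; rewrite /Rintegral fineK//; exact: integrable_fin_num. Qed.

Lemma L1_ge0P f : measurable_fun setT f -> (forall x, 0 <= f x) ->
  L1 mu f <-> (\int[mu]_x (f x)%:E < +oo)%E.
Proof.
move=> mf f0; split.
  by move=> /integrableP[_]; under eq_integral do rewrite /= ger0_norm//.
move=> H; apply/integrableP; split; first exact/measurable_EFinP.
by under eq_integral do rewrite /= ger0_norm//.
Qed.

(** Measurability of the limit is part of the conclusion: applied to difference quotients, it makes
    directional derivatives measurable. *)
Lemma Rint_dct (f_ : nat -> T -> R) f g :
  (forall n, measurable_fun setT (f_ n)) -> L1 mu g ->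
  (forall n x, `|f_ n x| <= g x) ->
  (forall x, f_ n x @[n --> \oo] --> f x) ->
  [/\ measurable_fun setT f, L1 mu f &
   \int[mu]_x f_ n x @[n --> \oo] --> \int[mu]_x f x].
Proof.
move=> mf_ Lg fg cf.
have mf : measurable_fun setT f.
  by apply: (@measurable_fun_cvg _ _ _ _ f_) => // x _; exact: cf.
have [|||||] := @dominated_convergence _ _ _ mu setT measurableT (fun n x => (f_ n x)%:E) (EFin \o f) (EFin \o g) => //.
- by move=> n; exact/measurable_EFinP.
- exact/measurable_EFinP.
- by apply: aeW => x _; apply: cvg_EFin; [exact: nearW|exact: cf].
- by apply: aeW => x n _; rewrite lee_fin.
move=> Lf _ H; split => //.
apply: fine_cvg.
by rewrite -RintE// in H.
Qed.

End L1_theory.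

Section Fubini_real.
Context d1 d2 (T1 : measurableType d1) (T2 : measurableType d2) {R : realType}.
Variables (m1 : {sigma_finite_measure set T1 -> \bar R})
  (m2 : {sigma_finite_measure set T2 -> \bar R}).

(** Domination by a product is an easily checked form of integrability on the product space: the
    iterated integral of [|f|] is at most the product of the L^1 norms of [g] and [h]. *)
Lemma Rfubini (f : T1 * T2 -> R) g h : measurable_fun setT f -> L1 m1 g -> L1 m2 h ->
  (forall x y, `|f (x, y)| <= g x * h y) ->
  [/\ L1 m1 (fun x => \int[m2]_y f (x, y)), L1 m2 (fun y => \int[m1]_x f (x, y)) &
  \int[m1]_x \int[m2]_y f (x, y) = \int[m2]_y \int[m1]_x f (x, y)].
Proof.
move=> mf Lg Lh fgh.
have m1f y : measurable_fun setT (fun x => f (x, y)).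
  by apply: (measurableT_comp mf); exact: measurable_pair2.
have m2f x : measurable_fun setT (fun y => f (x, y)).
  by apply: (measurableT_comp mf); exact: measurable_pair1.
have L2 x : L1 m2 (fun y => f (x, y)) by apply: (L1_dom (m2f x) (fgh x)); exact: L1Z.
have L1' y : L1 m1 (fun x => f (x, y)).
  apply: (L1_dom (m1f y) (fun x => fgh x y)).
  by under eq_fun do rewrite mulrC; exact: L1Z.
have Lf : L1 (m1 \x m2)%E f.
  apply/integrable12ltyP; first exact/measurable_EFinP.
  apply: (@le_lt_trans _ _ (\int[m1]_x (`|g x * \int[m2]_y `|h y| |)%:E)%E); last first.
    have : L1 m1 (fun x => g x * \int[m2]_y `|h y|).
      by under eq_fun do rewrite mulrC; exact: L1Z.
    by case/integrableP.
  apply: ge0_le_integral => //=.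
  - by move=> x _; exact: integral_ge0.
  - apply: (measurable_fun_fubini_tonelli_F (fun z => `|f z|%:E)) => //=.
    exact/measurable_EFinP/measurableT_comp.
  - apply/measurable_EFinP; apply: measurableT_comp => //.
    apply: measurable_funM => //; exact: L1_measurable Lg.
  - move=> x _; rewrite -RintE; last exact: L1_abs.
    rewrite lee_fin normrM -[X in _ * X]ger0_norm ?Rintegral_ge0// normr_id.
    rewrite [X in _ <= _ * X]ger0_norm ?Rintegral_ge0//.
    rewrite -RintegralZl//; last exact: L1_abs.
    apply: le_Rintegral => //; [exact: L1_abs|exact/L1Z/L1_abs|].
    by move=> y _; rewrite (le_trans (fgh x y))// -normrM ler_norm.
have E1 : (fun x => \int[m2]_y (f (x, y))%:E)%E = EFin \o (fun x => \int[m2]_y f (x, y)).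
  by apply/funext => x; rewrite /= RintE.
have E2 : (fun y => \int[m1]_x (f (x, y))%:E)%E = EFin \o (fun y => \int[m1]_x f (x, y)).
  by apply/funext => x; rewrite /= RintE.
split.
- by rewrite -E1; exact: (integrable_fubini_F Lf).
- apply: (@L1_dom _ _ _ _ _ (fun y => (\int[m1]_x `|g x|) * `|h y|)).
  + have := measurable_fubini_G Lf.
    by rewrite /fubini_G/= E2 => /measurable_EFinP.
  + move=> y; rewrite mulrC -RintegralZl//; last exact: L1_abs.
    apply: Rint_abs_le => //; first exact/L1Z/L1_abs.
    by move=> x; rewrite (le_trans (fgh x y))// mulrC -normrM ler_norm.
  + exact/L1Z/L1_abs.
- have := Fubini Lf => /=.
  by rewrite E1 E2 /Rintegral => ->.
Qed.

End Fubini_real.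

Section rV_Rintegral.
Context {R : realType}.

Lemma L1_affine n (c : R) (h : 'rV[R]_n) (f : 'rV[R]_n -> R) :
  0 < c -> L1 (lebesgue_rV R n) f -> L1 (lebesgue_rV R n) (fun x => f (c *: x + h)).
Proof.
move=> c0 Lf; have mf := L1_measurable Lf.
apply/integrableP; split.
  apply/measurable_EFinP.
  exact: (measurableT_comp mf (measurable_affine c h)).
have /integrableP[_] := Lf.
rewrite -(@affine_integral R n c h (fun x => `|(f x)%:E|%E))//; last first.
  by apply/measurable_EFinP; exact: measurableT_comp.
rewrite muleC -lte_pdivlMr ?exprn_gt0//.
by rewrite gt0_mulye ?lte_fin ?invr_gt0 ?exprn_gt0.
Qed.

Lemma Rint_affine n (c : R) (h : 'rV[R]_n) (f : 'rV[R]_n -> R) :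
  0 < c -> L1 (lebesgue_rV R n) f ->
  c ^+ n * \int[lebesgue_rV R n]_x f (c *: x + h) = \int[lebesgue_rV R n]_x f x.
Proof.
move=> c0 Lf; have La := L1_abs Lf; have Lfa := L1D Lf La.
have P g : (forall x, 0 <= g x) -> L1 (lebesgue_rV R n) g ->
    c ^+ n * \int[lebesgue_rV R n]_x g (c *: x + h) = \int[lebesgue_rV R n]_x g x.
  move=> g0 Lg; have mg := L1_measurable Lg.
  apply: EFin_inj; rewrite EFinM !RintE//; last exact: L1_affine.
  rewrite -(@affine_integral R n c h (EFin \o g))//; exact/measurable_EFinP.
(* The identity for non-negative functions extends by linearity, [f] being the difference of
   [f + |f|] and [|f|]. *)
have E (g : 'rV[R]_n -> R) : g = (fun x : 'rV[R]_n => (g x + `|g x|) - `|g x|) by apply/funext => x; rewrite addrK.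
have P1 := P (fun x => f x + `|f x|) _ Lfa.
have P2 := P (fun x => `|f x|) _ La.
rewrite [in RHS](E f) RintegralB// -P1 -?P2//; last first.
  by move=> x; rewrite addrC -lerBlDr sub0r -normrN ler_norm.
rewrite -mulrBr -RintegralB//; last 2 first.
- exact: (L1_affine h c0 Lfa).
- exact: (L1_affine h c0 La).
by congr (_ * _); apply: eq_Rintegral => x _; rewrite addrK.
Qed.

Lemma L1_shift n (h : 'rV[R]_n) (f : 'rV[R]_n -> R) :
  L1 (lebesgue_rV R n) f -> L1 (lebesgue_rV R n) (fun x => f (x + h)).
Proof.
move=> Lf; have := @L1_affine n 1 h f ltr01 Lf.
by under eq_fun do rewrite scale1r.
Qed.

Lemma Rint_shift n (h : 'rV[R]_n) (f : 'rV[R]_n -> R) :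
  L1 (lebesgue_rV R n) f ->
  \int[lebesgue_rV R n]_x f (x + h) = \int[lebesgue_rV R n]_x f x.
Proof.
move=> Lf; rewrite -(@Rint_affine n 1 h f ltr01 Lf) expr1n mul1r.
by under [RHS]eq_Rintegral do rewrite scale1r.
Qed.

Lemma Rint_opp n (f : 'rV[R]_n -> R) :
  L1 (lebesgue_rV R n) f ->
  \int[lebesgue_rV R n]_x f (- x) = \int[lebesgue_rV R n]_x f x.
Proof.
move=> Lf; have mf := L1_measurable Lf.
rewrite /Rintegral; congr fine.
rewrite [LHS]integralE [RHS]integralE.
have := @opp_integral R n ((EFin \o f)^\+%E) => <-//; last first.
  by apply: measurable_funepos; exact/measurable_EFinP.
have := @opp_integral R n ((EFin \o f)^\-%E) => <-//; last first.
  by apply: measurable_funeneg; exact/measurable_EFinP.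
by congr (_ - _)%E; apply: eq_integral => x _; rewrite ?funeposE ?funenegE.
Qed.

Definition box n (M : R) : set 'rV[R]_n := [set x | forall i, - M <= x 0 i <= M].
Arguments box : clear implicits.

Lemma measurable_box0 n M : measurable (box n M).
Proof. exact: measurable_cbox. Qed.

Lemma lebesgue_box n (M : R) : 0 <= M -> lebesgue_rV R n (box n M) = ((2 * M) ^+ n)%:E.
Proof.
move=> M0; transitivity ((\prod_(i < n) (M - - M))%:E).
  by apply: (@lebesgue_rV_box R n (fun=> - M) (fun=> M)) => _; lra.
by rewrite prodr_const card_ord opprK mulrDl mul1r.
Qed.

Lemma L1_box n (M : R) : 0 <= M -> L1 (lebesgue_rV R n) (\1_(box n M)).
Proof.
move=> M0; apply/L1_ge0P => //; first by apply: measurable_indic; exact: measurable_box0.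
rewrite integral_indic//; last exact: measurable_box0.
by rewrite setIT [X in (X < _)%E](lebesgue_box n M0) ltry.
Qed.

Lemma L1_bounded n (M C : R) (f : 'rV[R]_n -> R) : 0 <= M -> measurable_fun setT f ->
  (forall x, `|f x| <= C * \1_(box n M) x) -> L1 (lebesgue_rV R n) f.
Proof. by move=> M0 mf H; apply: (L1_dom mf H); exact/L1Z/L1_box. Qed.

Lemma Rint_bounded n (M C : R) (f : 'rV[R]_n -> R) : 0 <= M -> measurable_fun setT f ->
  (forall x, `|f x| <= C * \1_(box n M) x) ->
  `|\int[lebesgue_rV R n]_x f x| <= C * (2 * M) ^+ n.
Proof.
move=> M0 mf H.
have -> : C * (2 * M) ^+ n = \int[lebesgue_rV R n]_x (C * \1_(box n M) x).
  rewrite RintegralZl//; last exact: L1_box.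
  congr (_ * _); apply: EFin_inj; rewrite RintE; last exact: L1_box.
  rewrite integral_indic//; last exact: measurable_box0.
  by rewrite setIT [RHS](lebesgue_box n M0).
apply: Rint_abs_le => //; exact/L1Z/L1_box.
Qed.

Lemma rV_cons0 n (a : R) (v : 'rV[R]_n) : rV_cons (a, v) 0 ord0 = a.
Proof.
rewrite /rV_cons (_ : ord0 = lshift n (ord0 : 'I_1)); last exact/val_inj.
by rewrite (row_mxEl (_%:M : 'rV_1)) mxE eqxx mulr1n.
Qed.

Lemma rV_consS n (a : R) (v : 'rV[R]_n) (i : 'I_n) : rV_cons (a, v) 0 (lift ord0 i) = v 0 i.
Proof.
rewrite /rV_cons (_ : lift ord0 i = rshift 1 i); last exact/val_inj.
by rewrite (row_mxEr (_%:M : 'rV_1)).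
Qed.

Lemma integral_prod n (g : R -> R) : measurable_fun setT g -> (forall x, 0 <= g x) ->
  (\int[lebesgue_rV R n]_x (\prod_i g (x 0 i))%:E = (\int[@lebesgue_measure R]_x (g x)%:E) ^+ n)%E.
Proof.
move=> mg g0; elim: n => [|n IH].
  by rewrite integral_rV0 big_ord0.
have mp m : measurable_fun setT (fun x : 'rV[R]_m => (\prod_i g (x 0 i))%:E).
  apply/measurable_EFinP; apply: measurable_prod => i _.
  exact: (measurableT_comp mg (measurable_rV_coord i)).
rewrite integral_rVS//; last by move=> x; rewrite lee_fin prodr_ge0.
under eq_integral => a _.
  under eq_integral => v _.
    rewrite big_ord_recl EFinM rV_cons0.
    under eq_bigr do rewrite rV_consS.
    over.
  rewrite ge0_integralZl//; first last.
  - by rewrite lee_fin.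
  - by move=> x _; rewrite lee_fin prodr_ge0.
  - exact: mp.
  over.
rewrite IH expeS muleC -ge0_integralZl//.
- by apply: eq_integral => x _; rewrite muleC.
- exact/measurable_EFinP.
- by move=> x _; rewrite lee_fin.
- by apply: expe_ge0; apply: integral_ge0 => x _; rewrite lee_fin.
Qed.

(** A product weight, so that its integral factors over the coordinates; its inverse is a
    polynomial, hence reachable by multiplications by coordinates. It bounds both the cosine
    transforms and, at [t *: h], the correlation kernel. *)
Definition decay n (x : 'rV[R]_n) : R := \prod_i (1 + x 0 i ^+ 2)^-1.

Lemma decay_gt0 n (x : 'rV[R]_n) : 0 < decay x.
Proof. by apply: prodr_gt0 => i _; rewrite invr_gt0 ltr_wpDr// sqr_ge0. Qed.

Lemma L1_decay n : L1 (lebesgue_rV R n) (@decay n).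
Proof.
have g0 (x : R) : 0 <= (1 + x ^+ 2)^-1 by rewrite invr_ge0 addr_ge0// sqr_ge0.
have mg : measurable_fun setT (fun x : R => (1 + x ^+ 2)^-1).
  by apply: continuous_measurable_fun; exact: continuous_oneDsqrV.
apply/L1_ge0P.
- apply: measurable_prod => i _; exact: (measurableT_comp mg (measurable_rV_coord i)).
- by move=> x; apply: prodr_ge0.
rewrite (_ : (\int[_]_x _)%E = (\int[@lebesgue_measure R]_x ((1 + x ^+ 2)^-1)%:E)%E ^+ n)%E; last exact: integral_prod.
suff : (\int[@lebesgue_measure R]_x ((1 + x ^+ 2)^-1)%:E)%E \is a fin_num.
  by move=> H; rewrite ltey_eq; apply/orP; left; exact: fin_numX.
rewrite ge0_fin_numE; last by apply: integral_ge0 => x _; rewrite lee_fin.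
rewrite (@ge0_symfun_integralT _ (fun x => (1 + x ^+ 2)^-1))//.
  rewrite (_ : mkset _ = `[0, +oo[%classic); last by apply/seteqP; split=> x /=; rewrite in_itv/= andbT.
  by rewrite [X in (_ * X)%E]integral0y_oneDsqr -EFinM ltry.
- exact: continuous_oneDsqrV.
- by move=> x; rewrite /= sqrrN.
Qed.

(** By continuity [f] is at least [f x0 / 2] on a box around [x0], which has positive volume. *)
Lemma Rint_gt0 n (f : 'rV[R]_n -> R) (x0 : 'rV[R]_n) : measurable_fun setT f -> (forall x, 0 <= f x) ->
  {for x0, continuous f} -> 0 < f x0 -> (0 < \int[lebesgue_rV R n]_x (f x)%:E)%E.
Proof.
move=> mf f0 cf fx0.
have [e e0 He] : exists2 e, 0 < e & forall x, ball x0 e x -> f x0 / 2 <= f x.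
  have : nbhs x0 (f @^-1` [set y | f x0 / 2 < y]).
    by apply: cvgr_gt cf _ _; lra.
  by move=> /nbhs_ballP[e e0 H]; exists e => // x /H /= /ltW.
pose B : set 'rV[R]_n := [set x | forall i, x0 0 i - e / 2 <= x 0 i <= x0 0 i + e / 2].
have mB : measurable B by exact: measurable_cbox.
apply: (@lt_le_trans _ _ (\int[lebesgue_rV R n]_x (f x0 / 2 * \1_B x)%:E)%E).
  under eq_integral do rewrite EFinM.
  rewrite ge0_integralZl//; last 2 first.
  - exact/measurable_EFinP/measurable_indic.
  - by rewrite lee_fin; lra.
  rewrite mule_gt0 ?lte_fin//; first by lra.
  rewrite integral_indic// setIT.
  have := @lebesgue_rV_box R n (fun i => x0 0 i - e / 2) (fun i => x0 0 i + e / 2).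
  move=> vB; rewrite [X in (_ < X)%E]vB; last by move=> i; lra.
  by rewrite lte_fin; apply: prodr_gt0 => i _; lra.
apply: ge0_le_integral => //.
- by move=> x _; rewrite lee_fin mulr_ge0// ltW//; lra.
- apply/measurable_EFinP; apply: measurable_funM => //; exact/measurable_indic.
- exact/measurable_EFinP.
move=> x _; rewrite lee_fin indicE; case: (boolP (x \in B)) => [|_]; last by rewrite mulr0.
rewrite inE => Bx; rewrite mulr1; apply: He; split => // i j; rewrite ord1 /ball/=.
have := Bx j; rewrite ltr_norml; lra.
Qed.

End rV_Rintegral.
Arguments box {R} n M.

(** * Differential calculus *)

Section line_derivative.
Context {R : realType} {V : normedModType R}.
Implicit Types (f : V -> R) (x v : V).

Lemma is_derive_lineP f x v df :
  is_derive x v f df <-> is_derive (0 : R) 1 (fun h => f (h *: v + x)) df.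
Proof.
have E : 'D_v f x = 'D_1 (fun h : R => f (h *: v + x)) 0.
  rewrite /derive; set g1 := fun h => h^-1 *: _; set g2 := fun h => h^-1 *: _.
  suff -> : g1 = g2 by [].
  by rewrite funeqE /g1 /g2 => h /=; rewrite addr0 scale0r add0r [_%:A]mulr1.
split=> -[d1 d2]; apply: DeriveDef.
- exact: (derivable1P _ _ _).1.
- by rewrite -E.
- exact: (derivable1P _ _ _).2.
- by rewrite E.
Qed.

Lemma is_derive_line f x v (s df : R) :
  is_derive (s *: v + x) v f df -> is_derive s 1 (fun h => f (h *: v + x)) df.
Proof.
move=> /is_derive_lineP H.
have -> : (fun h => f (h *: v + x)) = (fun h => f (h *: v + (s *: v + x))) \o (fun h => h - s).
  by apply/funext => h /=; rewrite addrA -scalerDl subrK.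
have H1 : is_derive s (1 : R) (fun h : R => h - s) 1.
  by apply: is_derive_eq; rewrite subr0.
rewrite -[df]mulr1; apply: is_derive1_comp.
by rewrite subrr.
Qed.

Lemma is_derive_comp1 f (g : R -> R) x v df dg :
  is_derive x v f df -> is_derive (f x) 1 g dg -> is_derive x v (g \o f) (dg * df).
Proof.
move=> /is_derive_lineP Hf Hg; apply/is_derive_lineP.
have -> : (fun h => (g \o f) (h *: v + x)) = g \o (fun h => f (h *: v + x)) by [].
apply: is_derive1_comp.
by rewrite scale0r add0r.
Qed.

Lemma is_derive_scale f x v df (c : R) :
  is_derive x v f df -> is_derive x (c *: v) f (c * df).
Proof.
move=> /is_derive_lineP H; apply/is_derive_lineP.
have -> : (fun h => f (h *: (c *: v) + x)) = (fun h => f (h *: v + x)) \o (fun h => h * c).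
  by apply/funext => h /=; rewrite scalerA.
have H1 : is_derive (0 : R) (1 : R) (fun h : R => h * c) c.
  by apply: is_derive_eq; rewrite scaler0 add0r [_ *: _]mulr1.
rewrite mulrC; apply: is_derive1_comp.
by rewrite mul0r.
Qed.

Lemma is_deriveV f x v df : f x != 0 -> is_derive x v f df ->
  is_derive x v (fun y => (f y)^-1) (- (df * (f x)^-1 * (f x)^-1)).
Proof.
move=> fx0 [d1 <-]; apply: DeriveDef; first exact: derivableV.
by rewrite deriveV// /GRing.scale /=; field.
Qed.

(** Clearing the denominator replaces the punctured limit of difference quotients by an estimate
    that also holds at [h = 0]. *)
Lemma is_derive_epsP f x v d : is_derive x v f d <->
  forall e : R, 0 < e -> \forall h \near (0 : R), `|f (h *: v + x) - f x - h * d| <= e * `|h|.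
Proof.
have E (h : R) : h != 0 -> forall e : R, (`|d - h^-1 *: (f (h *: v + x) - f x)| <= e) =
    (`|f (h *: v + x) - f x - h * d| <= e * `|h|).
  move=> h0 e; rewrite -ler_pdivrMr ?normr_gt0// -normfV -normrM distrC.
  by rewrite mulrBl mulrC [h * d]mulrC mulfK.
have P : (h^-1 *: (f (h *: v + x) - f x) @[h --> 0^'] --> d) <->
  forall e : R, 0 < e -> \forall h \near (0 : R), `|f (h *: v + x) - f x - h * d| <= e * `|h|.
  split.
    move=> /cvgrPdist_le H e e0; have := H e e0; rewrite near_withinE.
    apply: filterS => h Hh; have [->|h0] := eqVneq h 0.
      by rewrite scale0r add0r subrr mul0r subrr !normr0 mulr0.
    by rewrite -E//; exact: Hh.
  move=> H; apply/cvgrPdist_le => e e0; have := H e e0.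
  rewrite near_withinE.
  by apply: filterS => h Hh h0; rewrite E.
split.
  move=> [/cvg_ex[l Hl] Hd]; apply/P.
  have /cvg_lim := Hl; rewrite -[X in X = _]/('D_v f x) Hd => /(_ (@Rhausdorff R)) ->.
  exact: Hl.
by move=> /P H; apply: DeriveDef; [apply/cvg_ex; exists d|apply/cvg_lim].
Qed.

Lemma is_derive_near f g x v df :
  (\near x, f x = g x) -> is_derive x v f df -> is_derive x v g df.
Proof. exact: near_eq_is_derive. Qed.

Lemma is_derive_open (U : set V) f g x v df : open U -> U x ->
  (forall y, U y -> f y = g y) -> is_derive x v f df -> is_derive x v g df.
Proof.
move=> oU Ux fg; apply: is_derive_near.
by apply: filterS (open_nbhs_nbhs (conj oU Ux)) => y /fg.
Qed.

Lemma is_derive_uniq f x v d1 d2 :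
  is_derive x v f d1 -> is_derive x v f d2 -> d1 = d2.
Proof. by move=> [_ <-] [_ <-]. Qed.

Lemma mvt_line f y v (df : R -> R) :
  (forall s, 0 <= s <= 1 -> is_derive (s *: v + y) v f (df s)) ->
  exists2 s, 0 <= s <= 1 & f (v + y) - f y = df s.
Proof.
move=> H.
have H1 (s : R) : s \in `[0, 1]%R -> is_derive s (1 : R) (fun h => f (h *: v + y)) (df s).
  by rewrite in_itv/= => ?; apply: is_derive_line; exact: H.
pose g : R -> R := fun h => f (h *: v + y).
have le01 : (0 : R) <= 1 by [].
have D (s : R) : s \in `]0, 1[%R -> is_derive s (1 : R) g (df s).
  by move=> s01; apply: H1; move: s01; rewrite !in_itv/= => /andP[? ?]; rewrite !ltW.
have C : {within `[0, 1], continuous g}.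
  by apply: derivable_within_continuous => s s01; have [] := H1 s s01.
have [s] := MVT_segment le01 D C.
rewrite in_itv/= => s01; rewrite /g subr0 mulr1 scale1r scale0r add0r => E.
by exists s.
Qed.

End line_derivative.

Section rV_norm.
Context {R : realType}.

Lemma rV_norm_le n (x : 'rV[R]_n) (M : R) : 0 <= M ->
  (`|x| <= M) <-> (forall i, `|x 0 i| <= M).
Proof.
move=> M0; rewrite /Num.Def.normr/= mx_normrE; split => [H i|H].
  by apply: le_trans H; exact: (le_bigmax _ (fun ij : 'I_1 * 'I_n => `|x ij.1 ij.2|) (ord0, i)).
by apply: bigmax_le => // -[i j] _ /=; rewrite ord1 H.
Qed.

Lemma rV_coord_le n (x : 'rV[R]_n) i : `|x 0 i| <= `|x|.
Proof. by have /rV_norm_le := lexx `|x|; apply. Qed.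

Lemma rV_norm_lt n (x : 'rV[R]_n) (M : R) : 0 < M ->
  (`|x| < M) <-> (forall i, `|x 0 i| < M).
Proof.
move=> M0; rewrite /Num.Def.normr/= mx_normrE; split => [H i|H].
  by apply: le_lt_trans H; exact: (le_bigmax _ (fun ij : 'I_1 * 'I_n => `|x ij.1 ij.2|) (ord0, i)).
by apply: bigmax_lt => // -[i j] _ /=; rewrite ord1 H.
Qed.

Lemma rV_normM_sum n (u v : 'rV[R]_n) (C : R) :
  (forall i, `|v 0 i| <= C) -> `|\sum_i u 0 i * v 0 i| <= n%:R * `|u| * C.
Proof.
move=> H; apply: le_trans (ler_norm_sum _ _ _) _.
have -> : n%:R * `|u| * C = \sum_(i < n) (`|u| * C) by rewrite sumr_const card_ord -mulrA mulr_natl.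
by apply: ler_sum => i _; rewrite normrM ler_pM// rV_coord_le.
Qed.

End rV_norm.

(** * Functions with continuous partial derivatives: expansion and chain rule *)

Section C1_differentiable.
Context {R : realType} {n : nat}.
Implicit Types (f : 'rV[R]_n -> R) (U : set 'rV[R]_n).

Definition grad_lin f (x : 'rV[R]_n) (h : 'rV[R]_n) : R :=
  \sum_i h 0 i * 'D_(delta_mx 0 i) f x.

(** The increment is split into legs that move one coordinate at a time; on each leg the mean value
    theorem gives a partial derivative at a point near [x], which differs from its value at [x] by
    at most [e / n.+1]. *)
Lemma C1_expansion U f x : open U -> U x ->
  (forall y i, U y -> derivable f y (delta_mx 0 i)) ->
  (forall i, {for x, continuous ('D_(delta_mx 0 i) f)}) ->
  forall e : R, 0 < e -> \forall h \near (0 : 'rV[R]_n),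
   `|f (h + x) - f x - grad_lin f x h| <= e * `|h|.
Proof.
move=> oU Ux df cf e e0.
have [r r0 Hr] : exists2 r, 0 < r & forall y, ball x r y -> U y /\
    forall i, `|'D_(delta_mx 0 i) f y - 'D_(delta_mx 0 i) f x| <= e / n.+1%:R.
  have : \forall y \near x, U y /\
    forall i, `|'D_(delta_mx 0 i) f y - 'D_(delta_mx 0 i) f x| <= e / n.+1%:R.
    near=> y; split; first by near: y; exact: open_nbhs_nbhs.
    near: y; apply: filter_forall => i.
    have /cvgrPdistC_le := cf i; apply; rewrite divr_gt0//.
  by move=> /nbhs_ballP[r r0 H]; exists r.
near=> h.
have hr : `|h| < r by near: h; apply/nbhs_ballP; exists r => //= y; rewrite -ball_normE/= sub0r normrN.
(* [hk k] keeps the first [k] coordinates of [h], so it runs from 0 to [h], one coordinate per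
   step. *)
pose hk k : 'rV[R]_n := \row_j (if (j < k)%N then h 0 j else 0).
have hk0 : hk 0%N = 0 by apply/rowP => j; rewrite !mxE ltn0.
have hkn : hk n = h by apply/rowP => j; rewrite !mxE ltn_ord.
have hkS (k : 'I_n) : hk k.+1 = h 0 k *: delta_mx 0 k + hk k.
  apply/rowP => j; rewrite !mxE eqxx/=; have [->|jk] := eqVneq j k.
    by rewrite ltnSn ltnn mulr1 addr0.
  by rewrite ltnS leq_eqVlt [_ == _ :> nat](negbTE jk) /= mulr0 add0r.
have step (k : 'I_n) : `|f (hk k.+1 + x) - f (hk k + x) - h 0 k * 'D_(delta_mx 0 k) f x| <= e / n.+1%:R * `|h|.
  have inb s : 0 <= s <= 1 -> ball x r (s *: (h 0 k *: delta_mx 0 k) + (hk k + x)).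
    move=> s01; rewrite -ball_normE /ball_/= addrA opprD addrCA subrr addr0 normrN.
    apply: le_lt_trans hr; apply/rV_norm_le => // j; rewrite !mxE eqxx/=.
    have [->|jk] := eqVneq j k.
      rewrite mulr1 ltnn addr0 normrM (le_trans _ (rV_coord_le h k))//.
      by rewrite ler_piMl// ger0_norm; case/andP: s01.
    rewrite /= !mulr0 add0r; case: ifP => _; first exact: rV_coord_le.
    by rewrite normr0.
  have [|s s01 E] := @mvt_line R _ f (hk k + x) (h 0 k *: delta_mx 0 k)
      (fun s => h 0 k * 'D_(delta_mx 0 k) f (s *: (h 0 k *: delta_mx 0 k) + (hk k + x))).
    move=> s s01; have [Uy _] := Hr _ (inb s s01).
    exact/is_derive_scale/derivableP/df.
  rewrite hkS -(addrA (h 0 k *: _)) E -mulrBr normrM mulrC ler_pM//; last exact: rV_coord_le.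
  by have [_] := Hr _ (inb s s01); exact.
have -> : f (h + x) - f x - grad_lin f x h =
    \sum_(k < n) (f (hk k.+1 + x) - f (hk k + x) - h 0 k * 'D_(delta_mx 0 k) f x).
  rewrite sumrB /grad_lin; congr (_ - _).
  rewrite -(big_mkord xpredT (fun k => f (hk k.+1 + x) - f (hk k + x))).
  by rewrite telescope_sumr// hkn hk0 add0r.
apply: le_trans (ler_norm_sum _ _ _) _.
apply: le_trans (ler_sum _ (fun k _ => step k)) _.
rewrite sumr_const card_ord -mulrnAl ler_wpM2r// -mulr_natr -mulrA ger_pMr//.
by rewrite mulrC ler_pdivrMr// mul1r ler_nat.
Unshelve. all: by end_near. Qed.

Lemma C1_chain (W : normedModType R) U f (g : W -> 'rV[R]_n) (x v : W) (dg : 'I_n -> R) :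
  open U -> U (g x) ->
  (forall y i, U y -> derivable f y (delta_mx 0 i)) ->
  (forall i, {for g x, continuous ('D_(delta_mx 0 i) f)}) ->
  (forall i, is_derive x v (fun y => g y 0 i) (dg i)) ->
  is_derive x v (f \o g) (\sum_i dg i * 'D_(delta_mx 0 i) f (g x)).
Proof.
move=> oU Ux df cf Hg; apply/is_derive_epsP => e e0.
(* [D] bounds the increment of [g] relative to [h], and [S] the gradient of [f]; the added 1 makes
   both positive. Half of [e] goes to the expansion of [f], half to that of [g]. *)
pose D : R := 1 + \sum_i `|dg i|.
have D1 : 1 <= D by rewrite lerDl sumr_ge0.
have D0 : 0 < D by rewrite (lt_le_trans _ D1).
pose S : R := 1 + \sum_i `|'D_(delta_mx 0 i) f (g x)|.
have S1 : 1 <= S by rewrite lerDl sumr_ge0.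
have S0 : 0 < S by rewrite (lt_le_trans _ S1).
have e10 : 0 < e / 2 / D by rewrite !divr_gt0.
have /nbhs_ballP[r /= r0 Hr] := C1_expansion oU Ux df cf e10.
pose e' := Num.min 1 (e / 2 / S).
have e'0 : 0 < e' by rewrite lt_min ltr01/= !divr_gt0.
near=> h.
have Hk : forall i, `|(g (h *: v + x) - g x) 0 i - h * dg i| <= e' * `|h|.
  near: h; apply: filter_forall => i.
  have /is_derive_epsP/(_ e' e'0) := Hg i.
  by apply: filterS => h; rewrite !mxE.
pose k := g (h *: v + x) - g x; rewrite -/k in Hk.
have kD : `|k| <= D * `|h|.
  apply/rV_norm_le => [|i]; first by rewrite mulr_ge0// ltW.
  rewrite -(subrK (h * dg i) (k 0 i)) (le_trans (ler_normD _ _))//.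
  rewrite mulrDl lerD//.
    by rewrite (le_trans (Hk i))// ler_wpM2r// ge_min lexx.
  rewrite normrM mulrC ler_wpM2r// (bigD1 i)//= lerDl sumr_ge0//.
have kr : `|k| < r.
  apply: le_lt_trans kD _; rewrite -ltr_pdivlMl//.
  near: h; apply/nbhs_ballP; exists (D^-1 * r) => /=; first by rewrite mulr_gt0// invr_gt0.
  by move=> y; rewrite -ball_normE/= sub0r normrN.
have := Hr k; rewrite -ball_normE/= sub0r normrN => /(_ kr).
rewrite /k subrK -/k => Hf.
rewrite /= -(subrKA (grad_lin f (g x) k)).
apply: le_trans (ler_normD _ _) _.
rewrite [leRHS](_ : _ = e / 2 * `|h| + e / 2 * `|h|); last by field.
apply: lerD.
  apply: le_trans Hf _; rewrite -ler_pdivlMl//.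
  rewrite [leRHS](_ : _ = D * `|h|)//; field.
  by rewrite !lt0r_neq0.
rewrite /grad_lin mulr_sumr -sumrB.
under eq_bigr do rewrite mulrA -mulrBl.
apply: le_trans (ler_norm_sum _ _ _) _.
apply: (@le_trans _ _ (\sum_i (e / 2 / S * `|h|) * `|'D_(delta_mx 0 i) f (g x)|)).
  apply: ler_sum => i _; rewrite normrM ler_wpM2r// (le_trans (Hk i))// ler_wpM2r//.
  by rewrite ge_min lexx orbT.
rewrite -mulr_sumr mulrAC ler_wpM2r// -[leRHS](divfK (lt0r_neq0 S0)) ler_wpM2l//.
  by rewrite ltW// !divr_gt0.
by rewrite lerDr.
Unshelve. all: by end_near. Qed.

Lemma is_derive_coord (x v : 'rV[R]_n) i : is_derive x v (fun y : 'rV[R]_n => y 0 i) (v 0 i).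
Proof.
apply/is_derive_epsP => e e0; near=> h.
by rewrite !mxE addrK subrr normr0 mulr_ge0// ltW.
Unshelve. all: by end_near. Qed.

Lemma C1_is_derive U f x v : open U -> U x ->
  (forall y i, U y -> derivable f y (delta_mx 0 i)) ->
  (forall i, {for x, continuous ('D_(delta_mx 0 i) f)}) ->
  is_derive x v f (\sum_i v 0 i * 'D_(delta_mx 0 i) f x).
Proof.
move=> oU Ux df cf.
exact: (@C1_chain _ U f id x v (fun i => v 0 i) oU Ux df cf (is_derive_coord x v)).
Qed.

End C1_differentiable.

Section derive_rules.
Context {R : realType} {V : normedModType R}.
Implicit Types (f g : V -> R) (x v : V).

Lemma is_derive_add f g x v a b : is_derive x v f a -> is_derive x v g b ->
  is_derive x v (fun y => f y + g y) (a + b).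
Proof. by move=> Hf Hg; exact: is_deriveD. Qed.

Lemma is_derive_mul f g x v a b : is_derive x v f a -> is_derive x v g b ->
  is_derive x v (fun y => f y * g y) (a * g x + f x * b).
Proof.
move=> Hf Hg; apply: (is_derive_eq (is_deriveM Hf Hg)).
by rewrite addrC; congr (_ + _); rewrite -[LHS]/(_ * _) mulrC.
Qed.

Lemma is_derive_cmul f x v a (c : R) : is_derive x v f a ->
  is_derive x v (fun y => c * f y) (c * a).
Proof. by move=> Hf; exact: is_deriveZ. Qed.

Lemma is_derive_const x v (c : R) : is_derive x v (fun=> c) (0 : R).
Proof. exact: is_derive_cst. Qed.

Lemma is_derive_sum_seq (I : Type) (r : seq I) (F : I -> V -> R) x v (dF : I -> R) :
  (forall i, is_derive x v (F i) (dF i)) ->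
  is_derive x v (fun y => \sum_(i <- r) F i y) (\sum_(i <- r) dF i).
Proof.
move=> H; elim: r => [|i r IH].
  rewrite big_nil; under eq_fun do rewrite big_nil; exact: is_derive_const.
by rewrite big_cons; under eq_fun do rewrite big_cons; exact: is_derive_add.
Qed.

Lemma is_derive_translate f x v a h : is_derive (x + h) v f a ->
  is_derive x v (fun y => f (y + h)) a.
Proof.
move=> /is_derive_lineP H; apply/is_derive_lineP.
by under eq_fun do rewrite -addrA.
Qed.

End derive_rules.

Section D1n_class.
Context {R : realType}.
Implicit Types g h : R -> R.

(** One-variable counterpart of [Cn], on the whole line, for the outer function of a composition. *)
Fixpoint D1n k (g : R -> R) : Prop :=
  continuous g /\
  if k is m.+1 then
    exists g' : R -> R, (forall x : R, is_derive x (1 : R) g (g' x)) /\ D1n m g'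
  else True.

Lemma D1nD k g h : D1n k g -> D1n k h -> D1n k (fun x => g x + h x).
Proof.
elim: k g h => [|k IH] f g [cf Df] [cg Dg];
  (split; first by move=> x; apply: cvgD; [exact: (cf x)|exact: (cg x)]) => //.
have [f' [Hf' Cf']] := Df; have [g' [Hg' Cg']] := Dg.
exists (fun x => f' x + g' x); split; last exact: IH.
by move=> x; exact: (is_derive_add (Hf' x) (Hg' x)).
Qed.

Lemma D1nZ k g c : D1n k g -> D1n k (fun x => c * g x).
Proof.
elim: k g => [|k IH] f [cf Df];
  (split; first by move=> x; apply: cvgM; [exact: cvg_cst|exact: cf]) => //.
have [f' [Hf' Cf']] := Df.
exists (fun x => c * f' x); split; last exact: IH.
by move=> x; apply: is_derive_cmul.
Qed.

Lemma is_derive_cos_shift (th x : R) : is_derive x 1 (fun y : R => cos (y + th)) (cos (x + (th + pi / 2))).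
Proof.
have H : is_derive x (1 : R) (fun y : R => y + th) 1.
  by apply: is_derive_eq; rewrite addr0.
have := @is_derive1_comp R (@cos R) _ x _ _ (is_derive_cos _) H.
by rewrite mulr1 addrA cosDpihalf.
Qed.

(** Differentiation adds [pi / 2] to the phase, so the induction runs over all phases at once. *)
Lemma D1n_cos k (th : R) : D1n k (fun x => cos (x + th)).
Proof.
have c t : continuous (fun x : R => cos (x + t)).
  move=> x; apply: (@continuous_comp _ _ _ (fun x => x + t) (@cos R)).
    by apply: cvgD; [exact: cvg_id|exact: cvg_cst].
  exact: continuous_cos.
elim: k th => [|k IH] th; first by split => //; exact: c.
split; first exact: c.
exists (fun x => cos (x + (th + pi / 2))); split => // x.
exact: is_derive_cos_shift.
Qed.

End D1n_class.

Section Cn_class.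
Context {R : realType} {n : nat}.
Implicit Types (f g : 'rV[R]_n -> R) (U : set 'rV[R]_n).

(* [Cn k U f] is the finite-order version of [smooth_on U f]; quantifying the
   derivatives existentially makes it stable under algebraic operations by
   induction on the order. *)
Fixpoint Cn k U f : Prop :=
  (forall x, U x -> {for x, continuous f}) /\
  if k is m.+1 then
    forall i, exists f', (forall x, U x -> is_derive x (delta_mx 0 i) f (f' x)) /\ Cn m U f'
  else True.

Lemma for_continuous_near f g x : (\near x, f x = g x) -> {for x, continuous f} ->
  {for x, continuous g}.
Proof.
move=> fg cf; have fgx := nbhs_singleton fg.
rewrite /prop_for /continuous_at -fgx.
by apply: cvg_trans cf; exact: (near_eq_cvg fg).
Qed.

Lemma Cn_ext k U f g : open U -> (forall x, U x -> f x = g x) -> Cn k U f -> Cn k U g.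
Proof.
move=> oU; elim: k f g => [|k IH] f g fg [c D].
  split => // x Ux; apply: for_continuous_near (c x Ux).
  by apply: filterS (open_nbhs_nbhs (conj oU Ux)) => y /fg.
split.
  move=> x Ux; apply: for_continuous_near (c x Ux).
  by apply: filterS (open_nbhs_nbhs (conj oU Ux)) => y /fg.
move=> i; have [f' [Hf' Cf']] := D i; exists f'; split => // x Ux.
exact: (is_derive_open oU Ux fg (Hf' x Ux)).
Qed.

Lemma CnS k U f : Cn k.+1 U f -> Cn k U f.
Proof.
elim: k f => [|k IH] f [c D]; split => // i.
by have [f' [Hf' Cf']] := D i; exists f'; split => //; exact: IH.
Qed.

(** On an open set an existentially given derivative coincides with ['D], so each partial derivative
    costs exactly one order. *)
Lemma Cn_partials m k U f : open U -> forall s, (size s <= m)%N -> Cn (m + k) U f ->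
  Cn (m - size s + k) U (partials s f).
Proof.
move=> oU; elim=> [|i s IH] /= sm Cf; first by rewrite subn0.
have := IH (ltnW sm) Cf.
rewrite (_ : m - size s = (m - (size s).+1).+1)%N; last by lia.
rewrite addSn => -[c D]; have [f' [Hf' Cf']] := D i.
by apply: Cn_ext Cf' => // x /Hf' [_ ->].
Qed.

Lemma Cn_smooth U f : open U -> (forall k, Cn k U f) -> smooth_on U f.
Proof.
move=> oU Cf s x Ux.
have := Cn_partials (m := size s) (k := 1) oU (leqnn _) (Cf _).
rewrite subnn add0n => -[c D]; split; first exact: c.
by move=> i; have [f' [Hf' _]] := D i; have [] := Hf' x Ux.
Qed.

(** Stated for iterated partials so that the induction on the order can pass from [s] to
    [i :: s]. *)
Lemma smooth_Cn U f s k : smooth_on U f -> Cn k U (partials s f).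
Proof.
move=> sf; elim: k s => [|k IH] s.
  by split => // x Ux; have [] := sf s x Ux.
split; first by move=> x Ux; have [] := sf s x Ux.
move=> i; exists (partials (i :: s) f); split => // x Ux.
by have [_ D] := sf s x Ux; exact: derivableP.
Qed.

Lemma Cn_cst k U (c : R) : Cn k U (fun=> c).
Proof.
elim: k c => [|k IH] c; (split; first by move=> x _; exact: cst_continuous) => // i.
by exists (fun=> 0); split => // x _; exact: is_derive_const.
Qed.

Lemma Cn_coord k U i : Cn k U (fun x => x 0 i).
Proof.
case: k => [|k]; (split; first by move=> x _; exact: coord_continuous) => // j.
exists (fun=> (delta_mx 0 j : 'rV[R]_n) 0 i); split; last exact: Cn_cst.
by move=> x _; exact: is_derive_coord.
Qed.

Lemma CnD k U f g : Cn k U f -> Cn k U g -> Cn k U (fun x => f x + g x).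
Proof.
elim: k f g => [|k IH] f g [cf Df] [cg Dg];
  (split; first by move=> x Ux; apply: continuousD; [exact: (cf x Ux)|exact: (cg x Ux)]) => // i.
have [f' [Hf' Cf']] := Df i; have [g' [Hg' Cg']] := Dg i.
exists (fun x => f' x + g' x); split; last exact: IH.
by move=> x Ux; apply: is_derive_add; [exact: Hf'|exact: Hg'].
Qed.

Lemma CnM k U f g : Cn k U f -> Cn k U g -> Cn k U (fun x => f x * g x).
Proof.
elim: k f g => [|k IH] f g Cf Cg; have [cf Df] := Cf; have [cg Dg] := Cg;
  (split; first by move=> x Ux; apply: continuousM; [exact: (cf x Ux)|exact: (cg x Ux)]) => // i.
have [f' [Hf' Cf']] := Df i; have [g' [Hg' Cg']] := Dg i.
exists (fun x => f' x * g x + f x * g' x); split.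
  by move=> x Ux; apply: is_derive_mul; [exact: Hf'|exact: Hg'].
by apply: CnD; apply: IH => //; exact: CnS.
Qed.

Lemma Cn_sum k U (I : Type) (r : seq I) (F : I -> 'rV[R]_n -> R) :
  (forall i, Cn k U (F i)) -> Cn k U (fun x => \sum_(i <- r) F i x).
Proof.
move=> H; elim: r => [|i r IH].
  by under eq_fun do rewrite big_nil; exact: Cn_cst.
by under eq_fun do rewrite big_cons; exact: CnD.
Qed.

Lemma Cn_comp k U f (g : R -> R) : D1n k g -> Cn k U f -> Cn k U (fun x => g (f x)).
Proof.
elim: k f g => [|k IH] f g Cg Cf; have [cf Df] := Cf; have [cg Dg] := Cg.
  by split=> // x Ux; apply: continuous_comp; [exact: (cf x Ux)|exact: cg].
split; first by move=> x Ux; apply: continuous_comp; [exact: (cf x Ux)|exact: cg].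
move=> i; have [f' [Hf' Cf']] := Df i; have [g' [Hg' Cg']] := Dg.
exists (fun x => g' (f x) * f' x); split.
  by move=> x Ux; exact: (is_derive_comp1 (Hf' x Ux) (Hg' (f x))).
by apply: CnM => //; apply: IH => //; exact: CnS.
Qed.

End Cn_class.

(** * A smooth function vanishing exactly on a half-line *)

Section bump.
Context {R : realType}.

(* [flat 0] is the function exp(-1/x); the other [flat k] span its derivatives. *)
Definition flat k (x : R) : R := if 0 < x then x^-1 ^+ k * expR (- x^-1) else 0.

(** The exponential [exp(1/x)] dominates its Taylor term of degree [k + 2]. The factor [x ^+ 2] is
    what makes the derivative at 0 vanish. *)
Lemma flat_le k (x : R) : `|flat k x| <= (k.+2)`!%:R * x ^+ 2.
Proof.
rewrite /flat; case: ifPn => x0; last by rewrite normr0 mulr_ge0// sqr_ge0.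
have xV : 0 <= x^-1 by rewrite invr_ge0 ltW.
rewrite ger0_norm; last by rewrite mulr_ge0 ?expR_ge0// exprn_ge0.
have f0 : 0 < (k.+2)`!%:R :> R by rewrite ltr0n fact_gt0.
have H : x^-1 ^+ k.+2 / (k.+2)`!%:R <= expR x^-1.
  by apply: le_trans (expR_ge1Dxn k.+1 xV); rewrite lerDr.
rewrite expRN ler_pdivrMr ?expR_gt0//.
apply: le_trans (ler_wpM2l _ H); last by rewrite mulr_ge0 ?sqr_ge0// ltW.
rewrite -addn2 exprD exprVn le_eqVlt; apply/orP; left; apply/eqP; field.
by rewrite addn2 (lt0r_neq0 f0) (lt0r_neq0 x0) expf_neq0// lt0r_neq0.
Qed.

Lemma is_derive_pow k (x : R) : is_derive x 1 (fun y : R => y ^+ k) (k%:R * x ^+ k.-1).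
Proof.
elim: k => [|k IH]; first by rewrite mul0r; under eq_fun do rewrite expr0; exact: is_derive_cst.
have := is_derive_mul (is_derive_id x (1 : R)) IH.
under eq_fun do rewrite -exprS.
move=> H; apply: is_derive_eq H _ => /=.
case: k {IH} => [|k] /=; first by rewrite !expr0; ring.
by rewrite -[k.+2]addn1 natrD exprS; ring.
Qed.

(** With [y = 1/x] one has [y' = - y^2], so the derivative of [y^k e^(-y)] is
    [y^(k+2) e^(-y) - k y^(k+1) e^(-y)]; at 0 the quadratic bound gives derivative 0. *)
Lemma is_derive_flat k (x : R) : is_derive x 1 (flat k) (flat k.+2 x - k%:R * flat k.+1 x).
Proof.
have [x0|x0|x0] := ltgtP x 0.
- apply: (@is_derive_open R R `]-oo, 0[%classic (fun=> 0)) => //.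
  + by move=> y /=; rewrite in_itv/= => y0; rewrite /flat ltNge (ltW y0).
  + rewrite /flat !ltNge (ltW x0)/= mulr0 subr0; exact: is_derive_const.
- apply: (@is_derive_open R R `]0, +oo[%classic (fun y => y^-1 ^+ k * expR (- y^-1))) => //.
  + by rewrite /= in_itv/= x0.
  + by move=> y /=; rewrite in_itv/= andbT => y0; rewrite /flat y0.
  + rewrite /flat x0.
    have HV : is_derive x (1 : R) (fun y : R => y^-1) (- (x^-1 * x^-1)).
      by have := is_deriveV (lt0r_neq0 x0) (is_derive_id x (1 : R)); rewrite mul1r.
    have H1 := is_derive_comp1 HV (is_derive_pow k (x^-1)).
    have HN := is_derive_cmul (-1) HV.
    have H2 := is_derive_comp1 HN (is_derive_expR _).
    have := is_derive_mul H1 H2.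
    rewrite /comp; under [X in is_derive _ _ X]eq_fun do rewrite mulN1r.
    move=> H; apply: is_derive_eq H _; rewrite !mulN1r.
    case: k {H1} => [|k] /=; first by rewrite !expr0; ring.
    by rewrite !exprS; ring.
- rewrite x0 /flat ltxx mulr0 subr0; apply/is_derive_epsP => e e0.
  have f0 : 0 < (k.+2)`!%:R :> R by rewrite ltr0n fact_gt0.
  near=> h.
  rewrite addr0 [h%:A]mulr1 ltxx mulr0 !subr0.
  apply: le_trans (flat_le k h) _; rewrite -[h ^+ 2]real_normK ?num_real// expr2 mulrA ler_wpM2r//.
  rewrite -ler_pdivlMl//; near: h; apply/nbhs_ballP; exists (((k.+2)`!%:R)^-1 * e) => /=.
    by rewrite mulr_gt0// invr_gt0.
  by move=> y; rewrite -ball_normE/= sub0r normrN => /ltW.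
Unshelve. all: by end_near. Qed.

Lemma D1n_flat m k : D1n m (flat k).
Proof.
have c j : continuous (flat j).
  move=> x; apply/differentiable_continuous/derivable1_diffP.
  by have [] := is_derive_flat j x.
elim: m k => [|m IH] k; split => //.
exists (fun x => flat k.+2 x + (- k%:R) * flat k.+1 x); split.
  by move=> x; rewrite mulNr; exact: is_derive_flat.
by apply: D1nD => //; exact: D1nZ.
Qed.

Lemma flat_gt0 (x : R) : 0 < x -> 0 < flat 0 x.
Proof. by move=> x0; rewrite /flat x0 expr0 mul1r expR_gt0. Qed.

Lemma flat_le0 (x : R) : x <= 0 -> flat 0 x = 0.
Proof. by move=> x0; rewrite /flat ltNge x0. Qed.

Lemma flat_ge0 (x : R) : 0 <= flat 0 x.
Proof.
by have [x0|x0] := lerP x 0; [rewrite flat_le0|exact/ltW/flat_gt0].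
Qed.

End bump.

(** * Cosine transforms of test functions *)

Section dot_product.
Context {R : realType} {n : nat}.
Implicit Types x y z : 'rV[R]_n.

Lemma dotpC x y : dotp x y = dotp y x.
Proof. by apply: eq_bigr => i _; rewrite mulrC. Qed.

Lemma dotpDl x y z : dotp (x + y) z = dotp x z + dotp y z.
Proof. by rewrite -big_split; apply: eq_bigr => i _; rewrite !mxE mulrDl. Qed.

Lemma dotpDr x y z : dotp z (x + y) = dotp z x + dotp z y.
Proof. by rewrite dotpC dotpDl !(dotpC z). Qed.

Lemma dotpZl (c : R) x y : dotp (c *: x) y = c * dotp x y.
Proof. by rewrite mulr_sumr; apply: eq_bigr => i _; rewrite !mxE mulrA. Qed.

Lemma dotpZr (c : R) x y : dotp y (c *: x) = c * dotp y x.
Proof. by rewrite dotpC dotpZl dotpC. Qed.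

Lemma dotpNl x y : dotp (- x) y = - dotp x y.
Proof. by rewrite -scaleN1r dotpZl mulN1r. Qed.

Lemma dotpNr x y : dotp y (- x) = - dotp y x.
Proof. by rewrite dotpC dotpNl dotpC. Qed.

Lemma dotp_delta i x : dotp (delta_mx 0 i) x = x 0 i.
Proof.
rewrite /dotp (bigD1 i)//= mxE !eqxx/= mul1r big1 ?addr0// => j ji.
by rewrite mxE eqxx /= (negbTE ji) mul0r.
Qed.

Lemma dotp0l x : dotp 0 x = 0.
Proof. by rewrite -(scale0r 0) dotpZl mul0r. Qed.

Lemma dotp_le x y (C : R) : (forall i, `|y 0 i| <= C) -> `|dotp x y| <= n%:R * `|x| * C.
Proof. exact: rV_normM_sum. Qed.

Lemma is_derive_dotp x xi v : is_derive xi v (dotp x) (dotp x v).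
Proof.
by apply: is_derive_sum_seq => i; apply: is_derive_cmul; exact: is_derive_coord.
Qed.

Lemma is_derive_cos_dotp x th xi v :
  is_derive xi v (fun z => cos (dotp x z + th)) (cos (dotp x xi + (th + pi / 2)) * dotp x v).
Proof. exact: (is_derive_comp1 (is_derive_dotp x xi v) (is_derive_cos_shift th _)). Qed.

Lemma measurable_dotp_pair d (T : measurableType d) (f g : T -> 'rV[R]_n) :
  measurable_fun setT f -> measurable_fun setT g ->
  measurable_fun setT (fun t => dotp (f t) (g t)).
Proof.
move=> mf mg; apply: measurable_sum => i.
by apply: measurable_funM; [exact: (measurableT_comp (measurable_rV_coord i) mf)
  |exact: (measurableT_comp (measurable_rV_coord i) mg)].
Qed.

Lemma measurable_cos_dotp d (T : measurableType d) (f g : T -> 'rV[R]_n) (th : R) :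
  measurable_fun setT f -> measurable_fun setT g ->
  measurable_fun setT (fun t => cos (dotp (f t) (g t) + th)).
Proof.
move=> mf mg; have mc : measurable_fun setT (@cos R).
  by apply: continuous_measurable_fun; exact: continuous_cos.
apply: (measurableT_comp mc).
by apply: measurable_funD => //; exact: measurable_dotp_pair.
Qed.

Lemma measurable_add d (T : measurableType d) (f g : T -> 'rV[R]_n) :
  measurable_fun setT f -> measurable_fun setT g ->
  measurable_fun setT (fun t => f t + g t).
Proof.
move=> mf mg; apply: measurable_fun_rV => i.
rewrite (_ : _ \o _ = fun t => rV_coord i (f t) + rV_coord i (g t)).
  by apply: measurable_funD; [exact: (measurableT_comp (measurable_rV_coord i) mf)
  |exact: (measurableT_comp (measurable_rV_coord i) mg)].
by apply/funext => t; rewrite /rV_coord/= mxE.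
Qed.

End dot_product.

Section cosine.
Context {R : realType}.
Implicit Types u v : R.

Lemma cos_abs_le1 u : `|cos u| <= 1.
Proof. by rewrite ler_norml cos_geN1 cos_le1. Qed.

Lemma cos_mvt u v : exists2 s, 0 <= s <= 1 &
  cos (v + u) - cos u = v * cos (s * v + (u + pi / 2)).
Proof.
have [|s s01 E] := @mvt_line R R (@cos R) u v (fun s => v * cos (s * v + (u + pi / 2))).
  move=> s _; have := is_derive_cos_shift 0 (s * v + u).
  move=> H; have {H} := is_derive_scale v H.
  rewrite [v%:A]mulr1 add0r addrA; under eq_fun do rewrite addr0.
  by [].
by exists s.
Qed.

Lemma cosB_le u v : `|cos (v + u) - cos u| <= `|v|.
Proof.
have [s _ ->] := cos_mvt u v.
by rewrite normrM ler_piMr// cos_abs_le1.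
Qed.

(** Two applications of the mean value theorem; a quadratic remainder is enough to differentiate
    under the integral sign. *)
Lemma cos_taylor u v : `|cos (v + u) - cos u - v * cos (u + pi / 2)| <= v ^+ 2.
Proof.
have [s /andP[s0 s1] ->] := cos_mvt u v.
rewrite -mulrBr normrM -[v ^+ 2]real_normK ?num_real// expr2 ler_wpM2l//.
by apply: le_trans (cosB_le _ _) _; rewrite normrM ger0_norm// ler_piMl.
Qed.

End cosine.

Section cc_functions.
Context {R : realType} {n : nat}.
Local Notation Rn := 'rV[R]_n.
Local Notation mu := (lebesgue_rV R n).
Implicit Types (f g b : Rn -> R) (M : R).

(** The class [C_c^oo(R^n)]; supports are confined to cubes, which are compact and have an explicit
    volume. *)
Definition cc b := smooth_on setT b /\ exists2 M, 0 <= M & forall x, ~ box n M x -> b x = 0.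

Lemma box_compact M : compact (box n M).
Proof.
rewrite (_ : box n M = [set v | forall i, `[- M, M]%classic (v ord0 i)]).
  by apply: (@rV_compact R n (fun=> `[- M, M]%classic)) => i; exact: segment_compact.
by apply/seteqP; split => x /= H i; have := H i; rewrite in_itv.
Qed.

Lemma compact_bound (A : set Rn) f : compact A -> (forall x, A x -> {for x, continuous f}) ->
  exists2 C, 0 <= C & forall x, A x -> `|f x| <= C.
Proof.
move=> cA cf; have [->|A0] := eqVneq A set0; first by exists 0.
have [c cA' H] : exists2 c, c \in A & forall t, t \in A -> `|f t| <= `|f c|.
  apply: EVT_max_rV => //; first exact/set0P.
  apply: continuous_in_subspaceT => x /set_mem Ax.
  apply: continuous_comp; [exact: cf|exact: norm_continuous].
by exists `|f c| => // x /mem_set; exact: H.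
Qed.

Lemma cc_continuous b : cc b -> continuous b.
Proof. by move=> [sb _] x; have [] := sb [::] x I. Qed.

Lemma cc_measurable b : cc b -> measurable_fun setT b.
Proof. by move=> /cc_continuous; exact: continuous_measurable_rV. Qed.

Lemma cc_bound b : cc b -> exists C M, [/\ 0 <= C, 0 <= M & forall x, `|b x| <= C * \1_(box n M) x].
Proof.
move=> Hb; have [sb [M M0 bM]] := Hb.
have [C C0 HC] := compact_bound (@box_compact M) (fun x _ => @cc_continuous b Hb x).
exists C, M; split => // x; rewrite indicE; have [xM|xM] := boolP (x \in box n M).
  by rewrite mulr1; apply: HC; exact/set_mem.
by rewrite mulr0 bM ?normr0// => /mem_set; exact/negP.
Qed.

Lemma cc_L1 b : cc b -> L1 mu b.
Proof.
move=> Hb; have [C [M [C0 M0 H]]] := cc_bound Hb.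
exact: L1_bounded M0 (cc_measurable Hb) H.
Qed.

Lemma smooth_Cn0 U f k : smooth_on U f -> Cn k U f.
Proof. exact: (@smooth_Cn _ _ U f [::] k). Qed.

Lemma smoothM U f g : open U -> smooth_on U f -> smooth_on U g -> smooth_on U (fun x => f x * g x).
Proof. by move=> oU sf sg; apply: Cn_smooth => // k; apply: CnM; exact: smooth_Cn0. Qed.

Lemma smooth_coord (U : set Rn) i : open U -> smooth_on U (fun x => x 0 i).
Proof. by move=> oU; apply: Cn_smooth => // k; exact: Cn_coord. Qed.

Lemma ccM f b : smooth_on setT f -> cc b -> cc (fun x => f x * b x).
Proof.
move=> sf [sb [M M0 H]]; split; first by apply: smoothM => //; exact: openT.
by exists M => // x /H ->; rewrite mulr0.
Qed.

Lemma cc_deriv b i : cc b -> cc ('D_(delta_mx 0 i) b).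
Proof.
move=> [sb [M M0 H]]; split.
  move=> s x _; have := sb (rcons s i) x I.
  by rewrite /partials foldr_rcons.
exists M => // x xM.
have : is_derive x (delta_mx 0 i) b 0.
  apply: (@is_derive_open _ _ (~` box n M) (fun=> 0)) => //.
  - apply: closed_openC; apply: compact_closed; [exact: norm_hausdorff|exact: box_compact].
  - by move=> y /H.
by move=> [_ ->].
Qed.

Lemma box_add M x v : ~ box n (M + `|v|) x -> ~ box n M (x + v).
Proof.
move=> H K; apply: H => i; have := K i; rewrite mxE.
have := rV_coord_le v i; rewrite ler_norml; lra.
Qed.

Lemma box_le M M' x : M <= M' -> box n M x -> box n M' x.
Proof. by move=> MM H i; have := H i; lra. Qed.

(* Translation invariance kills the integral of the difference quotients. *)
Lemma Rint_derive0 (F F' : Rn -> R) v M C : 0 <= M -> L1 mu F ->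
  (forall x, ~ box n M x -> F x = 0) ->
  (forall x, is_derive x v F (F' x)) -> (forall x, `|F' x| <= C) ->
  measurable_fun setT F' /\ \int[mu]_x F' x = 0.
Proof.
move=> M0 LF HF dF bF; have mF := L1_measurable LF.
have C0 : 0 <= C by apply: le_trans (bF 0).
pose e k : R := k.+1%:R^-1.
have e0 k : 0 < e k by rewrite invr_gt0.
have e1 k : e k <= 1 by rewrite invf_le1// ler1n.
pose f_ k x := (e k)^-1 * (F (x + e k *: v) - F x).
have mf_ k : measurable_fun setT (f_ k).
  apply: measurable_funM => //; apply: measurable_funB => //.
  by apply: (measurableT_comp mF); apply: measurable_add.
have M'0 : 0 <= M + `|v| by rewrite addr_ge0.
have diff k x : exists2 s, 0 <= s <= 1 & F (x + e k *: v) - F x = e k * F' (s *: (e k *: v) + x).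
  rewrite [x + _]addrC; apply: mvt_line => s _.
  exact/is_derive_scale.
(* Mean value theorem inside the cube enlarged by [|v|], and zero outside; since [e k <= 1], one
   cube serves for all [k]. *)
have bf_ k x : `|f_ k x| <= C * \1_(box n (M + `|v|)) x.
  rewrite indicE; have [xM|xM] := boolP (x \in box n _).
    have [s _] := diff k x; rewrite /f_ => ->.
    by rewrite mulKf ?lt0r_neq0// mulr1.
  rewrite /f_ !HF ?subr0 ?mulr0 ?normr0//.
  - by move=> H; move/negP: xM; apply; apply/mem_set; apply: box_le H; rewrite lerDl.
  - apply: box_add => H; move/negP: xM; apply; apply/mem_set; apply: box_le H.
    by rewrite lerD2l normrZ gtr0_norm// ler_piMl.
have cf x : f_ k x @[k --> \oo] --> F' x.
  apply/cvgrPdist_le => eps eps0.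
  have /is_derive_epsP/(_ _ eps0) := dF x.
  move=> /nbhs_ballP[r /= r0 Hr].
  near=> k.
  have ekr : e k < r.
    by rewrite /e; near: k; apply: (cvgr_lt 0); [exact: cvg_harmonic|].
  have := Hr (e k); rewrite -ball_normE/= sub0r normrN gtr0_norm// => /(_ ekr).
  rewrite (addrC (e k *: v)) => Hk.
  move: Hk; have -> : F (x + e k *: v) - F x - e k * F' x = (f_ k x - F' x) * e k.
    by rewrite /f_ mulrBl mulrAC mulVf ?lt0r_neq0// mul1r [F' x * _]mulrC.
  by rewrite normrM (gtr0_norm (e0 k)) ler_pM2r// distrC.
have [mF' _ lim] := Rint_dct mf_ (L1Z C (L1_box n M'0)) bf_ cf.
split => //.
have I0 k : \int[mu]_x f_ k x = 0.
  have Ls := L1_shift (e k *: v) LF.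
  rewrite /f_ RintegralZl//; last first.
    by apply: (L1D Ls); have := L1Z (-1) LF; under eq_fun do rewrite mulN1r.
  by rewrite RintegralB// Rint_shift// subrr mulr0.
have : (fun k => \int[mu]_x f_ k x) @ \oo --> (0 : R).
  by under eq_fun do rewrite I0; exact: cvg_cst.
by move=> /(cvg_lim (@Rhausdorff R)) <-; apply/esym/cvg_lim.
Unshelve. all: by end_near. Qed.

Lemma L1_bounded_supp f M C : 0 <= M -> measurable_fun setT f ->
  (forall x, ~ box n M x -> f x = 0) -> (forall x, `|f x| <= C) -> L1 mu f.
Proof.
move=> M0 mf H bf; apply: (L1_bounded (C := C) M0 mf) => x.
rewrite indicE; have [xM|xM] := boolP (x \in box n M); first by rewrite mulr1.
by rewrite mulr0 H ?normr0// => /mem_set; exact/negP.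
Qed.

(* The cosine transforms [W b th]; the phase [th] also encodes the sine
   transform, so that derivatives and coordinate multiplications stay in the
   same class. *)
Definition W b th (x : Rn) : R := \int[mu]_xi (b xi * cos (dotp x xi + th)).

Lemma measurable_cosd x (th : R) : measurable_fun setT (fun xi : Rn => cos (dotp x xi + th)).
Proof. by apply: measurable_cos_dotp => //; exact: measurable_cst. Qed.

Lemma L1_cos b x th : cc b -> L1 mu (fun xi => b xi * cos (dotp x xi + th)).
Proof.
move=> Hb; apply: (L1_dom (g := fun xi => `|b xi|)).
- by apply: measurable_funM; [exact: cc_measurable|exact: measurable_cosd].
- by move=> xi; rewrite normrM ler_piMr// cos_abs_le1.
- exact/L1_abs/cc_L1.
Qed.

Lemma W_bound b th x : cc b -> `|W b th x| <= \int[mu]_xi `|b xi|.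
Proof.
move=> Hb; apply: Rint_abs_le.
- exact: L1_measurable (L1_cos x th Hb).
- exact/L1_abs/cc_L1.
- by move=> xi; rewrite normrM ler_piMr// cos_abs_le1.
Qed.

Lemma W_lipschitz b th : cc b -> exists2 C, 0 <= C & forall x y, `|W b th x - W b th y| <= C * `|x - y|.
Proof.
move=> Hb; have [_ [M M0 H]] := Hb.
have Lb := L1_abs (cc_L1 Hb).
exists (n%:R * M * \int[mu]_xi `|b xi|) => [|x y].
  by rewrite !mulr_ge0// Rintegral_ge0.
rewrite /W -RintegralB//; try exact: L1_cos.
have -> : n%:R * M * (\int[mu]_xi `|b xi|) * `|x - y| = \int[mu]_xi (n%:R * `|x - y| * M * `|b xi|).
  by rewrite RintegralZl//; ring.
apply: Rint_abs_le.
- by apply: measurable_funB; exact: L1_measurable (L1_cos _ th Hb).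
- exact: L1Z.
move=> xi; rewrite -mulrBr normrM mulrC.
have [xiM|xiM] := pselect (box n M xi); last by rewrite H// normr0 !mulr0.
rewrite ler_wpM2r//.
have -> : dotp x xi + th = dotp (x - y) xi + (dotp y xi + th).
  by rewrite dotpDl dotpNl; ring.
apply: le_trans (cosB_le _ _) _; apply: dotp_le => i.
by rewrite ler_norml; exact: xiM.
Qed.

Lemma continuous_eps f (x : Rn) :
  (forall e : R, 0 < e -> exists2 r, 0 < r & forall y, `|x - y| < r -> `|f x - f y| <= e) ->
  {for x, continuous f}.
Proof.
move=> H A /nbhs_ballP[e /= e0 HA].
have [r r0 Hr] := H (e / 2) (divr_gt0 e0 (ltr0Sn _ 1)).
apply/nbhs_ballP; exists r => //= y; rewrite -ball_normE/= => xy.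
apply: HA; rewrite -ball_normE/=; apply: le_lt_trans (Hr y xy) _.
by rewrite ltr_pdivrMr// ltr_pMr// ltr1n.
Qed.

Lemma W_continuous b th : cc b -> continuous (W b th).
Proof.
move=> Hb x; have [C C0 HC] := W_lipschitz th Hb.
apply: continuous_eps => e e0; exists (e / (C + 1)).
  by rewrite divr_gt0// ltr_wpDl.
move=> y xy; apply: le_trans (HC x y) _.
have C1 : 0 < C + 1 by rewrite ltr_wpDl.
apply: (@le_trans _ _ ((C + 1) * `|x - y|)); first by rewrite ler_wpM2r// lerDl.
by rewrite mulrC -ler_pdivlMr// ltW.
Qed.

(** Differentiation under the integral sign: [cos_taylor] bounds the remainder by [(M h)^2 |b|],
    where the cube of half-side [M] contains the support of [b]. *)
Lemma W_is_derive b th x i : cc b ->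
  is_derive x (delta_mx 0 i) (W b th) (W (fun xi => xi 0 i * b xi) (th + pi / 2) x).
Proof.
move=> Hb; have [_ [M M0 H]] := Hb.
have Hb' : cc (fun xi => xi 0 i * b xi).
  by apply: ccM => //; apply: smooth_coord; exact: openT.
have Lb := L1_abs (cc_L1 Hb).
pose C := M ^+ 2 * \int[mu]_xi `|b xi|.
have C0 : 0 <= C by rewrite mulr_ge0 ?sqr_ge0// Rintegral_ge0.
apply/is_derive_epsP => e e0; near=> h.
apply: (@le_trans _ _ (C * h ^+ 2)).
  rewrite /W -RintegralB//; try exact: L1_cos.
  rewrite -RintegralZl//; last exact: L1_cos.
  rewrite -RintegralB//; last 2 first.
  - have L2 := L1Z (-1) (L1_cos x th Hb).
    by apply: eq_integrable (L1D (L1_cos (h *: delta_mx 0 i + x) th Hb) L2) => // xi _ /=; rewrite mulN1r.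
  - exact/L1Z/L1_cos.
  have -> : C * h ^+ 2 = \int[mu]_xi (M ^+ 2 * h ^+ 2 * `|b xi|).
    by rewrite RintegralZl// /C; ring.
  apply: Rint_abs_le.
  - apply: measurable_funB; last first.
      by apply: measurable_funM => //; exact: (L1_measurable (L1_cos x (th + pi / 2) Hb')).
    by apply: measurable_funB; exact: L1_measurable (L1_cos _ th Hb).
  - exact: L1Z.
  move=> xi; rewrite dotpDl dotpZl dotp_delta.
  have -> : b xi * cos (h * xi 0 i + dotp x xi + th) - b xi * cos (dotp x xi + th) -
    h * (xi 0 i * b xi * cos (dotp x xi + (th + pi / 2))) =
    (cos (h * xi 0 i + (dotp x xi + th)) - cos (dotp x xi + th)
     - (h * xi 0 i) * cos (dotp x xi + th + pi / 2)) * b xi.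
    by rewrite !addrA; ring.
  have [xiM|xiM] := pselect (box n M xi); last by rewrite H// !mulr0 normr0 mulr0.
  rewrite normrM ler_wpM2r//; apply: le_trans (cos_taylor _ _) _.
  rewrite exprMn mulrC ler_wpM2r ?sqr_ge0//.
  by have := xiM i; nra.
rewrite -[h ^+ 2]real_normK ?num_real// expr2 mulrA ler_wpM2r//.
have C1 : 0 < C + 1 by rewrite ltr_wpDl.
apply: (@le_trans _ _ ((C + 1) * `|h|)); first by rewrite ler_wpM2r// lerDl.
rewrite mulrC -ler_pdivlMr//; near: h.
apply/nbhs_ballP; exists (e / (C + 1)) => /=; first by rewrite divr_gt0// ltr_wpDl.
by move=> y; rewrite -ball_normE/= sub0r normrN => /ltW.
Unshelve. all: by end_near. Qed.

(** Integration by parts: the derivative of a compactly supported function has integral 0. *)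
Lemma W_mul b th (x : Rn) i : cc b -> x 0 i * W b th x = W ('D_(delta_mx 0 i) b) (th + pi / 2) x.
Proof.
move=> Hb; have [sb [M M0 H]] := Hb.
have Hd := cc_deriv i Hb.
(* The phase [th - pi / 2] gives the differentiated cosine the phase [th]; the other term then
   differs from the phase [th + pi / 2] by [pi], which absorbs the sign. *)
pose F xi := b xi * cos (dotp x xi + (th - pi / 2)).
pose F' xi := 'D_(delta_mx 0 i) b xi * cos (dotp x xi + (th - pi / 2)) +
  b xi * (cos (dotp x xi + th) * x 0 i).
have dF xi : is_derive xi (delta_mx 0 i) F (F' xi).
  have db : is_derive xi (delta_mx 0 i) b ('D_(delta_mx 0 i) b xi).
    by apply: derivableP; have [_] := sb [::] xi I; exact.
  have := is_derive_cos_dotp x (th - pi / 2) xi (delta_mx 0 i).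
  by rewrite subrK (dotpC x (delta_mx 0 i)) dotp_delta => dc; exact: is_derive_mul.
have LF : L1 mu F by exact: L1_cos.
have [C [M1 [C0 M10 HC]]] := cc_bound Hb.
have [C' [M1' [C0' M10' HC']]] := cc_bound Hd.
have bF' xi : `|F' xi| <= C' + C * `|x 0 i|.
  have c1 (f : R) (D K : R) : 0 <= D -> `|f| <= D * \1_(box n K) xi -> `|f| <= D.
    move=> D0 Hf; apply: le_trans Hf _; rewrite indicE.
    by case: (_ \in _); rewrite ?mulr1// mulr0.
  apply: le_trans (ler_normD _ _) _; apply: lerD; rewrite !normrM.
    by apply: le_trans (c1 _ _ _ C0' (HC' xi)); rewrite ler_piMr// cos_abs_le1.
  rewrite ler_pM//; first exact: c1 _ _ _ C0 (HC xi).
  by rewrite ler_piMl// cos_abs_le1.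
have F0 xi : ~ box n M xi -> F xi = 0 by move=> /H; rewrite /F => ->; rewrite mul0r.
have [_] := Rint_derive0 M0 LF F0 dF bF'.
have Lc : L1 mu (fun xi => b xi * (cos (dotp x xi + th) * x 0 i)).
  have := L1Z (x 0 i) (L1_cos x th Hb).
  by apply: eq_integrable => // xi _ /=; congr EFin; ring.
rewrite /F' RintegralD//; last exact: L1_cos.
move/eqP; rewrite addr_eq0 => /eqP E.
have -> : x 0 i * W b th x = \int[mu]_xi (b xi * (cos (dotp x xi + th) * x 0 i)).
  rewrite /W -RintegralZl//; last exact: L1_cos.
  by apply: eq_Rintegral => xi _; ring.
apply/eqP; rewrite -[X in X == _]opprK -E -mulN1r /W -RintegralZl//; last exact: L1_cos.
apply/eqP; apply: eq_Rintegral => xi _.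
have -> : dotp x xi + (th + pi / 2) = (dotp x xi + (th - pi / 2)) + pi by field.
by rewrite cosDpi; ring.
Qed.

(** Stable under partial derivatives and multiplication by coordinates, so every Schwartz bound
    reduces to the boundedness of a member. Sums are included because wave packets and
    [(1 + x_i^2) f] are sums. *)
Inductive Wclass : (Rn -> R) -> Prop :=
| Wclass1 b th : cc b -> Wclass (W b th)
| WclassD f g : Wclass f -> Wclass g -> Wclass (fun x => f x + g x).

Lemma Wclass_bound f : Wclass f -> exists C, forall x, `|f x| <= C.
Proof.
elim=> [b th Hb|g h _ [C HC] _ [C' HC']].
  by exists (\int[mu]_xi `|b xi|) => x; exact: W_bound.
by exists (C + C') => x; apply: le_trans (ler_normD _ _) _; exact: lerD.
Qed.

Lemma Wclass_continuous f : Wclass f -> continuous f.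
Proof.
elim=> [b th Hb|g h _ cg _ ch]; first exact: W_continuous.
by move=> x; apply: continuousD; [exact: cg|exact: ch].
Qed.

Lemma Wclass_derive f i : Wclass f -> exists2 f', Wclass f' &
  forall x, is_derive x (delta_mx 0 i) f (f' x).
Proof.
elim=> [b th Hb|g h _ [g' Wg Hg] _ [h' Wh Hh]].
  exists (W (fun xi => xi 0 i * b xi) (th + pi / 2)); last by move=> x; exact: W_is_derive.
  by apply: Wclass1; apply: ccM => //; apply: smooth_coord; exact: openT.
exists (fun x => g' x + h' x); first exact: WclassD.
by move=> x; exact: is_derive_add.
Qed.

Lemma Wclass_mul f i : Wclass f -> Wclass (fun x => x 0 i * f x).
Proof.
elim=> [b th Hb|g h _ Wg _ Wh].
  rewrite (_ : (fun x => _) = W ('D_(delta_mx 0 i) b) (th + pi / 2)).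
    by apply: Wclass1; exact: cc_deriv.
  by apply/funext => x; rewrite W_mul.
rewrite (_ : (fun x => _) = (fun x : Rn => x 0 i * g x + x 0 i * h x)); first exact: WclassD.
by apply/funext => x; rewrite mulrDr.
Qed.

Lemma Wclass_partials f s : Wclass f -> Wclass (partials s f).
Proof.
elim: s => [//|i s IH] /IH Wf /=.
have [f' Wf' Hf'] := Wclass_derive i Wf.
rewrite (_ : 'D_(_) _ = f') //; apply/funext => x.
by have [_] := Hf' x.
Qed.

Lemma Wclass_prod f (r : seq 'I_n) (alpha : 'I_n -> nat) : Wclass f ->
  Wclass (fun x => \prod_(i <- r) x 0 i ^+ alpha i * f x).
Proof.
move=> Wf; elim: r => [|i r IH].
  by under eq_fun do rewrite big_nil mul1r.
under eq_fun do rewrite big_cons -mulrA.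
elim: (alpha i) => [|k IHk]; first by under eq_fun do rewrite expr0 mul1r.
by under eq_fun do rewrite exprS -mulrA; exact: Wclass_mul.
Qed.

Lemma Wclass_schwartz f : Wclass f -> schwartz_real f.
Proof.
move=> Wf; split=> [s x _|alpha s].
  have Ws := Wclass_partials s Wf; split; first exact: Wclass_continuous.
  by move=> i; have [f' _ Hf'] := Wclass_derive i Ws; have [] := Hf' x.
by apply: Wclass_bound; apply: Wclass_prod; exact: Wclass_partials.
Qed.

(** The product of [f] by all the [1 + x_i^2] stays in the class, hence is bounded. *)
Lemma Wclass_decay f : Wclass f -> exists C, forall x, `|f x| <= C * decay x.
Proof.
move=> Wf.
have [C HC] : exists C, forall x : Rn, `|\prod_(i <- index_enum 'I_n) (1 + x 0 i ^+ 2) * f x| <= C.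
  apply: Wclass_bound; elim: (index_enum _) => [|i r IH].
    by under eq_fun do rewrite big_nil mul1r.
  under eq_fun do rewrite big_cons -mulrA mulrDl mul1r expr2 -mulrA.
  by apply: WclassD => //; apply: Wclass_mul; exact: Wclass_mul.
exists C => x; have := HC x; rewrite normrM.
have P0 : 0 < \prod_(i <- index_enum 'I_n) (1 + x 0 i ^+ 2).
  by apply: prodr_gt0 => i _; rewrite ltr_wpDr// sqr_ge0.
by rewrite gtr0_norm// /decay prodfV mulrC -ler_pdivlMr.
Qed.

Lemma Wclass_L1 f : Wclass f -> L1 mu f.
Proof.
move=> Wf; have [C HC] := Wclass_decay Wf.
apply: (L1_dom _ HC); last exact/L1Z/L1_decay.
by apply: continuous_measurable_rV; exact: Wclass_continuous.
Qed.

Lemma W_L1 b th : cc b -> L1 mu (W b th).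
Proof. by move=> Hb; exact/Wclass_L1/Wclass1. Qed.

Lemma measurable_pair_fst (f : Rn -> R) : measurable_fun setT f ->
  measurable_fun setT (fun z : Rn * Rn => f z.1).
Proof. by move=> mf; apply: (measurableT_comp mf); exact: measurable_fst. Qed.

Lemma measurable_pair_snd (f : Rn -> R) : measurable_fun setT f ->
  measurable_fun setT (fun z : Rn * Rn => f z.2).
Proof. by move=> mf; apply: (measurableT_comp mf); exact: measurable_snd. Qed.

(** The multiplication formula of Fourier analysis, with a dilation: [cos (x.y + th)] is symmetric
    in [x] and [y], and after Fubini the factor [c^n] produced by rescaling [x] is absorbed by
    rescaling [y]. *)
Lemma W_exchange a rho th (c : R) : 0 < c -> cc a -> cc rho ->
  \int[mu]_x (rho (c^-1 *: x) * W a th x) = \int[mu]_y (a (c^-1 *: y) * W rho th y).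
Proof.
move=> c0 Ha Hr.
have cV0 : 0 < c^-1 by rewrite invr_gt0.
have Lrc : L1 mu (fun x => rho (c^-1 *: x)).
  by have := L1_affine 0 cV0 (cc_L1 Hr); under eq_fun do rewrite addr0.
have Lac : L1 mu (fun x => a (c^-1 *: x)).
  by have := L1_affine 0 cV0 (cc_L1 Ha); under eq_fun do rewrite addr0.
pose F (z : Rn * Rn) := rho (c^-1 *: z.1) * (a z.2 * cos (dotp z.1 z.2 + th)).
have mF : measurable_fun setT F.
  apply: measurable_funM; first exact: (measurable_pair_fst (L1_measurable Lrc)).
  apply: measurable_funM; first exact: (measurable_pair_snd (cc_measurable Ha)).
  by apply: measurable_cos_dotp; [exact: measurable_fst|exact: measurable_snd].
have bF x y : `|F (x, y)| <= `|rho (c^-1 *: x)| * `|a y|.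
  by rewrite /F/= !normrM ler_wpM2l// ler_piMr// cos_abs_le1.
have [_ _] := Rfubini mF (L1_abs Lrc) (L1_abs (cc_L1 Ha)) bF.
have -> : \int[mu]_x \int[mu]_y F (x, y) = \int[mu]_x (rho (c^-1 *: x) * W a th x).
  by apply: eq_Rintegral => x _; rewrite /F/= RintegralZl//; exact: L1_cos.
move=> ->.
have -> : \int[mu]_y \int[mu]_x F (x, y) = c ^+ n * \int[mu]_y (a y * W rho th (c *: y)).
  rewrite -RintegralZl//; last first.
    have [C HC] := Wclass_bound (Wclass1 th Hr).
    apply: (L1_dom (g := fun y : Rn => C * `|a y|)); last exact/L1Z/L1_abs/cc_L1.
      apply: measurable_funM; first exact: cc_measurable.
      have := measurable_affine c (0 : Rn); under eq_fun do rewrite addr0.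
      exact: (measurableT_comp (L1_measurable (W_L1 th Hr))).
    by move=> y; rewrite normrM mulrC ler_wpM2r.
  apply: eq_Rintegral => y _.
  pose G x := rho (c^-1 *: x) * cos (dotp x y + th).
  have LG : L1 mu G.
    apply: (L1_dom _ _ (L1_abs Lrc)).
      apply: measurable_funM; first exact: L1_measurable Lrc.
      by under eq_fun do rewrite dotpC; exact: measurable_cosd.
    by move=> x; rewrite normrM ler_piMr// cos_abs_le1.
  have -> : \int[mu]_x F (x, y) = a y * \int[mu]_x G x.
    by rewrite -RintegralZl//; apply: eq_Rintegral => x _; rewrite /F/G/=; ring.
  rewrite -(Rint_affine 0 c0 LG) mulrCA /W; congr (_ * (_ * _)).
  apply: eq_Rintegral => x _; rewrite /G addr0 scalerA mulVf ?lt0r_neq0// scale1r.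
  by rewrite dotpZl dotpZl (dotpC y).
have LH : L1 mu (fun y => a (c^-1 *: y) * W rho th y).
  have [C HC] := Wclass_bound (Wclass1 th Hr).
  apply: (L1_dom (g := fun y : Rn => C * `|a (c^-1 *: y)|)); last exact/L1Z/L1_abs.
    by apply: measurable_funM; [exact: L1_measurable Lac|exact: L1_measurable (W_L1 th Hr)].
  by move=> y; rewrite normrM mulrC ler_wpM2r.
transitivity (c ^+ n * \int[mu]_y (a (c^-1 *: (c *: y + 0)) * W rho th (c *: y + 0))); last first.
  exact: (Rint_affine 0 c0 LH).
apply: (congr1 ( *%R (c ^+ n))); apply: eq_Rintegral => y _.
by rewrite addr0 scalerA mulVf ?lt0r_neq0// scale1r.
Qed.

Lemma W_exchange_limit a rho th : cc a -> cc rho ->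
  (fun k => \int[mu]_x (rho (k.+1%:R^-1 *: x) * W a th x)) @ \oo --> rho 0 * \int[mu]_x W a th x.
Proof.
move=> Ha Hr.
have [C [M [C0 M0 HC]]] := cc_bound Hr.
have bC x : `|rho x| <= C.
  apply: le_trans (HC x) _; rewrite indicE.
  by case: (_ \in _); rewrite ?mulr1// mulr0.
have [||||_ _] := @Rint_dct _ _ R mu (fun k x => rho (k.+1%:R^-1 *: x) * W a th x)
  (fun x => rho 0 * W a th x) (fun x => C * `|W a th x|).
- move=> k; apply: measurable_funM; last exact: L1_measurable (W_L1 th Ha).
  have := measurable_affine (k.+1%:R^-1) (0 : Rn); under eq_fun do rewrite addr0.
  exact: (measurableT_comp (cc_measurable Hr)).
- exact/L1Z/L1_abs/W_L1.
- by move=> k x; rewrite normrM ler_wpM2r.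
- move=> x; apply: cvgM; last exact: cvg_cst.
  have E : (fun k => k.+1%:R^-1 *: x) @ \oo --> (0 : Rn).
    rewrite -[0](scale0r x); by apply: cvgZ; [exact: cvg_harmonic|exact: cvg_cst].
  exact: (cvg_comp _ _ E (@cc_continuous rho Hr 0)).
rewrite RintegralZl//; exact: W_L1.
Qed.

(** Limit of the exchange formula as the dilation tends to infinity: [rho (x / (k+1))] tends to
    [rho 0] under domination, and likewise for [a] on the other side. Fixing [rho] gives inversion
    at the origin up to a constant. *)
Lemma W_inversion_sym a rho th : cc a -> cc rho ->
  rho 0 * \int[mu]_x W a th x = a 0 * \int[mu]_x W rho th x.
Proof.
move=> Ha Hr.
have := @W_exchange_limit _ _ th Hr Ha.
under eq_fun do rewrite -W_exchange//.
move=> /(cvg_lim (@Rhausdorff R)) <-.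
by apply/esym/cvg_lim => //; exact: W_exchange_limit.
Qed.

End cc_functions.

(** * Fourier inversion and wave packets *)

Section Rint_linear.
Context d (T : measurableType d) {R : realType} (mu : {measure set T -> \bar R}).
Implicit Types f g : T -> R.

Lemma RintZ (k : R) f : L1 mu f -> \int[mu]_x (k * f x) = k * \int[mu]_x f x.
Proof. by move=> Lf; rewrite RintegralZl. Qed.

Lemma RintD f g : L1 mu f -> L1 mu g ->
  \int[mu]_x (f x + g x) = \int[mu]_x f x + \int[mu]_x g x.
Proof. by move=> Lf Lg; rewrite RintegralD. Qed.

End Rint_linear.

Section bump_function.
Context {R : realType} {n : nat}.
Local Notation Rn := 'rV[R]_n.
Local Notation mu := (lebesgue_rV R n).

(** The squared Euclidean distance makes the argument polynomial, hence the bump smooth; the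
    Euclidean ball lies in the ball of the maximum norm, in which supports are measured. *)
Definition bump (x0 : Rn) (r : R) (x : Rn) : R := flat 0 (r ^+ 2 - dotp (x - x0) (x - x0)).

Lemma dotp_ge0 (x : Rn) : 0 <= dotp x x.
Proof. by apply: sumr_ge0 => i _; rewrite -expr2 sqr_ge0. Qed.

Lemma dotp_coord_le (x : Rn) i : x 0 i ^+ 2 <= dotp x x.
Proof.
rewrite /dotp (bigD1 i)//= -expr2 lerDl sumr_ge0// => j _.
by rewrite -expr2 sqr_ge0.
Qed.

Lemma bump_ge0 x0 r x : 0 <= bump x0 r x.
Proof. exact: flat_ge0. Qed.

Lemma bump_center x0 r : 0 < r -> 0 < bump x0 r x0.
Proof. by move=> r0; apply: flat_gt0; rewrite subrr dotp0l subr0 exprn_gt0. Qed.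

Lemma bump_supp x0 r x : 0 < r -> r <= `|x - x0| -> bump x0 r x = 0.
Proof.
move=> r0 H; apply: flat_le0; rewrite subr_le0 leNgt; apply/negP => K.
move: H; rewrite leNgt => /negP; apply; apply/rV_norm_lt => // i.
have := le_lt_trans (dotp_coord_le (x - x0) i) K.
by rewrite -[X in X < _]real_normK ?num_real// ltr_pXn2r// nnegrE// ltW.
Qed.

Lemma bump_cc x0 r : 0 < r -> cc (bump x0 r).
Proof.
move=> r0; split.
  apply: Cn_smooth => [|k]; first exact: openT.
  apply: Cn_comp; first exact: D1n_flat.
  have Cs i : Cn k setT (fun x : Rn => (x - x0) 0 i).
    under eq_fun do rewrite !mxE; apply: CnD; [exact: Cn_coord|exact: Cn_cst].
  apply: CnD; first exact: Cn_cst.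
  under eq_fun do rewrite -mulN1r; apply: CnM; first exact: Cn_cst.
  by apply: Cn_sum => i; exact: CnM.
exists (`|x0| + r) => [|x H]; first by rewrite addr_ge0// ltW.
apply: bump_supp => //; rewrite leNgt; apply/negP => K; apply: H => i.
have := rV_coord_le x0 i; have := le_lt_trans (rV_coord_le (x - x0) i) K.
rewrite !mxE ler_norml ltr_norml; lra.
Qed.

Lemma bump_even r x : bump 0 r (- x) = bump 0 r x.
Proof. by rewrite /bump !subr0 dotpNl dotpNr opprK. Qed.

End bump_function.

Section inversion.
Context {R : realType} {n : nat}.
Local Notation Rn := 'rV[R]_n.
Local Notation mu := (lebesgue_rV R n).
Implicit Types (a b : Rn -> R).

Lemma W_phase a th s (x : Rn) : cc a ->
  W a (th + s) x = cos s * W a th x + sin s * W a (th + pi / 2) x.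
Proof.
move=> Ha; rewrite /W -!RintegralZl//; try exact: L1_cos.
rewrite -RintegralD//; try by apply: L1Z; exact: L1_cos.
apply: eq_Rintegral => xi _.
by rewrite !addrA; set u := dotp x xi + th; rewrite cosDpihalf cosD; ring.
Qed.

Lemma W_pi a th (x : Rn) : cc a -> W a (th + pi) x = - W a th x.
Proof. by move=> Ha; rewrite W_phase// cospi sinpi mul0r addr0 mulN1r. Qed.

(** The reflection of [xi] turns the phase [th] into [- th]; comparing the two expansions kills the
    sine part. *)
Lemma W_even a th (x : Rn) : cc a -> (forall xi, a (- xi) = a xi) -> W a th x = cos th * W a 0 x.
Proof.
move=> Ha ae.
have E : W a th x = W a (- th) x.
  rewrite /W -[LHS]Rint_opp; last exact: L1_cos.
  by apply: eq_Rintegral => xi _; rewrite ae dotpNr -cosN opprD opprK.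
have E1 := W_phase 0 th x Ha; have E2 := W_phase 0 (- th) x Ha.
rewrite !add0r in E1 E2; rewrite cosN sinN in E2.
by move: E; rewrite E1 E2; lra.
Qed.

(** The factor [cos th] comes from the evenness of the reference bump. The constant, defined through
    that bump, is [(2 pi)^n], a value that is never computed. *)
Lemma W_inversion : exists kappa : R, forall a th, cc a ->
  \int[mu]_x W a th x = kappa * cos th * a 0.
Proof.
have Hr : cc (bump (0 : Rn) 1) by exact: bump_cc.
have r0 : 0 < bump (0 : Rn) 1 0 by exact: bump_center.
exists ((\int[mu]_x W (bump 0 1) 0 x) / bump (0 : Rn) 1 0) => a th Ha.
have := W_inversion_sym th Ha Hr.
have -> : \int[mu]_x W (bump 0 1) th x = cos th * \int[mu]_x W (bump 0 1) 0 x.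
  rewrite -RintegralZl//; last exact: W_L1.
  by apply: eq_Rintegral => x _; rewrite W_even//; exact: bump_even.
move=> E; apply: (mulfI (lt0r_neq0 r0)); rewrite E.
by field; exact: lt0r_neq0.
Qed.

Lemma continuous_translate a (h x : Rn) : {for x + h, continuous a} ->
  {for x, continuous (fun y : Rn => a (y + h))}.
Proof.
move=> ca A HA; have /nbhs_ballP[r r0 Hr] := ca A HA.
apply/nbhs_ballP; exists r => // y; rewrite -ball_normE/= => xy.
by apply: Hr; rewrite -ball_normE/= opprD addrACA subrr addr0.
Qed.

Lemma cc_shift a h : cc a -> cc (fun x => a (x + h)).
Proof.
move=> [sa [M M0 H]]; split.
  apply: Cn_smooth => [|k]; first exact: openT.
  have : Cn k setT a by exact: smooth_Cn0.
  elim: k a {sa H} => [|k IH] a [ca Da];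
    (split; first by move=> x _; apply: continuous_translate; exact: ca) => // i.
  have [a' [Ha' Ca']] := Da i; exists (fun x => a' (x + h)); split; last exact: IH.
  by move=> x _; apply: is_derive_translate; exact: Ha'.
exists (M + `|h|) => [|x xM]; first by rewrite addr_ge0.
by apply: H; exact: box_add.
Qed.

Lemma W_shift a th h (x : Rn) : cc a -> W (fun xi => a (xi + h)) th x = W a (th - dotp x h) x.
Proof.
move=> Ha; rewrite /W -[RHS](Rint_shift h); last exact: L1_cos.
by apply: eq_Rintegral => xi _; rewrite dotpDr; congr (_ * cos _); ring.
Qed.

End inversion.

Section wave_packet.
Context {R : realType} {n : nat}.
Local Notation Rn := 'rV[R]_n.
Local Notation mu := (lebesgue_rV R n).
Variables (a b : Rn -> R).
Hypotheses (Ha : cc a) (Hb : cc b).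

(* Real and imaginary parts of [x |-> \int (a + i b)(xi) e^(i x.xi) dxi]. *)
Definition Gre (x : Rn) : R := W a 0 x + W b (pi / 2) x.
Definition Gim (x : Rn) : R := W a (- (pi / 2)) x + W b 0 x.
Definition Gc (x : Rn) : R[i] := Complex (Gre x) (Gim x).

Lemma Gre_Wclass : Wclass Gre.
Proof. by apply: WclassD; exact: Wclass1. Qed.

Lemma Gim_Wclass : Wclass Gim.
Proof. by apply: WclassD; exact: Wclass1. Qed.

Lemma Gc_schwartz : schwartz Gc.
Proof.
by split; apply: Wclass_schwartz; [exact: Gre_Wclass|exact: Gim_Wclass].
Qed.

Let W_mpi c (Hc : cc c) (x : Rn) : W c (- (pi / 2)) x = - W c (pi / 2) x.
Proof. by rewrite -W_pi// (_ : pi / 2 + pi = - (pi / 2) + pi + pi); [rewrite !W_pi// opprK|field]. Qed.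

(** Real part of [G(x) e^(-i x.h)]: modulating the packet translates its symbol by [h]. *)
Lemma Gre_rot (x h : Rn) :
  Gre x * cos (dotp x h) + Gim x * sin (dotp x h) =
  W (fun xi => a (xi + h)) 0 x + W (fun xi => b (xi + h)) (pi / 2) x.
Proof.
rewrite !W_shift// (W_phase 0)// (W_phase (pi / 2) (- _))// cosN sinN /Gre /Gim.
rewrite add0r W_mpi// (_ : pi / 2 + pi / 2 = 0 + pi); last by field.
by rewrite W_pi//; ring.
Qed.

Lemma Gim_rot (x h : Rn) :
  Gim x * cos (dotp x h) - Gre x * sin (dotp x h) =
  W (fun xi => a (xi + h)) (- (pi / 2)) x + W (fun xi => b (xi + h)) 0 x.
Proof.
rewrite !W_shift// (W_phase 0)// (W_phase (- (pi / 2)) (- _))// cosN sinN /Gre /Gim.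
by rewrite add0r addNr; ring.
Qed.

Variable kappa : R.
Hypothesis Hk : forall a th, cc a -> \int[mu]_x W a th x = kappa * cos th * a 0.

(** Inversion at the origin, applied to the translated symbol; the factor [cos th] discards the part
    of phase [pi / 2]. *)
Lemma Gre_rot_int h : \int[mu]_x (Gre x * cos (dotp x h) + Gim x * sin (dotp x h)) = kappa * a h.
Proof.
under eq_Rintegral do rewrite Gre_rot.
have Ha' := cc_shift h Ha; have Hb' := cc_shift h Hb.
rewrite RintegralD//; try exact: W_L1.
by rewrite !Hk// cos0 cos_pihalf !add0r; ring.
Qed.

Lemma Gim_rot_int h : \int[mu]_x (Gim x * cos (dotp x h) - Gre x * sin (dotp x h)) = kappa * b h.
Proof.
under eq_Rintegral do rewrite Gim_rot.
have Ha' := cc_shift h Ha; have Hb' := cc_shift h Hb.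
rewrite RintegralD//; try exact: W_L1.
by rewrite !Hk// cosN cos0 cos_pihalf !add0r; ring.
Qed.

Lemma mulCE (x y z w : R) : Complex x y * Complex z w = Complex (x * z - y * w) (x * w + y * z).
Proof. by []. Qed.

Lemma fourier_Gc (xi : Rn) :
  fourier Gc xi = Complex (kappa / (2 * pi) ^+ n * a xi) (kappa / (2 * pi) ^+ n * b xi).
Proof.
rewrite /fourier /Cintegral.
have -> : \int[mu]_x complex.Re (Gc x * expi (- dotp xi x)) = kappa * a xi.
  rewrite -Gre_rot_int; apply: eq_Rintegral => x _.
  by rewrite /Gc /expi mulCE /= cosN sinN dotpC; ring.
have -> : \int[mu]_x complex.Im (Gc x * expi (- dotp xi x)) = kappa * b xi.
  rewrite -Gim_rot_int; apply: eq_Rintegral => x _.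
  by rewrite /Gc /expi mulCE /= cosN sinN dotpC; ring.
by rewrite /real_complex_def mulCE !mul0r subr0 addr0; congr Complex; ring.
Qed.

Lemma Gre_int x : Gre x = \int[mu]_xi (a xi * cos (dotp x xi) - b xi * sin (dotp x xi)).
Proof.
rewrite /Gre /W -RintegralD//; try exact: L1_cos.
by apply: eq_Rintegral => xi _; rewrite addr0 cosDpihalf; ring.
Qed.

Lemma Gim_int x : Gim x = \int[mu]_xi (a xi * sin (dotp x xi) + b xi * cos (dotp x xi)).
Proof.
rewrite /Gim /W -RintegralD//; try exact: L1_cos.
apply: eq_Rintegral => xi _; rewrite addr0; congr (_ * _ + _).
by rewrite -[LHS]opprK -cosDpi (_ : _ + pi = dotp x xi + pi / 2); [rewrite cosDpihalf opprK|field].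
Qed.

(** In [|G(x)|^2] one factor is replaced by its integral over [y]; after Fubini the integral over
    [x] is evaluated by inversion. *)
Lemma Gc_plancherel :
  L1 mu (fun x => Gre x ^+ 2 + Gim x ^+ 2) /\
  \int[mu]_x (Gre x ^+ 2 + Gim x ^+ 2) = kappa * \int[mu]_xi (a xi ^+ 2 + b xi ^+ 2).
Proof.
(* [F (x, y)] is the real part of [G(x) e^(-i x.y)] times the conjugate of [(a + i b)(y)]. *)
pose F (z : Rn * Rn) := a z.2 * (Gre z.1 * cos (dotp z.1 z.2) + Gim z.1 * sin (dotp z.1 z.2)) +
  b z.2 * (Gim z.1 * cos (dotp z.1 z.2) - Gre z.1 * sin (dotp z.1 z.2)).
have mre : measurable_fun setT Gre by exact: L1_measurable (Wclass_L1 Gre_Wclass).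
have mim : measurable_fun setT Gim by exact: L1_measurable (Wclass_L1 Gim_Wclass).
have mcos : measurable_fun setT (fun z : Rn * Rn => cos (dotp z.1 z.2)).
  have := measurable_cos_dotp 0 (@measurable_fst _ _ Rn Rn) (@measurable_snd _ _ Rn Rn).
  by under eq_fun do rewrite addr0.
have msin : measurable_fun setT (fun z : Rn * Rn => sin (dotp z.1 z.2)).
  have := measurable_cos_dotp (- (pi / 2)) (@measurable_fst _ _ Rn Rn) (@measurable_snd _ _ Rn Rn).
  by under eq_fun do rewrite cosBpihalf.
have mF : measurable_fun setT F.
  apply: measurable_funD; apply: measurable_funM.
  - by apply: measurable_pair_snd; exact: cc_measurable.
  - by apply: measurable_funD; apply: measurable_funM => //; exact: measurable_pair_fst.
  - by apply: measurable_pair_snd; exact: cc_measurable.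
  - by apply: measurable_funB; apply: measurable_funM => //; exact: measurable_pair_fst.
have sin1 (u : R) : `|sin u| <= 1 by rewrite ler_norml sin_geN1 sin_le1.
have bF x y : `|F (x, y)| <= (`|Gre x| + `|Gim x|) * (`|a y| + `|b y|).
  rewrite /F /= [leRHS]mulrC [leRHS]mulrDl; apply: le_trans (ler_normD _ _) _.
  apply: lerD; rewrite normrM ler_wpM2l//.
    by apply: le_trans (ler_normD _ _) _; apply: lerD; rewrite normrM ler_piMr// cos_abs_le1.
  rewrite [leRHS]addrC; apply: le_trans (ler_normB _ _) _.
  by apply: lerD; rewrite normrM ler_piMr// cos_abs_le1.
have Lg := L1D (L1_abs (Wclass_L1 Gre_Wclass)) (L1_abs (Wclass_L1 Gim_Wclass)).
have Lab := L1D (L1_abs (cc_L1 Ha)) (L1_abs (cc_L1 Hb)).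
have [L _ ] := Rfubini mF Lg Lab bF.
have E x : \int[mu]_y F (x, y) = Gre x ^+ 2 + Gim x ^+ 2.
  have mc : measurable_fun setT (fun y => cos (dotp x y)).
    by have := measurable_cosd x 0; under eq_fun do rewrite addr0.
  have ms : measurable_fun setT (fun y => sin (dotp x y)).
    by have := measurable_cosd x (- (pi / 2)); under eq_fun do rewrite cosBpihalf.
  have ma := cc_measurable Ha; have mb := cc_measurable Hb.
  have L1re : L1 mu (fun y => a y * cos (dotp x y) - b y * sin (dotp x y)).
    apply: (L1_dom _ _ Lab).
      by apply: measurable_funB; exact: measurable_funM.
    move=> y; apply: le_trans (ler_normB _ _) _.
    by apply: lerD; rewrite normrM ler_piMr// cos_abs_le1.
  have L1im : L1 mu (fun y => a y * sin (dotp x y) + b y * cos (dotp x y)).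
    apply: (L1_dom _ _ Lab).
      by apply: measurable_funD; exact: measurable_funM.
    move=> y; apply: le_trans (ler_normD _ _) _.
    by apply: lerD; rewrite normrM ler_piMr// cos_abs_le1.
  rewrite !expr2 {2}Gre_int {2}Gim_int -!RintegralZl// -RintegralD//; try exact: L1Z.
  by apply: eq_Rintegral => y _; rewrite /F/=; ring.
rewrite (_ : (fun x => _) = (fun x => Gre x ^+ 2 + Gim x ^+ 2)) in L; last by apply/funext.
move=> EF; split; first exact: L.
transitivity (\int[mu]_x \int[mu]_y F (x, y)); first by apply: eq_Rintegral => x _; rewrite E.
have L2ab : L1 mu (fun x => a x ^+ 2 + b x ^+ 2).
  have L2 c : cc c -> L1 mu (fun x => c x ^+ 2).
    move=> Hc; apply: cc_L1; have [sc _] := Hc.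
    by under eq_fun do rewrite expr2; exact: ccM.
  by apply: L1D; exact: L2.
rewrite EF -(RintZ kappa L2ab).
apply: eq_Rintegral => y _; rewrite /F /=.
have L1r : L1 mu (fun x => Gre x * cos (dotp x y) + Gim x * sin (dotp x y)).
  under eq_fun do rewrite Gre_rot.
  by apply: L1D; apply: W_L1; exact: cc_shift.
have L1i : L1 mu (fun x => Gim x * cos (dotp x y) - Gre x * sin (dotp x y)).
  under eq_fun do rewrite Gim_rot.
  by apply: L1D; apply: W_L1; exact: cc_shift.
rewrite (RintD (L1Z (a y) L1r) (L1Z (b y) L1i)).
rewrite (RintZ (a y) L1r) (RintZ (b y) L1i) Gre_rot_int Gim_rot_int; ring.
Qed.

End wave_packet.

(** * Non-stationary phase *)

Section directional_bounds.
Context {R : realType} {n : nat}.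
Local Notation Rn := 'rV[R]_n.
Local Notation mu := (lebesgue_rV R n).
Implicit Types (U : set Rn) (u : Rn) (F G : Rn -> R).

(** Only derivatives along the fixed direction [u] matter, quantified existentially as in [Cn]; one
    constant bounds all orders up to [k]. *)
Fixpoint cbound k (C : R) U u F : Prop :=
  (forall x, U x -> `|F x| <= C) /\
  if k is m.+1 then
    exists F', (forall x, U x -> is_derive x u F (F' x)) /\ cbound m C U u F'
  else True.

Lemma cbound_bound k C U u F x : cbound k C U u F -> U x -> `|F x| <= C.
Proof. by case: k => [|k] [H _]; exact: H. Qed.

Lemma cbound_le k (C C' : R) U u F : C <= C' -> cbound k C U u F -> cbound k C' U u F.
Proof.
move=> CC; elim: k F => [|k IH] F [bF DF]; (split; first by move=> x /bF /le_trans; apply) => //.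
by have [F' [HF' CF']] := DF; exists F'; split => //; exact: IH.
Qed.

Lemma cboundS k C U u F : cbound k.+1 C U u F -> cbound k C U u F.
Proof.
elim: k F => [|k IH] F [bF DF]; split => //.
by have [F' [HF' CF']] := DF; exists F'; split => //; exact: IH.
Qed.

Lemma cboundD k C C' U u F G : cbound k C U u F -> cbound k C' U u G ->
  cbound k (C + C') U u (fun x => F x + G x).
Proof.
elim: k F G => [|k IH] F G [bF DF] [bG DG];
  (split; first by move=> x Ux; apply: le_trans (ler_normD _ _) _; apply: lerD; [exact: bF|exact: bG]) => //.
have [F' [HF' CF']] := DF; have [G' [HG' CG']] := DG.
exists (fun x => F' x + G' x); split; last exact: IH.
by move=> x Ux; exact: (is_derive_add (HF' x Ux) (HG' x Ux)).
Qed.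

Lemma cboundN k C U u F : cbound k C U u F -> cbound k C U u (fun x => - F x).
Proof.
elim: k F => [|k IH] F [bF DF]; (split; first by move=> x Ux; rewrite normrN; exact: bF) => //.
have [F' [HF' CF']] := DF; exists (fun x => - F' x); split; last exact: IH.
move=> x Ux; have := is_derive_cmul (-1) (HF' x Ux).
by rewrite mulN1r; under eq_fun do rewrite mulN1r.
Qed.

(** Each use of the Leibniz rule doubles the number of terms, whence [2 ^+ k]. *)
Lemma cboundM k C C' U u F G : 0 <= C -> 0 <= C' -> cbound k C U u F -> cbound k C' U u G ->
  cbound k (2 ^+ k * (C * C')) U u (fun x => F x * G x).
Proof.
move=> C0 C0'; elim: k F G => [|k IH] F G CF CG; have [bF DF] := CF; have [bG DG] := CG.
  split => // x Ux; rewrite expr0 mul1r normrM ler_pM//; [exact: bF|exact: bG].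
split.
  move=> x Ux; apply: (@le_trans _ _ (C * C')).
    by rewrite normrM ler_pM//; [exact: bF|exact: bG].
  by rewrite ler_peMl ?mulr_ge0// exprn_ege1// ler1n.
have [F' [HF' CF']] := DF; have [G' [HG' CG']] := DG.
exists (fun x => F' x * G x + F x * G' x); split.
  by move=> x Ux; exact: (is_derive_mul (HF' x Ux) (HG' x Ux)).
rewrite exprS mulr_natl mulrnAl mulr2n; apply: cboundD; apply: IH => //; exact: cboundS.
Qed.

(** The constant precedes [U], [u] and [F], which later yields uniformity in the translation [h].
    Induction through [(1/F)' = - F' / F^2], whose two products account for the constant [C2]. *)
Lemma cboundV k (c C : R) : 0 < c -> 0 <= C -> exists2 C', 0 <= C' & forall U u F,
  (forall x, U x -> c <= `|F x|) -> cbound k C U u F -> cbound k C' U u (fun x => (F x)^-1).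
Proof.
move=> c0 C0; have V U F : (forall x : Rn, U x -> c <= `|F x|) -> forall x, U x -> `|(F x)^-1| <= c^-1.
  by move=> H x Ux; rewrite normfV lef_pV2 ?posrE ?H// (lt_le_trans c0)// H.
elim: k => [|k [C1 C10 IH]].
  by exists c^-1; [rewrite invr_ge0 ltW|move=> U u F H _; split => //; exact: V].
pose C2 := Num.max c^-1 (2 ^+ k * (2 ^+ k * (C * C1) * C1)).
exists C2; first by rewrite le_max invr_ge0 ltW.
move=> U u F H CF; have [bF DF] := CF; split.
  by move=> x Ux; rewrite le_max (V _ _ H _ Ux).
have [F' [HF' CF']] := DF.
exists (fun x => - (F' x * (F x)^-1 * (F x)^-1)); split.
  move=> x Ux; apply: is_deriveV; last exact: HF'.
  by rewrite -normr_gt0 (lt_le_trans c0)// H.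
apply: cboundN; apply: (@cbound_le _ (2 ^+ k * (2 ^+ k * (C * C1) * C1))).
  by rewrite le_max lexx orbT.
have CV := IH U u F H (cboundS CF).
apply: cboundM => //; first by rewrite mulr_ge0 ?exprn_ge0// mulr_ge0.
exact: cboundM.
Qed.

Lemma cbound_ext k C U u F G : open U -> (forall x, U x -> F x = G x) ->
  cbound k C U u F -> cbound k C U u G.
Proof.
move=> oU; case: k => [|k] FG [bF DF]; (split; first by move=> x Ux; rewrite -FG//; exact: bF) => //.
have [F' [HF' CF']] := DF; exists F'; split => // x Ux.
exact: (is_derive_open oU Ux FG (HF' x Ux)).
Qed.

Lemma measurable_fun_invr : measurable_fun setT (fun x : R => x^-1).
Proof.
have -> : [set: R] = [set x | x != 0] `|` [set 0].
  by apply/seteqP; split => x // _; have [->|x0] := eqVneq x 0; [right|left].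
have oD : open [set x : R | x != 0] by exact: open_neq.
apply/measurable_funU => //; first exact: open_measurable.
split; last exact: measurable_fun_set1.
apply: open_continuous_measurable_fun => // x; rewrite inE/= => x0.
exact: inv_continuous.
Qed.

(* Each integration by parts along [u] gains a factor [lambda]. *)
Lemma nonstationary k (c C M : R) : 0 < c -> 0 <= C -> 0 <= M -> exists2 C', 0 <= C' &
  forall (U K : set Rn) u (b psi psi' : Rn -> R) (lambda th : R),
   open U -> closed K -> K `<=` U -> K `<=` box n M ->
   measurable_fun setT b -> measurable_fun setT psi -> measurable_fun setT psi' ->
   (forall x, ~ K x -> b x = 0) -> cbound k C U u b ->
   (forall x, U x -> is_derive x u psi (psi' x)) ->
   (forall x, U x -> c <= `|psi' x|) -> cbound k C U u psi' -> 0 < lambda ->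
   lambda ^+ k * `|\int[mu]_x (b x * cos (lambda * psi x + th))| <= C'.
Proof.
move=> c0 C0 M0.
have mcos (l t : R) (f : Rn -> R) : measurable_fun setT f -> measurable_fun setT (fun x => cos (l * f x + t)).
  move=> mf; have mc : measurable_fun setT (@cos R).
    by apply: continuous_measurable_fun; exact: continuous_cos.
  by apply: (measurableT_comp mc); apply: measurable_funD => //; exact: measurable_funM.
elim: k C C0 => [|k IH] C C0.
  exists (C * (2 * M) ^+ n); first by rewrite mulr_ge0// exprn_ge0// mulr_ge0.
  move=> U K u b psi psi' l th oU cK KU KM mb mpsi mpsi' bK [bb _] _ _ _ _.
  rewrite expr0 mul1r; apply: Rint_bounded => //.
    by apply: measurable_funM => //; exact: mcos.
  move=> x; have [Kx|Kx] := pselect (K x); last first.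
    by rewrite bK// mul0r normr0 mulr_ge0.
  rewrite indicE mem_set ?mulr1; last exact: KM.
  by rewrite normrM (le_trans (ler_piMr _ (cos_abs_le1 _)))// bb//; exact: KU.
have [CV CV0 HV] := @cboundV k.+1 c C c0 C0.
(* Bound for [b / psi'] up to order [k + 1], hence for its derivative, the new amplitude, up to
   order [k]: each integration by parts costs one order. *)
pose C1 := 2 ^+ k.+1 * (C * CV).
have C10 : 0 <= C1 by rewrite mulr_ge0 ?exprn_ge0// mulr_ge0.
have CC1 : C <= C + C1 by rewrite lerDl.
have [C' C'0 HC'] := IH (C + C1) (addr_ge0 C0 C10).
exists C' => // U K u b psi psi' l th oU cK KU KM mb mpsi mpsi' bK cb dpsi lpsi cpsi l0.
have psi0 x : U x -> psi' x != 0 by move=> Ux; rewrite -normr_gt0 (lt_le_trans c0)// lpsi.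
have cV := HV U u psi' lpsi cpsi.
have [_ [q' [dq cq]]] := cboundM C0 CV0 cb cV.
(* Since [cos (l psi + th)] is the derivative of [cos (l psi + th - pi / 2)] divided by [l psi'],
   the function to differentiate is [b / psi']. *)
pose q x := b x * (psi' x)^-1.
(* [q'] is only given on [U]; set to 0 off [K], it is the derivative of [q] everywhere, since [q]
   vanishes on the open complement of [K]. *)
pose b1 x := if `[< K x >] then q' x else 0.
have q0 x : ~ K x -> q x = 0 by move=> /bK; rewrite /q => ->; rewrite mul0r.
have near0 x (G : Rn -> R) : (forall y, ~ K y -> G y = 0) -> ~ K x -> is_derive x u G 0.
  move=> HG Kx; apply: (@is_derive_open _ _ (~` K) (fun=> 0)) => //.
  - exact: closed_openC.
  - by move=> y /HG.
have db1 x : is_derive x u q (b1 x).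
  rewrite /b1; case: asboolP => Kx; first exact/dq/KU.
  exact: near0.
pose F x := q x * (l * cos (l * psi x + (th - pi / 2))).
pose F' x := b1 x * (l * cos (l * psi x + (th - pi / 2))) + q x * (l * (cos (l * psi x + th) * (l * psi' x))).
have qC x : `|q x| <= C1.
  have [Kx|Kx] := pselect (K x); last by rewrite q0// normr0.
  exact: (cbound_bound (cboundM C0 CV0 cb cV) (KU _ Kx)).
have b1C x : `|b1 x| <= C1.
  rewrite /b1; case: asboolP => Kx; last by rewrite normr0.
  exact: (cbound_bound cq (KU _ Kx)).
have b10 x : ~ K x -> b1 x = 0 by rewrite /b1; case: asboolP.
have b1E x : U x -> q' x = b1 x.
  move=> Ux; rewrite /b1; case: asboolP => // Kx.
  exact: is_derive_uniq (dq x Ux) (near0 x q q0 Kx).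
have nbox x : ~ box n M x -> ~ K x by move=> H /KM.
have mq : measurable_fun setT q.
  apply: measurable_funM => //.
  exact: (measurableT_comp measurable_fun_invr mpsi').
have Lq : L1 mu q by apply: (L1_bounded_supp (C := C1) M0) => // x /nbox /q0.
have [mb1 _] := Rint_derive0 M0 Lq (fun x H => q0 x (nbox x H)) db1 b1C.
have FE x : q x * (l * (cos (l * psi x + th) * (l * psi' x))) = l ^+ 2 * (b x * cos (l * psi x + th)).
  rewrite /q; have [Kx|Kx] := pselect (K x); last by rewrite bK// !mul0r mulr0.
  by field; exact/psi0/KU.
have dF x : is_derive x u F (F' x).
  have [Kx|Kx] := pselect (K x); last first.
    rewrite /F' b10// q0// !mul0r addr0; apply: near0 => // y Ky.
    by rewrite /F q0// mul0r.
  have Ux := KU _ Kx.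
  have := is_derive_comp1 (is_derive_cmul l (dpsi x Ux)) (is_derive_cos_shift (th - pi / 2) _).
  rewrite subrK => /(is_derive_cmul l) H.
  exact: is_derive_mul.
have mc t : measurable_fun setT (fun x => cos (l * psi x + t)) by exact: mcos.
have bl (x t y B : R) : `|x| <= B -> `|x * (y * cos t)| <= B * `|y|.
  move=> xB; rewrite !normrM ler_pM//.
  by rewrite ler_piMr// cos_abs_le1.
have LF : L1 mu F.
  apply: (L1_bounded_supp (C := C1 * `|l|) M0).
  - apply: measurable_funM => //; exact: measurable_funM.
  - by move=> x /nbox /q0; rewrite /F => ->; rewrite mul0r.
  - by move=> x; exact: bl.
have F0 x : ~ box n M x -> F x = 0 by move=> /nbox /q0; rewrite /F => ->; rewrite mul0r.
have bC x : `|b x| <= C.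
  have [Kx|Kx] := pselect (K x); last by rewrite bK// normr0.
  exact: (cbound_bound cb (KU _ Kx)).
have F'C x : `|F' x| <= C1 * `|l| + C * `|l ^+ 2|.
  rewrite /F' FE [l ^+ 2 * _]mulrCA; apply: le_trans (ler_normD _ _) _.
  by apply: lerD; exact: bl.
have [_] := Rint_derive0 M0 LF (fun x H => F0 x H) dF F'C.
have L1b1 : L1 mu (fun x => b1 x * cos (l * psi x + (th - pi / 2))).
  apply: (L1_bounded_supp (C := C1) M0).
  - exact: measurable_funM.
  - by move=> x /nbox /b10 ->; rewrite mul0r.
  - by move=> x; rewrite normrM (le_trans (ler_piMr _ (cos_abs_le1 _))).
have L1b : L1 mu (fun x => b x * cos (l * psi x + th)).
  apply: (L1_bounded_supp (C := C) M0).
  - exact: measurable_funM.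
  - by move=> x /nbox /bK ->; rewrite mul0r.
  - by move=> x; rewrite normrM (le_trans (ler_piMr _ (cos_abs_le1 _))).
rewrite /F'; under eq_Rintegral do rewrite FE mulrCA.
rewrite RintegralD//; try exact: L1Z.
rewrite !RintegralZl// => E.
(* One factor [l] is gained; the remaining integral has amplitude [b1], to which the induction
   hypothesis applies. *)
have E2 : l * \int[mu]_x (b x * cos (l * psi x + th)) = - \int[mu]_x (b1 x * cos (l * psi x + (th - pi / 2))).
  apply: (mulfI (lt0r_neq0 l0)); apply/eqP; rewrite mulrA -expr2 mulrN -addr_eq0 addrC.
  by rewrite E => //.
rewrite exprS -mulrA mulrCA -[X in X * `|_|](gtr0_norm l0) -normrM E2 normrN.
apply: (HC' U K u b1 psi psi' l (th - pi / 2)) => //.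
- apply: (cbound_ext oU b1E); apply: (cbound_le _ cq); by rewrite lerDr.
- exact: (cbound_le CC1 (cboundS cpsi)).
Qed.

End directional_bounds.

(** * Bounds uniform in the translation and in the direction *)

Section uniform_bounds.
Context {R : realType} {n : nat}.
Local Notation Rn := 'rV[R]_n.
Implicit Types (U : set Rn) (u h : Rn) (F : Rn -> R).

Lemma cboundZ k c C U u F : cbound k C U u F -> cbound k (`|c| * C) U u (fun x => c * F x).
Proof.
elim: k F => [|k IH] F [bF DF];
  (split; first by move=> x Ux; rewrite normrM ler_wpM2l//; exact: bF) => //.
have [F' [HF' CF']] := DF; exists (fun x => c * F' x); split; last exact: IH.
by move=> x Ux; exact: is_derive_cmul (HF' x Ux).
Qed.

Lemma cbound0 k U u : cbound k 0 U u (fun=> 0).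
Proof.
elim: k => [|k IH]; (split; first by move=> x _; rewrite normr0) => //.
by exists (fun=> 0); split => // x _; exact: is_derive_const.
Qed.

Lemma cbound_sum k A C U u (c : 'I_n -> R) (F : 'I_n -> Rn -> R) (r : seq 'I_n) : 0 <= C ->
  (forall i, `|c i| <= A) -> (forall i, cbound k C U u (F i)) ->
  cbound k ((size r)%:R * (A * C)) U u (fun x => \sum_(i <- r) c i * F i x).
Proof.
move=> C0 cA CF; elim: r => [|i r IH].
  by under eq_fun do rewrite big_nil; rewrite mul0r; exact: cbound0.
under eq_fun do rewrite big_cons; rewrite /= -natr1 mulrDl mul1r addrC.
apply: cboundD => //; apply: (cbound_le _ (cboundZ (c i) (CF i))).
by rewrite ler_wpM2r.
Qed.

Lemma uniform_const (P : 'I_n -> R -> Prop) :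
  (forall i C C', C <= C' -> P i C -> P i C') ->
  (forall i, exists2 C, 0 <= C & P i C) -> exists2 C, 0 <= C & forall i, P i C.
Proof.
move=> mono H; have H' i : exists C, 0 <= C /\ P i C by have [C] := H i; exists C.
have [f Hf] := choice H'; exists (\sum_i f i); first by apply: sumr_ge0 => i _; have [] := Hf i.
move=> i; have [_] := Hf i; apply: mono; rewrite (bigD1 i)//= lerDl sumr_ge0// => j _.
by have [] := Hf j.
Qed.

Lemma continuous_norm_sub (c : Rn) : continuous (fun x : Rn => `|x - c|).
Proof.
move=> x; apply: continuous_eps => e e0; exists e => // y /ltW xy.
by apply: le_trans xy; rewrite (le_trans (ler_dist_dist _ _))// opprB addrA subrK.
Qed.

Lemma closed_norm_sub (c : Rn) (r : R) : closed [set x : Rn | `|x - c| <= r].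
Proof.
apply: (@closed_comp _ _ (fun x : Rn => `|x - c|) [set y | y <= r]); last exact: closed_le.
by move=> x _; exact: continuous_norm_sub.
Qed.

Lemma open_norm_sub (c : Rn) (r : R) : open [set x : Rn | `|x - c| < r].
Proof.
apply: (@open_comp _ _ (fun x : Rn => `|x - c|) [set y | y < r]); last exact: open_lt.
by move=> x _; exact: continuous_norm_sub.
Qed.

Lemma norm_box (c : Rn) (r : R) x : `|x - c| <= r -> box n (`|c| + r) x.
Proof.
move=> H i; have := rV_coord_le c i; have := le_trans (rV_coord_le (x - c) i) H.
by rewrite !mxE !ler_norml; lra.
Qed.

Section smooth_function.
Variables (V : set Rn) (g : Rn -> R) (x0 : Rn) (rho A : R).
Hypotheses (oV : open V) (sg : smooth_on V g).
Hypotheses (BV : forall x, `|x - x0| <= rho -> V x) (A0 : 0 <= A).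

Lemma partials_is_derive s x u : V x ->
  is_derive x u (partials s g) (\sum_i u 0 i * partials (i :: s) g x).
Proof.
move=> Vx; apply: (C1_is_derive u oV Vx) => [y i Vy|i]; first by have [_] := sg s Vy; exact.
by have [] := sg (i :: s) Vx.
Qed.

Lemma partials_bound s : exists2 C, 0 <= C & forall x, `|x - x0| <= rho -> `|partials s g x| <= C.
Proof.
apply: (@compact_bound _ _ [set x | `|x - x0| <= rho]); last first.
  by move=> x /BV Vx; have [] := sg s Vx.
apply: (subclosed_compact (@closed_norm_sub x0 rho) (@box_compact _ _ (`|x0| + rho))).
by move=> x; exact: norm_box.
Qed.

(** The derivative along [u] is a combination of partials with coefficients bounded by [A], so the
    induction on [k] runs over all [s] and yields a constant independent of [h] and [u]. *)
Lemma cbound_shift k s : exists2 C, 0 <= C & forall h u U, (forall i, `|u 0 i| <= A) ->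
  (forall x, U x -> `|x + h - x0| <= rho) -> cbound k C U u (fun x => partials s g (x + h)).
Proof.
elim: k s => [|k IH] s; have [C0 C00 HC0] := partials_bound s.
  by exists C0 => // h u U _ HU; split => // x Ux; exact/HC0/HU.
have [|C1 C10 HC1] := uniform_const _ (fun i => IH (i :: s)).
  move=> i C C' CC H h u U Hu HU; apply: (cbound_le CC); exact: H.
have nA : 0 <= n%:R * (A * C1) by rewrite !mulr_ge0.
exists (C0 + n%:R * (A * C1)); first exact: addr_ge0.
move=> h u U Hu HU; split.
  by move=> x Ux; rewrite (le_trans (HC0 _ (HU _ Ux)))// lerDl.
exists (fun x => \sum_i u 0 i * partials (i :: s) g (x + h)); split.
  by move=> x Ux; apply: is_derive_translate; apply: partials_is_derive; exact/BV/HU.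
apply: (@cbound_le _ _ _ (n%:R * (A * C1))); first by rewrite lerDr.
rewrite -[X in X%:R * _](size_enum_ord n) enumT.
by apply: cbound_sum => // i; exact: HC1.
Qed.

Lemma ball_segment x h (sg0 : R) : 0 <= sg0 <= 1 -> `|x - x0| <= rho -> `|x + h - x0| <= rho ->
  `|sg0 *: h + x - x0| <= rho.
Proof.
move=> /andP[s0 s1] H1 H2.
have -> : sg0 *: h + x - x0 = sg0 *: (x + h - x0) + (1 - sg0) *: (x - x0).
  by apply/rowP => i; rewrite !mxE; ring.
apply: le_trans (ler_normD _ _) _; rewrite !normrZ (ger0_norm s0) ger0_norm ?subr_ge0//.
have -> : rho = sg0 * rho + (1 - sg0) * rho by ring.
by apply: lerD; rewrite ler_wpM2l// subr_ge0.
Qed.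

Lemma partials_mvt s x h : `|x - x0| <= rho -> `|x + h - x0| <= rho ->
  exists2 y, `|y - x0| <= rho &
    partials s g (x + h) - partials s g x = \sum_i h 0 i * partials (i :: s) g y.
Proof.
move=> H1 H2.
have [s0|sg0 Hs E] := @mvt_line _ _ (partials s g) x h
    (fun s0 => \sum_i h 0 i * partials (i :: s) g (s0 *: h + x)).
  by move=> Hs; apply: partials_is_derive; apply/BV; exact: ball_segment.
exists (sg0 *: h + x); first exact: (ball_segment Hs H1 H2).
by rewrite [x + h]addrC.
Qed.

(** The mean value theorem pays for the factor [|h|^-1] with one more partial derivative, so the
    bounds do not degrade as [h] tends to 0. *)
Lemma cbound_diff k s : exists2 C, 0 <= C & forall h u U, h != 0 -> (forall i, `|u 0 i| <= A) ->
  (forall x, U x -> `|x - x0| <= rho /\ `|x + h - x0| <= rho) ->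
  cbound k C U u (fun x => `|h|^-1 * (partials s g (x + h) - partials s g x)).
Proof.
have B s' : exists2 C, 0 <= C & forall h x, h != 0 -> `|x - x0| <= rho -> `|x + h - x0| <= rho ->
    `| `|h|^-1 * (partials s' g (x + h) - partials s' g x) | <= C.
  have [|C1 C10 HC1] := uniform_const _ (fun i => partials_bound (i :: s')).
    by move=> i C C' CC H x Hx; apply: le_trans CC; exact: H.
  exists (n%:R * C1); first by rewrite mulr_ge0.
  move=> h x h0 H1 H2; have [y Hy ->] := partials_mvt s' H1 H2.
  rewrite normrM ger0_norm ?invr_ge0// ler_pdivrMl ?normr_gt0//.
  have := @rV_normM_sum _ _ h (\row_i partials (i :: s') g y) C1.
  under eq_bigr do rewrite mxE; rewrite mulrCA mulrA; apply => i.
  by rewrite mxE; exact: HC1.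
elim: k s => [|k IH] s; have [C0 C00 HC0] := B s.
  by exists C0 => // h u U h0 _ HU; split => // x /HU[H1 H2]; exact: HC0.
have [|C1 C10 HC1] := uniform_const _ (fun i => IH (i :: s)).
  move=> i C C' CC H h u U h0 Hu HU; apply: (cbound_le CC); exact: H.
have nA : 0 <= n%:R * (A * C1) by rewrite !mulr_ge0.
exists (C0 + n%:R * (A * C1)); first exact: addr_ge0.
move=> h u U h0 Hu HU; split.
  by move=> x /HU[H1 H2]; rewrite (le_trans (HC0 _ _ h0 H1 H2))// lerDl.
exists (fun x => \sum_i u 0 i * (`|h|^-1 * (partials (i :: s) g (x + h) - partials (i :: s) g x))).
split.
  move=> x /HU[/BV H1 /BV H2].
  have := is_derive_cmul `|h|^-1 (is_derive_add
    (is_derive_translate (partials_is_derive s u H2)) (is_derive_cmul (-1) (partials_is_derive s u H1))).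
  under eq_fun do rewrite mulN1r.
  rewrite mulN1r -sumrB mulr_sumr => HD.
  rewrite (eq_bigr (fun i => `|h|^-1 * (u 0 i * partials (i :: s) g (x + h) - u 0 i * partials (i :: s) g x)))//.
  by move=> i _; ring.
apply: (@cbound_le _ _ _ (n%:R * (A * C1))); first by rewrite lerDr.
rewrite -[X in X%:R * _](size_enum_ord n) enumT.
by apply: cbound_sum => // i; exact: HC1.
Qed.

End smooth_function.

End uniform_bounds.

(** * The dispersive estimate *)

Lemma near_forall (T : topologicalType) (I : finType) (P : I -> T -> Prop) (x : T) :
  (forall i, \forall y \near x, P i y) -> \forall y \near x, forall i, P i y.
Proof. by move=> H; apply: filter_forall. Qed.

Section kernel.
Context {R : realType} {n : nat}.
Local Notation Rn := 'rV[R]_n.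
Local Notation mu := (lebesgue_rV R n).
Variables (V : set Rn) (g : Rn -> R) (x0 : Rn).
Hypotheses (oV : open V) (sg : smooth_on V g) (Vx0 : V x0).
Hypothesis Hdet : (\matrix_(i, j) partials [:: i; j] g x0) \in unitmx.
Hypotheses (mg : measurable_fun setT g) (mdg : forall j, measurable_fun setT (partials [:: j] g)).

(* In the direction [u = D^2 g(x0) h / |h|] the derivative of the increment
   [g (x + h) - g x] is close to [|h| |u|^2]. *)
Lemma phase_derivative_lower : exists rho c A, [/\ 0 < rho, 0 < c, 0 <= A,
  forall x, `|x - x0| <= rho -> V x & forall h, h != 0 -> exists2 u : Rn, (forall i, `|u 0 i| <= A) &
  forall x, `|x - x0| <= rho -> `|x + h - x0| <= rho ->
   c <= \sum_j u 0 j * (`|h|^-1 * (partials [:: j] g (x + h) - partials [:: j] g x))].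
Proof.
pose H : 'M[R]_n := \matrix_(i, j) partials [:: i; j] g x0.
have [B B0 HB] : exists2 B, 0 <= B & forall i, forall j, `|H i j| <= B.
  apply: uniform_const => [i C C' CC HC j|i]; first exact: le_trans (HC j) CC.
  by apply: uniform_const => [j C C' CC HC|j]; [exact: le_trans HC CC|exists `|H i j|].
have [B' B'0 HB'] : exists2 B, 0 <= B & forall i, forall j, `|invmx H i j| <= B.
  apply: uniform_const => [i C C' CC HC j|i]; first exact: le_trans (HC j) CC.
  by apply: uniform_const => [j C C' CC HC|j]; [exact: le_trans HC CC|exists `|invmx H i j|].
pose A := n%:R * B; have A0 : 0 <= A by rewrite mulr_ge0.
(* From [h = |h| u H^-1] comes [1 <= n B' |u|], so [c0] is a lower bound for [|u|^2]. *)
pose c0 := ((n%:R * B' + 1) ^+ 2)^-1.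
have nB1 : 0 < n%:R * B' + 1 by rewrite ltr_pwDr// mulr_ge0.
have c00 : 0 < c0 by rewrite invr_gt0 exprn_gt0.
(* Chosen so that the total error [n^2 A e] is at most [c0 / 2]; the added 1 keeps the denominator
   positive. *)
pose e := c0 / 2 / (n%:R * (A * n%:R) + 1).
have D0 : 0 < n%:R * (A * n%:R) + 1 by rewrite ltr_pwDr// !mulr_ge0.
have e0 : 0 < e by rewrite !divr_gt0.
have Hnear : \forall y \near x0, V y /\ forall i j, `|partials [:: i; j] g y - H i j| <= e.
  apply: filterI; first exact: open_nbhs_nbhs.
  have HN i j : \forall y \near x0, `|partials [:: i; j] g y - H i j| <= e.
    have [/cvgrPdist_le/(_ e e0) + _] := sg [:: i; j] Vx0.
    by apply: filterS => y; rewrite distrC mxE.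
  have HN2 i := @near_forall _ _ _ x0 (HN i).
  exact: (near_forall HN2).
have /nbhs_ballP[r /= r0 Hr] := Hnear.
have Hball y : `|y - x0| <= r / 2 -> V y /\ forall i j, `|partials [:: i; j] g y - H i j| <= e.
  move=> Hy; apply: Hr; rewrite -ball_normE/= distrC (le_lt_trans Hy)//.
  by rewrite ltr_pdivrMr// ltr_pMr// ltr1n.
exists (r / 2), (c0 / 2), A; split => //; [by rewrite divr_gt0|by rewrite divr_gt0|by move=> x /Hball[]|].
move=> h h0; pose u : Rn := `|h|^-1 *: (h *m H).
have nh0 : 0 < `|h| by rewrite normr_gt0.
have uA i : `|u 0 i| <= A.
  rewrite !mxE normrM ger0_norm ?invr_ge0// ler_pdivrMl// /A mulrCA mulrA.
  have := @rV_normM_sum _ _ h (\row_j H j i) B.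
  by under eq_bigr do rewrite mxE; apply => j; rewrite mxE.
exists u => // x Hx Hxh.
have uu : c0 <= dotp u u.
  have E : h = `|h| *: (u *m invmx H).
    by rewrite /u -scalemxAl mulmxK// scalerA mulfV ?scale1r// gt_eqF.
  have u1 : 1 <= n%:R * B' * `|u|.
    rewrite -(ler_pMr _ nh0); apply/rV_norm_le => [|i]; first by rewrite !mulr_ge0.
    rewrite {1}E mxE normrM normr_id ler_wpM2l// mxE.
    have K : `|\sum_j u 0 j * (\row_k invmx H k i) 0 j| <= n%:R * `|u| * B'.
      by apply: rV_normM_sum => j; rewrite mxE.
    rewrite mulrAC; apply: le_trans K.
    by rewrite (eq_bigr (fun j => u 0 j * (\row_k invmx H k i) 0 j))// => j _; rewrite [in RHS]mxE.
  have uu2 : `|u| ^+ 2 <= dotp u u.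
    rewrite -[leRHS]sqr_sqrtr ?dotp_ge0// ler_pXn2r ?nnegrE ?sqrtr_ge0//.
    apply/rV_norm_le => [|i]; first exact: sqrtr_ge0.
    by rewrite -sqrtr_sqr ler_wsqrtr// dotp_coord_le.
  apply: le_trans uu2; rewrite /c0 -exprVn ler_pXn2r ?nnegrE ?invr_ge0 ?(ltW nB1)//.
  rewrite -[leLHS]mulr1 ler_pdivrMl// (le_trans u1)// mulrDl mul1r lerDl//.
pose v : Rn := \row_j (`|h|^-1 * (partials [:: j] g (x + h) - partials [:: j] g x)).
have vu j : `|v 0 j - u 0 j| <= n%:R * e.
  have BV y : `|y - x0| <= r / 2 -> V y by move=> /Hball[].
  have [y Hy E] := partials_mvt oV sg BV [:: j] Hx Hxh.
  rewrite !mxE E -mulrBr normrM ger0_norm ?invr_ge0// ler_pdivrMl//.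
  rewrite -sumrB mulrCA mulrA.
  have := @rV_normM_sum _ _ h (\row_i (partials [:: i; j] g y - H i j)) e.
  under eq_bigr do rewrite mxE mulrBr; apply => i.
  by rewrite mxE; have [_] := Hball y Hy.
rewrite (eq_bigr (fun j => u 0 j * v 0 j)); last by move=> j _; rewrite [v 0 j]mxE.
rewrite (eq_bigr (fun j => u 0 j * u 0 j + u 0 j * (v 0 j - u 0 j))); last by move=> j _; ring.
rewrite big_split/= -/(dotp u u).
have : `|\sum_j u 0 j * (v 0 j - u 0 j)| <= c0 / 2.
  apply: le_trans (ler_norm_sum _ _ _) _.
  apply: (@le_trans _ _ (\sum_(j < n) A * (n%:R * e))).
    by apply: ler_sum => j _; rewrite normrM ler_pM.
  have De : (n%:R * (A * n%:R) + 1) * e = c0 / 2 by rewrite mulrC divfK ?gt_eqF.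
  rewrite sumr_const card_ord -mulr_natl -De -subr_ge0.
  by rewrite (_ : _ - _ = e) ?ltW//; ring.
rewrite ler_norml; lra.
Qed.

Lemma measurable_translate (f : Rn -> R) (h : Rn) : measurable_fun setT f ->
  measurable_fun setT (fun x : Rn => f (x + h)).
Proof.
move=> mf; apply: (measurableT_comp mf).
by apply: measurable_add; [exact: measurable_id|exact: measurable_cst].
Qed.

(* Correlation in [h]: its integral over [h], with [th = x.h], is [|G t (x)|^2]. *)
Definition kernel (r t th : R) (h : Rn) : R :=
  \int[mu]_x (bump x0 r x * bump x0 r (x + h) * cos (t * (g (x + h) - g x) + th)).

Lemma kernel_meas (r t th : R) (h : Rn) : 0 < r ->
  measurable_fun setT (fun x : Rn => bump x0 r x * bump x0 r (x + h) * cos (t * (g (x + h) - g x) + th)).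
Proof.
move=> r0; have mb : measurable_fun setT (bump x0 r) by exact: (cc_measurable (bump_cc x0 r0)).
have mc : measurable_fun setT (@cos R).
  by apply: continuous_measurable_fun; exact: continuous_cos.
apply: measurable_funM; first by apply: measurable_funM => //; exact: measurable_translate.
apply: (measurableT_comp mc); apply: measurable_funD => //; apply: measurable_funM => //.
by apply: measurable_funB => //; exact: measurable_translate.
Qed.

Lemma kernel_bounded (r : R) : 0 < r -> exists2 C, 0 <= C & forall t th h, `|kernel r t th h| <= C.
Proof.
move=> r0; have [C [M [C0 M0 HC]]] := cc_bound (bump_cc x0 r0).
exists (C * C * (2 * M) ^+ n) => [|t th h]; first by rewrite !mulr_ge0// exprn_ge0// mulr_ge0.
apply: Rint_bounded => //; first exact: kernel_meas.
move=> x; rewrite !normrM -mulrA [C * C]mulrC -mulrA mulrC.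
have H y : `|bump x0 r y| <= C.
  by rewrite (le_trans (HC y))// ler_piMr// indicE; case: (_ \in _).
by apply: ler_pM => //; rewrite -[C]mulr1 ler_pM// cos_abs_le1.
Qed.

Lemma prod_le_exp (m B : R) (f : 'I_n -> R) : (forall i, 0 <= f i <= B) -> \prod_i f i <= B ^+ n.
Proof.
move=> H; have := @ler_prod R _ (index_enum 'I_n) xpredT f (fun=> B).
by rewrite prodr_const card_ord; apply.
Qed.

(** Here [2 n] integrations by parts give [(t |h|)^(-2n)]. As [|h|] is the maximum norm, the product
    of the [1 + (t h_i)^2] is at most [2^n] if [t |h| <= 1], where the trivial bound suffices, and
    at most [2^n (t |h|)^(2n)] otherwise. *)
Lemma kernel_decay : exists r C, [/\ 0 < r, forall x, `|x - x0| <= r -> V x &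
  forall (t th : R) (h : Rn), 0 < t -> `|kernel r t th h| <= C * decay (t *: h)].
Proof.
have [rho [c [A [rho0 c0 A0 BV Hlow]]]] := phase_derivative_lower.
(* Half of [rho], so that the closed set [K] carrying the amplitude sits inside the open set [U]
   where the phase is controlled. *)
pose r := rho / 2; have r0 : 0 < r by rewrite divr_gt0.
have rrho : r < rho by rewrite /r; lra.
have [C0 C00 HC0] := kernel_bounded r0.
have [sb _] := bump_cc x0 r0.
have [Cb Cb0 HCb] := cbound_shift openT sb (x0 := x0) (rho := rho) (fun _ _ => I) A0 (2 * n) [::].
have [|Cd Cd0 HCd] := uniform_const _ (fun j => cbound_diff oV sg BV A0 (2 * n) [:: j]).
  move=> i C C' CC H h u U h0 Hu HU; apply: (cbound_le CC); exact: H.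
pose Cpsi := n%:R * (A * Cd); have Cpsi0 : 0 <= Cpsi by rewrite !mulr_ge0.
pose Cbb := 2 ^+ (2 * n) * (Cb * Cb); have Cbb0 : 0 <= Cbb by rewrite mulr_ge0 ?exprn_ge0// mulr_ge0.
have M0 : 0 <= `|x0| + r by rewrite addr_ge0// ltW.
have [C1 C10 HC1] := @nonstationary R n (2 * n) c (Cbb + Cpsi) (`|x0| + r) c0 (addr_ge0 Cbb0 Cpsi0) M0.
exists r, (2 ^+ n * (C0 + C1)); split => //.
  by move=> x H; apply: BV; rewrite (le_trans H)// ltW.
move=> t th h t0; pose l := t * `|h|.
have thl i : (t * h 0 i) ^+ 2 <= l ^+ 2.
  rewrite -[leLHS]real_normK ?num_real// ler_pXn2r ?nnegrE ?mulr_ge0 ?(ltW t0)//.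
  by rewrite normrM gtr0_norm// ler_wpM2l ?rV_coord_le// (ltW t0).
have -> : decay (t *: h) = (\prod_i (1 + (t * h 0 i) ^+ 2))^-1.
  by rewrite -prodfV; apply: eq_bigr => i _; rewrite mxE.
have P0 : 0 < \prod_i (1 + (t * h 0 i) ^+ 2).
  by apply: prodr_gt0 => i _; rewrite ltr_pwDl// sqr_ge0.
rewrite ler_pdivlMr// mulrC.
have [l1|l1] := leP l 1.
  rewrite ler_pM ?(ltW P0)//; last by rewrite (le_trans (HC0 _ _ _))// lerDl.
  apply: prod_le_exp => // i; rewrite addr_ge0 ?sqr_ge0//=.
  have := thl i; have : l ^+ 2 <= 1 by rewrite expr_le1// mulr_ge0 ?(ltW t0).
  lra.
have h0 : h != 0 by apply/eqP => h0; move: l1; rewrite /l h0 normr0 mulr0 ltr10.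
have l0 : 0 < l by rewrite (lt_trans _ l1).
apply: (@le_trans _ _ ((2 * l ^+ 2) ^+ n * `|kernel r t th h|)).
  rewrite ler_wpM2r//; apply: prod_le_exp => // i; rewrite addr_ge0 ?sqr_ge0//=.
  have := thl i; have : 1 <= l ^+ 2 by rewrite exprn_ege1// ltW.
  lra.
rewrite exprMn -mulrA ler_wpM2l ?exprn_ge0//; rewrite -exprM.
apply: (@le_trans _ _ C1); last by rewrite lerDr.
have [u Hu Hl] := Hlow h h0.
have subE x : x - (x0 - h) = x + h - x0 by rewrite opprB addrA.
(* Both [x] and [x + h] have to be close to [x0]; for [x + h] this is a ball centred at [x0 - h]. *)
pose U := [set x : Rn | `|x - x0| < rho] `&` [set x : Rn | `|x - (x0 - h)| < rho].
pose K := [set x : Rn | `|x - x0| <= r] `&` [set x : Rn | `|x - (x0 - h)| <= r].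
have KU : K `<=` U by move=> x [/= H1 H2]; split => /=; apply: le_lt_trans rrho.
have UU x : U x -> `|x - x0| <= rho /\ `|x + h - x0| <= rho.
  by move=> [/= H1]; rewrite subE => H2; split; exact: ltW.
(* Dividing the increment by [|h|] and moving [|h|] into the large parameter [l = t |h|] gives a
   phase with bounds independent of [h]. *)
pose psi x := `|h|^-1 * (g (x + h) - g x).
pose psi' x := \sum_j u 0 j * (`|h|^-1 * (partials [:: j] g (x + h) - partials [:: j] g x)).
have -> : kernel r t th h = \int[mu]_x (bump x0 r x * bump x0 r (x + h) * cos (l * psi x + th)).
  apply: eq_Rintegral => x _; congr (_ * cos (_ + _)).
  by rewrite /l /psi mulrA -[t * _ * _]mulrA divff ?mulr1// normr_eq0.
have mb : measurable_fun setT (bump x0 r) by exact: (cc_measurable (bump_cc x0 r0)).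
apply: (HC1 U K u _ psi psi') => //.
- by apply: openI; exact: open_norm_sub.
- by apply: closedI; exact: closed_norm_sub.
- by move=> x [/= /norm_box].
- by apply: measurable_funM => //; exact: measurable_translate.
- apply: measurable_funM => //; apply: measurable_funB => //; exact: measurable_translate.
- apply: measurable_sum => j; apply: measurable_funM => //; apply: measurable_funM => //.
  apply: measurable_funB; last exact: mdg.
  by apply: measurable_translate; exact: mdg.
- move=> x Kx; apply/eqP; rewrite mulf_eq0; apply/negPn/negP; rewrite negb_or => /andP[H1 H2].
  apply: Kx; split; rewrite /= leNgt; apply/negP => /ltW H.
    by move: H1; rewrite bump_supp// eqxx.
  by move: H2; rewrite bump_supp ?eqxx// -subE.
- apply: (@cbound_le _ _ _ Cbb); first by rewrite lerDl.
  apply: cboundM => //.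
    have := HCb 0 u U Hu; under [X in cbound _ _ _ _ X]eq_fun do rewrite addr0.
    by apply => x /UU[]; rewrite addr0.
  by have := HCb h u U Hu; apply => x /UU[].
- move=> x /UU[/BV V1 /BV V2]; rewrite /psi.
  have := is_derive_cmul `|h|^-1 (is_derive_add
    (is_derive_translate (partials_is_derive oV sg [::] u V2))
    (is_derive_cmul (-1) (partials_is_derive oV sg [::] u V1))).
  under eq_fun do rewrite mulN1r.
  rewrite mulN1r -sumrB mulr_sumr => HD.
  rewrite /psi' (eq_bigr (fun i => `|h|^-1 * (u 0 i * partials [:: i] g (x + h) - u 0 i * partials [:: i] g x)))//.
  by move=> i _; ring.
- move=> x /UU[H1 H2]; apply: le_trans (ler_norm _); exact: Hl.
- apply: (@cbound_le _ _ _ Cpsi); first by rewrite lerDr.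
  rewrite /Cpsi -[X in X%:R * _](size_enum_ord n) enumT.
  by apply: cbound_sum => // j; exact: HCd.
Qed.

End kernel.

(** * From the correlation kernel to the sup bound on wave packets *)

Section dispersive.
Context {R : realType} {n : nat}.
Local Notation Rn := 'rV[R]_n.
Local Notation mu := (lebesgue_rV R n).
Variables (V : set Rn) (g : Rn -> R) (x0 : Rn).
Hypotheses (oV : open V) (sg : smooth_on V g) (Vx0 : V x0).
Hypothesis Hdet : (\matrix_(i, j) partials [:: i; j] g x0) \in unitmx.
Hypotheses (mg : measurable_fun setT g) (mdg : forall j, measurable_fun setT (partials [:: j] g)).

Definition pre (r s : R) (x : Rn) : R := bump x0 r x * cos (s * g x).
Definition pim (r s : R) (x : Rn) : R := bump x0 r x * sin (s * g x).

Lemma smoothU (U U' : set Rn) f : smooth_on U f -> smooth_on U' f -> smooth_on (U `|` U') f.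
Proof. by move=> H H' s x [/H|/H']; apply. Qed.

(** Smoothness is local: [g] is smooth on [V], the product vanishes identically off the closed ball,
    and these two open sets cover the space. *)
Lemma cc_phase r s th : 0 < r -> (forall x, `|x - x0| <= r -> V x) ->
  cc (fun x => bump x0 r x * cos (s * g x + th)).
Proof.
move=> r0 BV; have [sb [M M0 HM]] := bump_cc x0 r0; split; last first.
  by exists M => // x /HM ->; rewrite mul0r.
have -> : setT = V `|` ~` [set x | `|x - x0| <= r].
  by apply/seteqP; split => // x _; have [/BV|] := pselect (`|x - x0| <= r); [left|right].
apply: smoothU.
  apply: Cn_smooth => // k; apply: CnM.
    by apply: smooth_Cn0 => q x _; exact: sb.
  apply: (@Cn_comp _ _ k V (fun x => s * g x) (fun y => cos (y + th))); first exact: D1n_cos.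
  by apply: CnM; [exact: Cn_cst|exact: smooth_Cn0].
have oW : open (~` [set x : Rn | `|x - x0| <= r]) by apply: closed_openC; exact: closed_norm_sub.
apply: Cn_smooth => // k; apply: (Cn_ext oW _ (Cn_cst k _ 0)) => x /= /negP.
by rewrite -ltNge => /ltW H; rewrite bump_supp// mul0r.
Qed.

Lemma cc_pre r s : 0 < r -> (forall x, `|x - x0| <= r -> V x) -> cc (pre r s).
Proof. by move=> r0 BV; have := cc_phase s 0 r0 BV; under eq_fun do rewrite addr0. Qed.

Lemma cc_pim r s : 0 < r -> (forall x, `|x - x0| <= r -> V x) -> cc (pim r s).
Proof. by move=> r0 BV; have := cc_phase s (- (pi / 2)) r0 BV; under eq_fun do rewrite cosBpihalf. Qed.

Section square.
Variables (r s : R) (x : Rn).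
Hypotheses (r0 : 0 < r) (BV : forall x, `|x - x0| <= r -> V x).
Local Notation S := (Gre (pre r s) (pim r s) x ^+ 2 + Gim (pre r s) (pim r s) x ^+ 2).

Let P y := s * g y + dotp x y.

Let L1P c : L1 mu (fun y => bump x0 r y * cos (P y + c)).
Proof.
have Lb := cc_L1 (bump_cc x0 r0); apply: (L1_dom _ _ (L1_abs Lb)); last first.
  by move=> y; rewrite normrM ler_piMr// cos_abs_le1.
have mc : measurable_fun setT (@cos R).
  by apply: continuous_measurable_fun; exact: continuous_cos.
apply: measurable_funM; first exact: L1_measurable Lb.
apply: (measurableT_comp mc); apply: measurable_funD => //; apply: measurable_funD.
  exact: measurable_funM.
by apply: measurable_dotp_pair; [exact: measurable_cst|exact: measurable_id].
Qed.

Let GreP : Gre (pre r s) (pim r s) x = \int[mu]_y (bump x0 r y * cos (P y + 0)).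
Proof.
rewrite Gre_int; [|exact: cc_pre|exact: cc_pim].
by apply: eq_Rintegral => y _; rewrite addr0 /pre /pim /P cosD; ring.
Qed.

Let GimP : Gim (pre r s) (pim r s) x = \int[mu]_y (bump x0 r y * cos (P y - pi / 2)).
Proof.
rewrite Gim_int; [|exact: cc_pre|exact: cc_pim].
by apply: eq_Rintegral => y _; rewrite cosBpihalf /pre /pim /P sinD; ring.
Qed.

(** Real part of [e^(-i P(z)) G(x)]: the substitution [y = z + h] leaves the phase
    [P(z + h) - P(z)], where [x] survives only through [x.h]. *)
Let rotP z : cos (P z) * Gre (pre r s) (pim r s) x + sin (P z) * Gim (pre r s) (pim r s) x =
  \int[mu]_h (bump x0 r (z + h) * cos (s * (g (z + h) - g z) + dotp x h)).
Proof.
rewrite GreP GimP -!RintZ// -RintD; try exact: L1Z.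
rewrite -[LHS](Rint_shift z); last by apply: L1D; exact: L1Z.
apply: eq_Rintegral => h _; rewrite addr0 cosBpihalf [h + z]addrC.
have -> : s * (g (z + h) - g z) + dotp x h = P (z + h) - P z by rewrite /P dotpDr; ring.
by rewrite cosB; ring.
Qed.

Let L1rot z : L1 mu (fun h => bump x0 r (z + h) * cos (s * (g (z + h) - g z) + dotp x h)).
Proof.
have := L1_shift z (L1P (- P z)).
rewrite (_ : (fun h => _) = (fun h => bump x0 r (z + h) * cos (s * (g (z + h) - g z) + dotp x h)))//.
by apply/funext => h; rewrite [h + z]addrC; congr (_ * cos _); rewrite /P dotpDr; ring.
Qed.

(** One factor of [|G|^2] is expanded over [z], the other is rotated by [e^(-i P(z))] and expanded
    over [h]; Fubini then puts the integral over [z] inside. *)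
Lemma Gc_sq_kernel : L1 mu (fun h => kernel g x0 r s (dotp x h) h) /\
  S = \int[mu]_h kernel g x0 r s (dotp x h) h.
Proof.
pose F (z : Rn * Rn) := bump x0 r z.1 * bump x0 r (z.1 + z.2) *
  cos (s * (g (z.1 + z.2) - g z.1) + dotp x z.2).
have Hb := bump_cc x0 r0; have mb := cc_measurable Hb.
have mc : measurable_fun setT (@cos R).
  by apply: continuous_measurable_fun; exact: continuous_cos.
have msum (f : Rn -> R) : measurable_fun setT f -> measurable_fun setT (fun z : Rn * Rn => f (z.1 + z.2)).
  move=> mf; apply: (measurableT_comp mf).
  by apply: measurable_add; [exact: measurable_fst|exact: measurable_snd].
have mF : measurable_fun setT F.
  apply: measurable_funM; first by apply: measurable_funM; [exact: measurable_pair_fst|exact: msum].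
  apply: (measurableT_comp mc); apply: measurable_funD.
    apply: measurable_funM => //; apply: measurable_funB; first exact: msum.
    exact: measurable_pair_fst.
  by apply: measurable_dotp_pair; [exact: measurable_cst|exact: measurable_snd].
have [C [M [C0 M0 HC]]] := cc_bound Hb.
(* If [z] and [z + h] lie in the cube of half-side [M], then [h] lies in that of half-side [2 M];
   this gives the product domination for Fubini. *)
have M20 : 0 <= M + M by rewrite addr_ge0.
have Lbox : L1 mu (fun h => C * \1_(box n (M + M)) h) by apply: L1Z; exact: L1_box.
have bF z h : `|F (z, h)| <= `|bump x0 r z| * (C * \1_(box n (M + M)) h).
  have [Kz|Kz] := pselect (box n M z); last first.
    have bz : bump x0 r z = 0.
      by apply/eqP; rewrite -normr_le0 (le_trans (HC z))// indicE memNset// mulr0.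
    by rewrite /F/= bz !mul0r normr0 mul0r.
  rewrite /F/= !normrM -mulrA ler_wpM2l//.
  apply: le_trans (ler_piMr _ (cos_abs_le1 _)) _ => //; apply: le_trans (HC _) _.
  rewrite ler_wpM2l// !indicE; have [zh|zh] := pselect (box n M (z + h)); last first.
    by rewrite memNset//; case: (_ \in _).
  rewrite mem_set// mem_set// => i.
  by have := zh i; have := Kz i; rewrite mxE; lra.
have [L1r L2 E] := Rfubini mF (L1_abs (cc_L1 Hb)) Lbox bF; split; first exact: L2.
rewrite [RHS](_ : _ = \int[mu]_z \int[mu]_h F (z, h)); last exact/esym/E.
transitivity (Gre (pre r s) (pim r s) x * \int[mu]_y (bump x0 r y * cos (P y + 0)) +
    Gim (pre r s) (pim r s) x * \int[mu]_y (bump x0 r y * cos (P y - pi / 2))).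
  by rewrite -GreP -GimP !expr2.
rewrite -(RintZ _ (L1P 0)) -(RintZ _ (L1P (- (pi / 2)))).
rewrite -(RintD (L1Z _ (L1P 0)) (L1Z _ (L1P (- (pi / 2))))).
apply: eq_Rintegral => z _.
transitivity (bump x0 r z * \int[mu]_h (bump x0 r (z + h) * cos (s * (g (z + h) - g z) + dotp x h))).
  by rewrite -rotP cosBpihalf addr0; ring.
rewrite -(RintZ _ (L1rot z)); apply: eq_Rintegral => h _; by rewrite /F/= mulrA.
Qed.

End square.

(** Integrating [decay (s *: h)] over [h] produces [|s|^(-n)], which bounds [|G|^2]: this is the
    origin of the rate [n / 2] for [|G|]. For [|s| <= 1] the L^1 norm of the bump is bound
    enough. *)
Lemma dispersive : exists r C, [/\ 0 < r, 0 <= C, forall x, `|x - x0| <= r -> V x &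
  forall (s : R) (x : Rn), (Gre (pre r s) (pim r s) x ^+ 2 + Gim (pre r s) (pim r s) x ^+ 2) * japanese s ^+ n <= C].
Proof.
have [r [C [r0 BV HC]]] := kernel_decay oV sg Vx0 Hdet mg mdg.
have [C1 C10 HC1] : exists2 C1, 0 <= C1 & forall s x,
    Gre (pre r s) (pim r s) x ^+ 2 + Gim (pre r s) (pim r s) x ^+ 2 <= C1.
  have Lb := cc_L1 (bump_cc x0 r0).
  pose I0 := \int[mu]_y `|bump x0 r y|.
  exists ((I0 + I0) ^+ 2 + (I0 + I0) ^+ 2); first by rewrite addr_ge0// sqr_ge0.
  move=> s x.
  have HW th : `|W (pre r s) th x| <= I0 /\ `|W (pim r s) th x| <= I0.
    have H1 := cc_pre s r0 BV; have H2 := cc_pim s r0 BV.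
    split; (apply: le_trans (W_bound _ _ _) _ => //; apply: le_trans (ler_norm _) _;
      apply: Rint_abs_le; [exact: L1_measurable (L1_abs (cc_L1 _))|exact: L1_abs|]) => y.
      by rewrite normr_id normrM ler_piMr// cos_abs_le1.
    by rewrite normr_id normrM ler_piMr// ler_norml sin_geN1 sin_le1.
  have sq (y z : R) : `|y| <= I0 -> `|z| <= I0 -> (y + z) ^+ 2 <= (I0 + I0) ^+ 2.
    move=> Hy Hz; rewrite -[leLHS]real_normK ?num_real// ler_pXn2r ?nnegrE ?addr_ge0 ?(le_trans _ Hy)//.
    by rewrite (le_trans (ler_normD _ _))// lerD.
  by apply: lerD; apply: sq; have [] := HW 0; have [] := HW (pi / 2); have [] := HW (- (pi / 2)).
pose D := \int[mu]_h decay (h : Rn).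
have D0 : 0 <= D by apply: Rintegral_ge0 => h _; exact/ltW/decay_gt0.
have HC2 (s : R) x : s != 0 -> (Gre (pre r s) (pim r s) x ^+ 2 + Gim (pre r s) (pim r s) x ^+ 2) * `|s| ^+ n <= `|C| * D.
  move=> s0; have ns0 : 0 < `|s| by rewrite normr_gt0.
  have [LK ->] := Gc_sq_kernel s x r0 BV.
  have Lc := L1_affine 0 ns0 (@L1_decay R n).
  have Ec := Rint_affine 0 ns0 (@L1_decay R n).
  rewrite /D -Ec mulrCA mulrC ler_wpM2l ?exprn_ge0// -RintZ//.
  apply: le_trans (ler_norm _) _; apply: Rint_abs_le; [exact: L1_measurable LK|exact: L1Z|].
  move=> h; rewrite addr0; apply: (@le_trans _ _ (C * decay (`|s| *: h))); last first.
    by rewrite ler_wpM2r ?ler_norm// ltW// decay_gt0.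
  have [sp|sn] := leP 0 s; first by rewrite (ger0_norm sp); apply: HC; rewrite lt_neqAle eq_sym s0.
  rewrite (ltr0_norm sn).
  (* Evenness of the cosine changes the signs of the time and of the phase together, and the kernel
     bound holds for every phase. *)
  have -> : kernel g x0 r s (dotp x h) h = kernel g x0 r (- s) (- dotp x h) h.
    by apply: eq_Rintegral => y _; rewrite -[in RHS]cosN; congr (_ * cos _); ring.
  by apply: HC; rewrite oppr_gt0.
have jle (s : R) : japanese s <= 2 * Num.max 1 `|s|.
  have m0 : 0 <= 2 * Num.max 1 `|s| by rewrite mulr_ge0// le_max ler01.
  rewrite /japanese -[leRHS](ger0_norm m0) -[leRHS]sqrtr_sqr ler_wsqrtr//.
  have : 1 <= Num.max 1 `|s| by rewrite le_max lexx.
  have : `|s| <= Num.max 1 `|s| by rewrite le_max lexx orbT.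
  have := normr_ge0 s; nra.
exists r, (2 ^+ n * (C1 + `|C| * D)); split => //.
  by rewrite mulr_ge0 ?exprn_ge0// addr_ge0// mulr_ge0.
move=> s x; set S := _ + _.
have S0 : 0 <= S by rewrite addr_ge0// sqr_ge0.
apply: (@le_trans _ _ (S * (2 * Num.max 1 `|s|) ^+ n)).
  by rewrite ler_wpM2l// lerXn2r ?nnegrE ?sqrtr_ge0// mulr_ge0// le_max ler01.
rewrite exprMn mulrCA ler_wpM2l ?exprn_ge0//.
case: (leP `|s| 1) => s1.
  by rewrite expr1n mulr1 (le_trans (HC1 s x))// lerDl mulr_ge0.
apply: le_trans (HC2 s x _) _; last by rewrite lerDr.
by rewrite -normr_gt0 (lt_trans _ s1).
Qed.

End dispersive.

(** * Points with an invertible Hessian *)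

Section critical_points.
Context {R : realType} {n : nat}.
Local Notation Rn := 'rV[R]_n.
Implicit Types (f : Rn -> R) (U : set Rn) (x v : Rn).

Lemma fermat_min f x v (a : R) : (\forall y \near x, f x <= f y) -> is_derive x v f a -> a = 0.
Proof.
move=> /nbhs_ballP[r /= r0 Hr] /is_derive_epsP Ha; apply/eqP; apply/negPn/negP => a0.
have a2 : 0 < `|a| / 2 by rewrite divr_gt0// normr_gt0.
have /nbhs_ballP[e /= e0 He] := Ha _ a2.
pose c := Num.min (e / 2) (r / (2 * (`|v| + 1))).
have v1 : 0 < `|v| + 1 by rewrite ltr_pwDr.
have c0 : 0 < c by rewrite lt_min !divr_gt0// mulr_gt0.
(* The sign opposite to [a] makes [h * a = - c |a|], which outweighs the error [c |a| / 2] and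
   contradicts minimality. *)
pose h := - (Num.sg a * c).
have nh : `|h| = c by rewrite normrN normrM normr_sg a0 mul1r gtr0_norm.
have ha : h * a = - (c * `|a|) by rewrite /h mulNr mulrAC mulrC -normrEsg.
have he : ball (0 : R) e h.
  rewrite -ball_normE/= sub0r normrN nh (@le_lt_trans _ _ (e / 2))//; first by rewrite ge_min lexx.
  by rewrite ltr_pdivrMr// ltr_pMr// ltr1n.
have hr : ball x r (h *: v + x).
  rewrite -ball_normE/= opprD addrCA subrr addr0 normrN normrZ nh.
  apply: (@le_lt_trans _ _ (r / (2 * (`|v| + 1)) * `|v|)).
    by rewrite ler_wpM2r// ge_min lexx orbT.
  rewrite mulrAC ltr_pdivrMr ?mulr_gt0// ltr_pM2l//; have := normr_ge0 v; lra.
have := He h he; rewrite nh ler_norml ha => /andP[_ H1].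
have := Hr _ hr => H2.
have : 0 < c * `|a| by rewrite mulr_gt0// normr_gt0.
nra.
Qed.

Lemma fermat_max f x v (a : R) : (\forall y \near x, f y <= f x) -> is_derive x v f a -> a = 0.
Proof.
move=> H /(is_derive_cmul (-1)) Ha; have : -1 * a = 0.
  apply: fermat_min Ha; apply: filterS H => y.
  by rewrite !mulN1r lerN2.
by rewrite mulN1r => /eqP; rewrite oppr_eq0 => /eqP.
Qed.

(** Mean value theorem in direction [j] for the increment in direction [i], then in direction [i]
    for the [j]-th partial derivative. *)
Lemma second_difference f U x i j (s r : R) : open U -> smooth_on U f ->
  (forall y, `|y - x| < r -> U y) -> 0 < s -> 2 * s < r -> exists2 y, `|y - x| < r &
  f (s *: delta_mx 0 j + (s *: delta_mx 0 i + x)) - f (s *: delta_mx 0 i + x) -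
   (f (s *: delta_mx 0 j + x) - f x) = s * s * partials [:: i; j] f y.
Proof.
move=> oU sf BU s0 sr.
have near_pt (a b : R) : 0 <= a <= 1 -> 0 <= b <= 1 ->
    `|a *: (s *: delta_mx 0 i) + (b *: (s *: delta_mx 0 j) + x) - x| < r.
  move=> /andP[a0 a1] /andP[b0 b1]; rewrite addrA addrK (le_lt_trans _ sr)//.
  have nd k : `|delta_mx 0 k : Rn| <= 1.
    by apply/rV_norm_le => // l; rewrite mxE; case: (_ && _); rewrite ?normr1 ?normr0.
  rewrite (le_trans (ler_normD _ _))// !normrZ !ger0_norm ?(ltW s0)//.
  have := nd i; have := nd j; have := normr_ge0 (delta_mx 0 i : Rn); have := normr_ge0 (delta_mx 0 j : Rn).
  set p := `|_|; set q := `|_| => p0 q0 p1 q1.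
  have : a * (s * q) <= s.
    rewrite (le_trans (ler_piMl _ a1)) ?mulr_ge0 ?(ltW s0)//; exact: ler_piMr (ltW s0) _.
  have : b * (s * p) <= s.
    rewrite (le_trans (ler_piMl _ b1)) ?mulr_ge0 ?(ltW s0)//; exact: ler_piMr (ltW s0) _.
  lra.
have D k q y : U y -> is_derive y (s *: delta_mx 0 k) (partials q f) (s * partials (k :: q) f y).
  move=> Uy; apply: is_derive_scale; apply: DeriveDef => //.
  by have [_] := sf q y Uy; apply.
have [z1 o1] : (0 <= (0 : R) <= 1) /\ (0 <= (1 : R) <= 1) by rewrite !lexx ler01.
have [|b Hb E1] := @mvt_line _ _ (fun y => f (y + s *: delta_mx 0 i) - f y) x (s *: delta_mx 0 j)
  (fun b => s * partials [:: j] f (b *: (s *: delta_mx 0 j) + x + s *: delta_mx 0 i) -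
            s * partials [:: j] f (b *: (s *: delta_mx 0 j) + x)).
  move=> b Hb.
  have U1 : U (b *: (s *: delta_mx 0 j) + x + s *: delta_mx 0 i).
    by apply: BU; have := near_pt 1 b o1 Hb; rewrite scale1r [X in `|X - _|]addrC.
  have U2 : U (b *: (s *: delta_mx 0 j) + x).
    by apply: BU; have := near_pt 0 b z1 Hb; rewrite scale0r add0r.
  have := is_derive_add (is_derive_translate (D j [::] _ U1)) (is_derive_cmul (-1) (D j [::] _ U2)).
  by rewrite mulN1r; under eq_fun do rewrite mulN1r.
have [|a Ha E2] := @mvt_line _ _ (partials [:: j] f) (b *: (s *: delta_mx 0 j) + x) (s *: delta_mx 0 i)
  (fun a => s * partials [:: i; j] f (a *: (s *: delta_mx 0 i) + (b *: (s *: delta_mx 0 j) + x))).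
  by move=> a Ha; apply: D; apply: BU; exact: near_pt.
exists (a *: (s *: delta_mx 0 i) + (b *: (s *: delta_mx 0 j) + x)); first exact: near_pt.
rewrite -mulrA -E2 mulrBr [s *: delta_mx 0 i + (b *: _ + x)]addrC -E1.
by rewrite [s *: delta_mx 0 i + x]addrC [s *: delta_mx 0 j + (x + _)]addrA; ring.
Qed.

(** The second difference is symmetric in [i] and [j] and equals [s^2] times either mixed partial at
    some point near [x]; continuity concludes. *)
Lemma clairaut f U x i j : open U -> U x -> smooth_on U f ->
  partials [:: i; j] f x = partials [:: j; i] f x.
Proof.
have third (a : R) : 0 < a -> 2 * (a / 3) < a by lra.
move=> oU Ux sf; apply/eqP; rewrite -subr_eq0; apply/negPn/negP => ne.
pose e := `|partials [:: i; j] f x - partials [:: j; i] f x| / 2.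
have e0 : 0 < e by rewrite divr_gt0// normr_gt0.
have N1 k l : \forall y \near x, `|partials [:: k; l] f x - partials [:: k; l] f y| < e.
  by have [/cvgrPdist_lt/(_ e e0)] := sf [:: k; l] x Ux.
have oUx : \forall y \near x, U y by exact: open_nbhs_nbhs.
have : \forall y \near x, U y /\ (`|partials [:: i; j] f x - partials [:: i; j] f y| < e /\
    `|partials [:: j; i] f x - partials [:: j; i] f y| < e).
  by apply: filterI => //; apply: filterI; exact: N1.
move=> /nbhs_ballP[r r0 Hr]; rewrite /= in r0.
have BU y : `|y - x| < r -> [/\ U y, `|partials [:: i; j] f x - partials [:: i; j] f y| < e &
    `|partials [:: j; i] f x - partials [:: j; i] f y| < e].
  move=> Hy; have By : ball x r y by rewrite -ball_normE /ball_ /= distrC.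
  by have [H1 [H2 H3]] := Hr y By; split.
have BU' y : `|y - x| < r -> U y by move=> /BU[].
have [s s0 sr] : exists2 s, 0 < s & 2 * s < r by exists (r / 3); [rewrite divr_gt0|exact: third].
have [y Hy E1] := second_difference i j oU sf BU' s0 sr.
have [z Hz E2] := second_difference j i oU sf BU' s0 sr.
have SW : f (s *: delta_mx 0 j + (s *: delta_mx 0 i + x)) - f (s *: delta_mx 0 i + x) -
   (f (s *: delta_mx 0 j + x) - f x) = f (s *: delta_mx 0 i + (s *: delta_mx 0 j + x)) -
   f (s *: delta_mx 0 j + x) - (f (s *: delta_mx 0 i + x) - f x).
  rewrite [s *: delta_mx 0 j + (s *: delta_mx 0 i + x)]addrCA.
  have sw (a b c d : R) : a - b - (c - d) = a - c - (b - d) by ring.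
  exact: sw.
have E := mulfI (lt0r_neq0 (mulr_gt0 s0 s0)) (etrans (esym E1) (etrans SW E2)).
have [_ H1 _] := BU y Hy; have [_ _ H2] := BU z Hz.
rewrite E in H1; rewrite distrC in H2.
have := le_lt_trans (ler_distD _ _ _) (ltrD H1 H2).
by rewrite /e -splitr ltxx.
Qed.

End critical_points.

(** * Homogeneity of degree 0: Euler's relations and extrema on the sphere *)

Section homogeneous.
Context {R : realType} {n : nat}.
Local Notation Rn := 'rV[R]_n.
Variable Phi : Rn -> R.
Hypotheses (sP : smooth_on [set xi | xi != 0] Phi) (hP : homogeneous0 Phi).
Local Notation V := [set xi : Rn | xi != 0].

Lemma open_neq0 : open V.
Proof.
have -> : V = ~` [set x : Rn | `|x - 0| <= 0].
  by apply/seteqP; split => x /=; rewrite subr0 normr_le0 => /negP.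
by apply: closed_openC; exact: closed_norm_sub.
Qed.

Lemma partialsE s (xi v : Rn) : xi != 0 ->
  is_derive xi v (partials s Phi) (\sum_i v 0 i * partials (i :: s) Phi xi).
Proof. by move=> x0; exact: (partials_is_derive open_neq0 sP). Qed.

Lemma partial_is_derive s (xi : Rn) j : xi != 0 ->
  is_derive xi (delta_mx 0 j) (partials s Phi) (partials (j :: s) Phi xi).
Proof. by move=> x0; apply: DeriveDef => //; have [_] := sP s x0; apply. Qed.

(** The sum is the derivative of [Phi] along its ray, on which [Phi] is constant:
    [h *: xi + xi = (h + 1) *: xi] with [h + 1 > 0] for small [h]. *)
Lemma euler (xi : Rn) : xi != 0 -> \sum_i xi 0 i * partials [:: i] Phi xi = 0.
Proof.
move=> x0; apply: is_derive_uniq (partialsE [::] xi x0) _.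
apply/is_derive_lineP; apply: (is_derive_near _ (is_derive_const _ _ (Phi xi))).
have : \forall h \near (0 : R), `|h| < 1 by exact: nbhs0_lt.
apply: filterS => h; rewrite ltr_norml => /andP[h1 _].
have -> : h *: xi + xi = (h + 1) *: xi by rewrite scalerDl scale1r.
by rewrite /= hP// -ltrBlDr sub0r.
Qed.

Lemma euler_derive (xi : Rn) j : xi != 0 ->
  \sum_i xi 0 i * partials [:: j; i] Phi xi = - partials [:: j] Phi xi.
Proof.
move=> x0; have D : is_derive xi (delta_mx 0 j) (fun x => \sum_i x 0 i * partials [:: i] Phi x)
   (\sum_i ((delta_mx 0 j : Rn) 0 i * partials [:: i] Phi xi + xi 0 i * partials [:: j; i] Phi xi)).
  apply: is_derive_sum_seq => i; apply: is_derive_mul; first exact: is_derive_coord.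
  exact: partial_is_derive.
have D0 : is_derive xi (delta_mx 0 j) (fun x => \sum_i x 0 i * partials [:: i] Phi x) 0.
  apply: (is_derive_open open_neq0 x0 _ (is_derive_const _ _ 0)) => y y0.
  by rewrite euler.
have := is_derive_uniq D D0; rewrite big_split/= => /eqP.
rewrite addrC addr_eq0 => /eqP ->; congr (- _).
rewrite (bigD1 j)//= mxE !eqxx mul1r big1 ?addr0// => i ij.
by rewrite mxE (negbTE ij) andbF mul0r.
Qed.

Lemma sphere_neq0 (q : Rn) : sphere n q -> q != 0.
Proof. by move=> q1; apply/eqP => q0; move: q1; rewrite q0 /sphere/= dotp0l => /eqP; rewrite eq_sym oner_eq0. Qed.

(** The radial projection is continuous at [q] and leaves [Phi] unchanged, so an extremum on the
    sphere is one in the ambient space, where Fermat's rule applies in every direction. *)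
Lemma near_sphere (P : R -> Prop) (q : Rn) : sphere n q ->
  (\forall x \near q, sphere n x -> P (Phi x)) -> \forall x \near q, P (Phi x).
Proof.
move=> q1 H; pose nm (x : Rn) := Num.sqrt (dotp x x).
have cd : {for q, continuous (fun x : Rn => dotp x x)}.
  have : Cn 0 setT (fun x : Rn => dotp x x).
    by apply: Cn_sum => i; apply: CnM; exact: Cn_coord.
  by case=> + _; apply.
have cn : {for q, continuous (fun x => (nm x)^-1 *: x)}.
  have cV : (nm x)^-1 @[x --> q] --> (nm q)^-1; last exact: (cvgZ cV cvg_id).
  apply: (@cvgV _ _ _ (nbhs_filter q) nm).
    by rewrite /nm (q1 : dotp q q = 1) sqrtr1 oner_neq0.
  by apply: (continuous_comp cd); exact: sqrt_continuous.
have E : (nm q)^-1 *: q = q by rewrite /nm (q1 : dotp q q = 1) sqrtr1 invr1 scale1r.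
have H1 : \forall x \near q, sphere n ((nm x)^-1 *: x) -> P (Phi ((nm x)^-1 *: x)).
  have K : nbhs ((nm q)^-1 *: q) [set x | sphere n x -> P (Phi x)] by rewrite E.
  exact: cn K.
have H2 : \forall x \near q, x != 0 by apply: open_nbhs_nbhs; split; [exact: open_neq0|exact: sphere_neq0].
apply: filterS2 H1 H2 => x H1 x0.
have n0 : 0 < nm x.
  rewrite sqrtr_gt0 lt_neqAle dotp_ge0 andbT eq_sym; apply/eqP => d0.
  move/eqP: x0; apply; apply/rowP => i; rewrite mxE; apply/eqP; rewrite -sqrf_eq0.
  by rewrite eq_le sqr_ge0 andbT -d0 dotp_coord_le.
rewrite -[Phi x](hP (lambda := (nm x)^-1)) ?invr_gt0//; apply: H1.
rewrite /sphere/= dotpZl dotpZr mulrA -expr2 exprVn sqr_sqrtr ?dotp_ge0// mulVf//.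
by rewrite gt_eqF// -sqrtr_gt0.
Qed.

Lemma extremum_grad0 (q : Rn) j : sphere_local_min Phi q \/ sphere_local_max Phi q ->
  partials [:: j] Phi q = 0.
Proof.
move=> H; have q1 : sphere n q by case: H => -[].
have D := partial_is_derive [::] j (sphere_neq0 q1).
case: H => -[_ H].
  by apply: fermat_min D; exact: (@near_sphere (fun y => Phi q <= y)).
by apply: fermat_max D; exact: (@near_sphere (fun y => y <= Phi q)).
Qed.

End homogeneous.

(** * From the tangential Hessian to the full one *)

Section nondegenerate_point.
Context {R : realType}.

Lemma cvg_det (m : nat) (F : set_system R) (FF : Filter F) (M : R -> 'M[R]_m) (L : 'M[R]_m) :
  (forall i j, M s i j @[s --> F] --> L i j) -> \det (M s) @[s --> F] --> \det L.
Proof.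
move=> H; rewrite /determinant; apply: cvg_big => [|sg _]; first exact: add_continuous.
apply: cvgM; first exact: cvg_cst.
by apply: cvg_big => [|i _]; [exact: mul_continuous|exact: H].
Qed.

Lemma is_derive_cvg (V : normedModType R) (f : V -> R) x v (d : R) :
  is_derive x v f d -> h^-1 * (f (h *: v + x) - f x) @[h --> 0^'] --> d.
Proof. by case=> H <-; exact: H. Qed.

(** By polarisation a symmetric matrix whose quadratic form vanishes is 0, which is not invertible
    in positive dimension. *)
Lemma quadratic_form_neq0 (n : nat) (A : 'M[R]_n) : (0 < n)%N -> A^T = A -> A \in unitmx ->
  exists y : 'rV[R]_n, (y *m A *m y^T) 0 0 != 0.
Proof.
move=> n0 At Au; apply/not_existsP => H.
pose B (y z : 'rV[R]_n) := (y *m A *m z^T) 0 0.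
have BE i j : B (delta_mx 0 i) (delta_mx 0 j) = A i j.
  by rewrite /B -rowE trmx_delta -colE !mxE.
have BD y z : B (y + z) (y + z) = B y y + B y z + B z y + B z z.
  by rewrite /B linearD/= !mulmxDl !mulmxDr !mxE; ring.
have B0 y : B y y = 0 by apply/eqP; have /negP := H y; rewrite negbK.
have A0 : A = 0.
  apply/matrixP => i j; rewrite mxE -BE.
  have := BD (delta_mx 0 i) (delta_mx 0 j); rewrite !B0 !BE.
  have -> : A j i = A i j by rewrite -[in RHS]At mxE.
  lra.
move: Au; rewrite A0 unitmxE; case: n n0 {A At H B BE BD B0 A0} => // m _.
by rewrite det0 unitr0.
Qed.

(** Right multiplication by the unipotent [L] clears the lower left block, [A] being symmetric, and
    leaves the diagonal blocks [- y A y^T] and [A]. *)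
Lemma bordered_det_neq0 (n : nat) (A : 'M[R]_n) (y : 'rV[R]_n) : A^T = A -> A \in unitmx ->
  (y *m A *m y^T) 0 0 != 0 ->
  \det (block_mx (0 : 'M[R]_1) (- (y *m A)) (- (y *m A)^T) A) != 0.
Proof.
move=> At Au y0; set M := block_mx _ _ _ _.
pose L : 'M[R]_(1 + n) := block_mx 1%:M 0 y^T 1%:M.
have E : M *m L = block_mx (- (y *m A *m y^T)) (- (y *m A)) 0 A.
  rewrite mulmx_block !mulmx1 !mulmx0 !add0r mulNmx; congr block_mx.
  by rewrite trmx_mul At addNr.
have : \det (M *m L) != 0.
  rewrite E det_ublock mulf_neq0//; last by rewrite -unitfE -unitmxE.
  by rewrite det_mx11 mxE oppr_eq0.
by rewrite det_mulmx mulf_eq0 negb_or => /andP[].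
Qed.

Section homogeneous_function.
Variables (n : nat) (Phi : 'rV[R]_n.+1 -> R).
Local Notation Rn := 'rV[R]_n.+1.
Hypotheses (sP : smooth_on [set xi | xi != 0] Phi) (hP : homogeneous0 Phi).

Definition hessian (xi : Rn) : 'M[R]_n.+1 := \matrix_(i, j) partials [:: i; j] Phi xi.
Definition gradient (xi : Rn) : Rn := \row_j partials [:: j] Phi xi.

Lemma hessian_sym xi : xi != 0 -> (hessian xi)^T = hessian xi.
Proof. by move=> x0; apply/matrixP => i j; rewrite !mxE; exact: clairaut (@open_neq0 R n.+1) x0 sP. Qed.

Lemma hessian_radial xi : xi != 0 -> hessian xi *m xi^T = - (gradient xi)^T.
Proof.
move=> x0; apply/matrixP => i j; rewrite !mxE -(euler_derive sP hP)//.
by apply: eq_bigr => k _; rewrite !mxE (ord1 j) mulrC.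
Qed.

Lemma gradient_radial xi : xi != 0 -> gradient xi *m xi^T = 0.
Proof.
move=> x0; apply/matrixP => i j; rewrite !mxE -[RHS](euler sP hP x0).
by apply: eq_bigr => k _; rewrite !mxE (ord1 j) mulrC.
Qed.

(** With the radial direction as first row, Euler's relations make the corner vanish and turn the
    border into a multiple of the gradient. *)
Lemma congruent_hessian (J : 'M[R]_(n, n.+1)) (xi : Rn) (s : R) : xi != 0 ->
  let P : 'M[R]_(1 + n, n.+1) := col_mx (s *: xi) J in
  let c := s *: (gradient xi *m J^T) in
  P *m hessian xi *m P^T = block_mx 0 (- c) (- c^T) (J *m hessian xi *m J^T).
Proof.
move=> x0 P c; have Hs := hessian_sym x0; have Hr := hessian_radial x0.
have Hl : xi *m hessian xi = - gradient xi.
  by apply: trmx_inj; rewrite trmx_mul Hs Hr linearN.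
rewrite /P tr_col_mx mul_col_mx mul_col_row -!scalemxAl Hl; congr block_mx.
- by rewrite linearZ/= -scalemxAr mulNmx gradient_radial// oppr0 !scaler0.
- by rewrite /c mulNmx scalerN.
- by rewrite /c linearZ/= -scalemxAr -mulmxA Hr linearZ/= trmx_mul trmxK mulmxN scalerN.
Qed.

Lemma nondegenerate_near (J : 'M[R]_(n, n.+1)) (q : Rn) : (0 < n)%N -> q != 0 -> gradient q = 0 ->
  J *m hessian q *m J^T \in unitmx -> exists2 xi, xi != 0 & hessian xi \in unitmx.
Proof.
move=> n0 q0 g0 Au; set A := J *m hessian q *m J^T in Au.
have At : A^T = A by rewrite /A !trmx_mul trmxK hessian_sym// mulmxA.
have [y yA] := quadratic_form_neq0 n0 At Au.
pose w := y *m J; pose xi (s : R) := s *: w + q.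
(* The gradient vanishes at [q], so this is a difference quotient and converges to a derivative
   along [w], namely [y *m A]. *)
pose c s := s^-1 *: (gradient (xi s) *m J^T).
pose M s := block_mx (0 : 'M[R]_1) (- c s) (- (c s)^T) (J *m hessian (xi s) *m J^T).
have xi0 : xi 0 = q by rewrite /xi scale0r add0r.
have cxi : xi s @[s --> (0 : R)^'] --> q.
  rewrite -[X in _ --> X]xi0; apply/continuous_withinNx.
  by apply: cvgD; [apply: cvgZ; [exact: cvg_id|exact: cvg_cst]|exact: cvg_cst].
have cc i : c s 0 i @[s --> (0 : R)^'] --> (y *m A) 0 i.
  pose G (x : Rn) := \sum_k J i k * partials [:: k] Phi x.
  have Gq : G q = 0.
    apply: big1 => k _; have := congr1 (fun v : Rn => v 0 k) g0.
    by rewrite !mxE => ->; rewrite mulr0.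
  have dG : is_derive q w G ((y *m A) 0 i).
    have := @is_derive_sum_seq R Rn 'I_n.+1 (index_enum _) (fun k x => J i k * partials [:: k] Phi x) q w
      (fun k => J i k * \sum_l w 0 l * partials [:: l; k] Phi q)
      (fun k => is_derive_cmul (J i k) (partialsE sP [:: k] w q0)).
    rewrite /G [X in is_derive _ _ _ X -> _](_ : _ = (y *m A) 0 i)//.
    rewrite /A !mulmxA -/w mxE; apply: eq_bigr => k _; rewrite !mxE mulrC; congr (_ * _).
    by apply: eq_bigr => l _; rewrite !mxE.
  have := is_derive_cvg dG; rewrite Gq.
  rewrite [X in X @ _ --> _ -> _](_ : _ = (fun s => c s 0 i))//.
  apply/funext => s; rewrite /c mxE subr0 mxE; congr (_ * _).
  by apply: eq_bigr => k _; rewrite !mxE mulrC.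
have cH i j : (J *m hessian (xi s) *m J^T) i j @[s --> (0 : R)^'] --> A i j.
  under eq_fun do rewrite mxE; rewrite mxE.
  apply: cvg_big => [|k _]; first exact: add_continuous.
  apply: cvgM; last exact: cvg_cst.
  under eq_fun do rewrite mxE; rewrite mxE.
  apply: cvg_big => [|l _]; first exact: add_continuous.
  apply: cvgM; first exact: cvg_cst.
  under eq_fun do rewrite mxE; rewrite mxE.
  by have [cp _] := sP [:: l; k] q0; exact: cvg_comp cxi cp.
have cM i j : M s i j @[s --> (0 : R)^'] --> (block_mx (0 : 'M[R]_1) (- (y *m A)) (- (y *m A)^T) A) i j.
  rewrite /M -(splitK i) -(splitK j).
  case: (fintype.split i) => a; case: (fintype.split j) => b; rewrite /unsplit.
  - rewrite [X in X @ _ --> _](_ : _ = (fun=> 0)); last first.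
      by apply/funext => s; rewrite block_mxEul mxE.
    by rewrite block_mxEul mxE; exact: cvg_cst.
  - rewrite [X in X @ _ --> _](_ : _ = (fun s => - c s 0 b)); last first.
      by apply/funext => s; rewrite block_mxEur (ord1 a) mxE.
    by rewrite block_mxEur (ord1 a) mxE; apply: cvgN; exact: cc.
  - rewrite [X in X @ _ --> _](_ : _ = (fun s => - c s 0 a)); last first.
      by apply/funext => s; rewrite block_mxEdl (ord1 b) mxE; congr (- _); rewrite mxE.
    rewrite block_mxEdl (ord1 b) mxE [X in - X]mxE; apply: cvgN; exact: cc.
  - rewrite [X in X @ _ --> _](_ : _ = (fun s => (J *m hessian (xi s) *m J^T) a b)); last first.
      by apply/funext => s; rewrite block_mxEdr.
    by rewrite block_mxEdr; exact: cH.
have cdet := @cvg_det _ _ (dnbhs_filter _) M _ cM.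
have N1 : \forall s \near (0 : R)^', \det (M s) != 0.
  exact: cvgr_neq0 cdet (bordered_det_neq0 At Au yA).
have N2 : \forall s \near (0 : R)^', xi s != 0.
  have K : nbhs q [set x : Rn | x != 0] by apply: open_nbhs_nbhs; split => //; exact: open_neq0.
  exact: cxi K.
have N3 : \forall s \near (0 : R)^', s != 0 by exact: nbhs_dnbhs_neq.
have [s [[H1 H2] H3]] := filter_ex (filterI (filterI N1 N2) N3).
exists (xi s) => //.
(* Scaling the radial row by [s^-1] offsets the vanishing of the gradient at [q], so that the border
   survives in the limit. *)
have := congruent_hessian J s^-1 H2; rewrite /= -/(c s) => E.
move: H1; rewrite /M -E unitmxE unitfE; apply: contra => /eqP h0.
by rewrite !det_mulmx h0 mulr0 mul0r.
Qed.

(** The second derivative of the composition has one more term, the gradient of [Phi] against the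
    second derivatives of [phi]; it vanishes because [gradient q = 0]. *)
Lemma chart_hessian U V psi phi (q : Rn) : @sphere_chart R n.+1 U V psi phi -> U q -> sphere n.+1 q ->
  gradient q = 0 ->
  let J : 'M[R]_(n, n.+1) := \matrix_(i, k) partials [:: i] (fun y => phi y 0 k) (psi q) in
  (\matrix_(i, j) partials [:: i; j] (Phi \o phi) (psi q) : 'M[R]_n) = J *m hessian q *m J^T.
Proof.
move=> [oU oV psiV phiU psiK phiK spsi sphi] Uq q1 g0 J.
have q0 := sphere_neq0 q1.
have Vq : V (psi q) by apply: psiV.
have pq : phi (psi q) = q by exact: psiK.
have phi0 y : V y -> phi y != 0 by move=> /phiU[_ /sphere_neq0].
have dphi y k i (s : seq 'I_n) : V y ->
    is_derive y (delta_mx 0 i) (partials s (fun y => phi y 0 k)) (partials (i :: s) (fun y => phi y 0 k) y).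
  by move=> Vy; apply: DeriveDef => //; have [_] := sphi k s y Vy; apply.
have chain (s : seq 'I_n.+1) y i : V y ->
    is_derive y (delta_mx 0 i) (partials s Phi \o phi)
      (\sum_k partials [:: i] (fun y => phi y 0 k) y * partials (k :: s) Phi (phi y)).
  move=> Vy; apply: (C1_chain (open_neq0 (n := n.+1)) (phi0 y Vy)).
  - by move=> z k z0; have [_] := sP s z0; apply.
  - by move=> k; have [] := sP (k :: s) (phi0 y Vy).
  - by move=> k; exact: (dphi y k i [::]).
apply/matrixP => i j; rewrite mxE.
have E1 y : V y -> \sum_k partials [:: j] (fun y => phi y 0 k) y * partials [:: k] Phi (phi y) =
    partials [:: j] (Phi \o phi) y.
  by move=> Vy; have [_ <-] := chain [::] y j Vy.
have D := @is_derive_sum_seq R 'rV[R]_n 'I_n.+1 (index_enum _)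
  (fun k y => partials [:: j] (fun y => phi y 0 k) y * partials [:: k] Phi (phi y)) (psi q) (delta_mx 0 i) _
  (fun k => is_derive_mul (dphi _ k i [:: j] Vq) (chain [:: k] _ i Vq)).
have [_ E2] := is_derive_open oV Vq E1 D.
rewrite [LHS]E2 mxE; apply: eq_bigr => k _; rewrite /= pq.
have gk : partials [:: k] Phi q = 0 by have := congr1 (fun v : Rn => v 0 k) g0; rewrite !mxE.
rewrite /= in gk; rewrite gk mulr0 add0r mulrC !mxE; congr (_ * _).
by apply: eq_bigr => l _; rewrite !mxE.
Qed.

Lemma exists_nondegenerate_point : (0 < n)%N -> has_nondegenerate_local_extremum Phi ->
  exists2 xi, xi != 0 & hessian xi \in unitmx.
Proof.
move=> n0 [q [[q1 [U [V [psi [phi [ch Uq _ Hu]]]]]] He]].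
have g0 : gradient q = 0.
  by apply/rowP => j; rewrite !mxE; exact: extremum_grad0.
by move: Hu; rewrite (chart_hessian ch Uq q1 g0); exact: (nondegenerate_near n0 (sphere_neq0 q1) g0).
Qed.

End homogeneous_function.

End nondegenerate_point.

(** * The lower bound *)

Section moments.
Context {R : realType} {n : nat}.
Local Notation Rn := 'rV[R]_n.
Local Notation mu := (lebesgue_rV R n).
Implicit Types (f : Rn -> R) (K p q r : R).
Local Notation normc := (@ComplexField.Normc.normc R).

Lemma powR_interp (y K q r : R) : 0 <= y -> y <= K -> 0 <= q -> 0 < r ->
  y `^ (q + r) <= K `^ q * y `^ r.
Proof.
move=> y0 yK q0 r0; rewrite powRD; last by rewrite gt_eqF ?ltr_wpDl.
by rewrite ler_wpM2r ?powR_ge0// ge0_ler_powR ?nnegrE// (le_trans y0).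
Qed.

Lemma L1_powR f K r : L1 mu f -> (forall x, 0 <= f x) -> (forall x, f x <= K) -> 1 <= r ->
  L1 mu (fun x => f x `^ r).
Proof.
move=> Lf f0 fK r1; apply: (L1_dom _ _ (L1Z (K `^ (r - 1)) Lf)).
  by apply: (measurableT_comp (measurable_powR r)); exact: L1_measurable Lf.
move=> x; rewrite ger0_norm ?powR_ge0// -{1}(subrK 1 r).
by rewrite (le_trans (powR_interp _ (fK x) _ _))// ?subr_ge0// powRr1.
Qed.

Lemma Rint_powR_interp f K q r : L1 mu f -> (forall x, 0 <= f x) -> (forall x, f x <= K) ->
  0 <= q -> 1 <= r -> \int[mu]_x f x `^ (q + r) <= K `^ q * \int[mu]_x f x `^ r.
Proof.
move=> Lf f0 fK q0 r1; have Lr := L1_powR Lf f0 fK r1.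
rewrite -(RintZ _ Lr); apply: le_trans (ler_norm _) _; apply: Rint_abs_le.
- by apply: (measurableT_comp (measurable_powR _)); exact: L1_measurable Lf.
- exact: L1Z.
- by move=> x; rewrite ger0_norm ?powR_ge0// powR_interp// (lt_le_trans ltr01).
Qed.

Lemma Lp_normE p (g : Rn -> R[i]) f : 0 < p -> (forall x, 0 <= f x) -> (forall x, normc (g x) = f x) ->
  L1 mu (fun x => f x `^ p) -> Lp_norm p g = ((\int[mu]_x f x `^ p) `^ p^-1)%:E.
Proof.
move=> p0 f0 gf Lf; rewrite /Lp_norm unlock.
under eq_integral do rewrite gf abse_EFin poweR_EFin ger0_norm//.
by rewrite -RintE// poweR_EFin.
Qed.

(** The p-th root of a ratio of p-th moments; [|2 - p| / (2 p)] is [|1/2 - 1/p|]. Positivity of [I1]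
    shows that the test function is not zero. *)
Lemma opnorm_ge p (T : (Rn -> R[i]) -> Rn -> R[i]) (g : Rn -> R[i]) (A k j e I1 I2 : R) : 1 < p ->
  0 < A -> 0 <= k -> schwartz g -> Lp_norm p g = (I1 `^ p^-1)%:E ->
  Lp_norm p (T g) = (k * I2 `^ p^-1)%:E -> 0 < I1 -> A * j `^ (e * `|2 - p| / 2) * I1 <= I2 ->
  ((k * A `^ p^-1 * j `^ (e * `|2^-1 - p^-1|))%:E <= Lp_opnorm p T)%E.
Proof.
move=> p1 A0 k0 sg gE TE I10 H; have p0 : 0 < p by rewrite (lt_trans ltr01).
have B0 : 0 <= A * j `^ (e * `|2 - p| / 2) by rewrite mulr_ge0 ?powR_ge0// ltW.
have I2p : 0 <= I2 by rewrite (le_trans _ H)// mulr_ge0// ltW.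
have -> : k * A `^ p^-1 * j `^ (e * `|2^-1 - p^-1|) = k * (A * j `^ (e * `|2 - p| / 2)) `^ p^-1.
  rewrite (powRM _ (ltW A0) (powR_ge0 _ _)) -powRrM mulrA; congr (_ * _ `^ _).
  rewrite -mulrA -mulrA; congr (_ * _).
  have -> : 2^-1 - p^-1 = - ((2 - p) / (2 * p)) by field; rewrite gt_eqF.
  by rewrite normrN normrM normfV [`|2 * p|]gtr0_norm ?mulr_gt0// invfM.
apply: (@le_trans _ _ (Lp_norm p (T g) / Lp_norm p g)%E).
  rewrite gE TE inver gt_eqF ?powR_gt0// -EFinM lee_fin -[leRHS]mulrA ler_wpM2l//.
  rewrite ler_pdivlMr ?powR_gt0// -(powRM _ B0 (ltW I10)).
  by rewrite ge0_ler_powR ?nnegrE ?invr_ge0 ?(ltW p0)// mulr_ge0// ltW.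
apply: ereal_sup_ubound; exists g; split => // g0.
have : Lp_norm p g = 0%E.
  rewrite g0 /Lp_norm (_ : (fun x => _) = cst 0%E); first by rewrite Lnorm0// eqe gt_eqF.
  by apply/funext => x /=; rewrite expr0n/= addr0 sqrtr0.
by rewrite gE => -[/eqP]; rewrite gt_eqF// powR_gt0.
Qed.

End moments.

Section ratio.
Context {R : realType}.

(** [I] stands for the p-th moment of the packet, [E] for its energy, [j] for the Japanese bracket.
    For [p <= 2] the moment grows by spreading from [s = 0] to [t], for [p > 2] by focusing from
    [s = - t] to 0. *)
Lemma ratio_of_bounds (E c d p : R) (I j : R -> R) : 0 < E -> 0 < c ->
  (forall s, 0 < I s) -> (forall s, 0 < j s) -> (forall s, j (- s) = j s) ->
  (p <= 2 -> forall t, E <= c `^ (2 - p) / j t `^ (d * (2 - p) / 2) * I t) ->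
  (2 < p -> forall t, I t <= c `^ (p - 2) / j t `^ (d * (p - 2) / 2) * E) ->
  exists2 A, 0 < A & forall t, exists s, A * j t `^ (d * `|2 - p| / 2) * I s <= I (s + t).
Proof.
move=> E0 c0 I0 j0 jN H1 H2; have [p2|p2] := leP p 2.
  have q0 : 0 <= 2 - p by rewrite subr_ge0.
  have c1 : 0 < c `^ (2 - p) by rewrite powR_gt0.
  exists (E / (c `^ (2 - p) * I 0)); first by rewrite divr_gt0// mulr_gt0.
  move=> t; exists 0; rewrite add0r (ger0_norm q0); have := H1 p2 t.
  have := powR_gt0 (d * (2 - p) / 2) (j0 t).
  move: (I0 0) c1; move: (c `^ _) (I 0) (I t) (j t `^ _) => c' I1 I2 j' I10 c1 j'0 H.
  have -> : E / (c' * I1) * j' * I1 = E / (c' / j') by field; rewrite !gt_eqF.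
  by rewrite ler_pdivrMr ?divr_gt0// mulrC.
have q0 : 0 <= p - 2 by rewrite subr_ge0 ltW.
have c1 : 0 < c `^ (p - 2) by rewrite powR_gt0.
exists (I 0 / (c `^ (p - 2) * E)); first by rewrite divr_gt0// mulr_gt0.
move=> t; exists (- t); rewrite addNr distrC (ger0_norm q0); have := H2 p2 (- t); rewrite jN.
have := powR_gt0 (d * (p - 2) / 2) (j0 t).
move: (I0 0) c1; move: (c `^ _) (I 0) (I (- t)) (j t `^ _) => c' I1 I2 j' I10 c1 j'0 H.
apply: (@le_trans _ _ (I1 / (c' * E) * j' * (c' / j' * E))).
  by rewrite ler_wpM2l// mulr_ge0 ?ltW// divr_gt0// mulr_gt0.
rewrite [leLHS](_ : _ = I1)//; field; rewrite !gt_eqF//.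
Qed.

End ratio.

Section lower_bound.
Context {R : realType} {n : nat}.
Local Notation Rn := 'rV[R]_n.
Local Notation mu := (lebesgue_rV R n).
Local Notation normc := (@ComplexField.Normc.normc R).
Variables (Phi : Rn -> R) (sP : smooth_on [set xi | xi != 0] Phi).

(** The value at the origin is arbitrary, but a single point is measurable; off it, preimages of
    open half-lines are open. *)
Lemma measurable_off0 (f : Rn -> R) : (forall x, x != 0 -> {for x, continuous f}) ->
  measurable_fun setT f.
Proof.
move=> cf; have -> : [set: Rn] = [set x | x != 0] `|` ~` [set x | x != 0] by rewrite setUv.
have mV : measurable ([set x | x != 0] : set Rn) by apply: measurable_open_rV; exact: open_neq0.
apply/measurable_funU => //; first exact: measurableC.
split; last first.
  apply: (eq_measurable_fun (cst (f 0))); last exact: measurable_cst.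
  by move=> x; rewrite inE /= => /negP; rewrite negbK => /eqP ->.
apply: (measurability _ (RGenOInfty.measurableE R)) => _ [_ [c ->] <-].
apply: measurable_open_rV; rewrite openE => x [/= x0 fx].
have oc : open (`]c, +oo[%classic : set R) by exact: interval_open.
apply: filterI; first by apply: open_nbhs_nbhs; split => //; exact: open_neq0.
by apply: (cf x x0); exact: open_nbhs_nbhs.
Qed.

Variables (xi0 : Rn) (r C : R).
Hypotheses (r0 : 0 < r) (C0 : 0 < C) (BV : forall x, `|x - xi0| <= r -> x != 0).
Local Notation a := (pre Phi xi0 r).
Local Notation b := (pim Phi xi0 r).
Hypothesis disp : forall s x, (Gre (a s) (b s) x ^+ 2 + Gim (a s) (b s) x ^+ 2) * japanese s ^+ n <= C.
Variable kappa : R.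
Hypothesis Hk : forall a th, cc a -> \int[mu]_x W a th x = kappa * cos th * a (0 : Rn).

Let N (s : R) x := Num.sqrt (Gre (a s) (b s) x ^+ 2 + Gim (a s) (b s) x ^+ 2).
(** Equal to 1 for the actual inversion constant; only its being non-zero is established. *)
Let k' := kappa / (2 * pi) ^+ n.
Let ca s : cc (a s) := cc_pre open_neq0 sP s r0 BV.
Let cb s : cc (b s) := cc_pim open_neq0 sP s r0 BV.

Let Gsq_ge0 s x : 0 <= Gre (a s) (b s) x ^+ 2 + Gim (a s) (b s) x ^+ 2.
Proof. by rewrite addr_ge0// sqr_ge0. Qed.

Let L1_cos0 c x : cc c -> L1 mu (fun xi => c xi * cos (dotp x xi)).
Proof. by move=> Hc; have := L1_cos x 0 Hc; under eq_fun do rewrite addr0. Qed.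

Let L1_sin0 c x : cc c -> L1 mu (fun xi => c xi * sin (dotp x xi)).
Proof. by move=> Hc; have := L1_cos x (- (pi / 2)) Hc; under eq_fun do rewrite cosBpihalf. Qed.

Let L1B (f g : Rn -> R) : L1 mu f -> L1 mu g -> L1 mu (fun x => f x - g x).
Proof. by move=> Lf /(L1Z (-1)) Lg; have := L1D Lf Lg; under eq_fun do rewrite mulN1r. Qed.

Lemma multiplier_Gc t s x : multiplier Phi t (Gc (a s) (b s)) x =
  Complex (k' * Gre (a (s + t)) (b (s + t)) x) (k' * Gim (a (s + t)) (b (s + t)) x).
Proof.
have Lab := cc_L1 (bump_cc xi0 r0).
rewrite /multiplier /Cintegral; congr Complex.
  rewrite (Gre_int (ca _) (cb _)) -RintZ.
    apply: eq_Rintegral => xi _; rewrite (fourier_Gc (ca s) (cb s) Hk) /expi mulCE /=.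
    rewrite [dotp xi x]dotpC /pre /pim -/k' [(s + t) * _]mulrDl !cosD !sinD; ring.
  by apply: L1B; [exact: L1_cos0|exact: L1_sin0].
rewrite (Gim_int (ca _) (cb _)) -RintZ.
  apply: eq_Rintegral => xi _; rewrite (fourier_Gc (ca s) (cb s) Hk) /expi mulCE /=.
  rewrite [dotp xi x]dotpC /pre /pim -/k' [(s + t) * _]mulrDl !cosD !sinD; ring.
by apply: L1D; [exact: L1_sin0|exact: L1_cos0].
Qed.

Lemma multiplier_normc t s x : normc (multiplier Phi t (Gc (a s) (b s)) x) = `|k'| * N (s + t) x.
Proof.
rewrite multiplier_Gc /=.
have -> : (k' * Gre (a (s + t)) (b (s + t)) x) ^+ 2 + (k' * Gim (a (s + t)) (b (s + t)) x) ^+ 2 =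
  k' ^+ 2 * (Gre (a (s + t)) (b (s + t)) x ^+ 2 + Gim (a (s + t)) (b (s + t)) x ^+ 2) by ring.
by rewrite sqrtrM ?sqr_ge0// sqrtr_sqr.
Qed.

Let N_ge0 s x : 0 <= N s x. Proof. exact: sqrtr_ge0. Qed.

Let LN s : L1 mu (N s).
Proof.
have L := L1D (L1_abs (Wclass_L1 (Gre_Wclass (ca s) (cb s)))) (L1_abs (Wclass_L1 (Gim_Wclass (ca s) (cb s)))).
have [Lsq _] := Gc_plancherel (ca s) (cb s) Hk.
apply: (L1_dom _ _ L).
  have ms : measurable_fun setT (@Num.sqrt R).
    by apply: continuous_measurable_fun; exact: sqrt_continuous.
  by apply: (measurableT_comp ms); exact: L1_measurable Lsq.
move=> x; rewrite ger0_norm// /N -[leRHS]ger0_norm ?addr_ge0// -sqrtr_sqr ler_wsqrtr//.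
rewrite -[X in X + _ <= _]real_normK ?num_real// -[X in _ + X <= _]real_normK ?num_real//.
by rewrite sqrrD -addrA lerD2l lerDr mulrn_wge0// mulr_ge0.
Qed.

Let K s : R := Num.sqrt C * japanese s `^ (- (n%:R / 2)).

Let j_gt0 (s : R) : 0 < japanese s.
Proof. by rewrite sqrtr_gt0 ltr_pwDl// sqr_ge0. Qed.

Let NK s x : N s x <= K s.
Proof.
rewrite /K powRN ler_pdivlMr ?powR_gt0//.
have -> : japanese s `^ (n%:R / 2) = Num.sqrt (japanese s ^+ n).
  by rewrite powRrM powR_mulrn ?ltW// powR12_sqrt// exprn_ge0// ltW.
by rewrite -sqrtrM// ler_wsqrtr.
Qed.

Let KP s q : 0 <= q -> K s `^ q = Num.sqrt C `^ q * japanese s `^ (- (n%:R * q / 2)).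
Proof.
move=> q0; rewrite /K powRM ?sqrtr_ge0 ?powR_ge0//; congr (_ * _).
by rewrite -powRrM; congr (_ `^ _); ring.
Qed.

Let E := kappa * \int[mu]_xi bump xi0 r xi ^+ 2.

(** Plancherel, where [cos^2 + sin^2 = 1] removes the dependence on [s]. *)
Let energy s : \int[mu]_x N s x `^ 2 = E.
Proof.
rewrite /E; have [_ EE] := Gc_plancherel (ca s) (cb s) Hk.
rewrite (_ : \int[mu]_xi bump xi0 r xi ^+ 2 = \int[mu]_xi (a s xi ^+ 2 + b s xi ^+ 2)).
  rewrite -EE; apply: eq_Rintegral => x _.
  by rewrite -[2]/(2%:R) powR_mulrn// sqr_sqrtr.
apply: eq_Rintegral => xi _; rewrite /pre /pim !exprMn -mulrDr.
by rewrite cos2Dsin2 mulr1.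
Qed.

Let Npow s m x : N s x `^ (2 * m)%:R = (Gre (a s) (b s) x ^+ 2 + Gim (a s) (b s) x ^+ 2) ^+ m.
Proof. by rewrite powR_mulrn// exprM sqr_sqrtr. Qed.

(** For an even exponent the integrand is a polynomial in the real and imaginary parts, hence
    continuous, and one positive value suffices. *)
Let Npow_gt0 s m y : (0 < m)%N -> 0 < N s y -> 0 < \int[mu]_x N s x `^ (2 * m)%:R.
Proof.
move=> m0 Ny; have L : L1 mu (fun x => N s x `^ (2 * m)%:R).
  by apply: L1_powR (NK s) _ => //; rewrite ler1n muln_gt0.
rewrite -lte_fin (RintE L); apply: (@Rint_gt0 _ _ _ y) => [||| ].
- exact: L1_measurable L.
- by move=> x; exact: powR_ge0.
- apply: (for_continuous_near (f := fun x => (Gre (a s) (b s) x ^+ 2 + Gim (a s) (b s) x ^+ 2) ^+ m)).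
    by apply: (@nearW _ _ _ (nbhs_filter y)) => z; rewrite Npow.
  have cre := Wclass_continuous (Gre_Wclass (ca s) (cb s)) (x := y).
  have cim := Wclass_continuous (Gim_Wclass (ca s) (cb s)) (x := y).
  have cX k : continuous (fun z : R => z ^+ k) by exact: exprn_continuous.
  have cS : Gre (a s) (b s) x ^+ 2 + Gim (a s) (b s) x ^+ 2 @[x --> y] -->
      Gre (a s) (b s) y ^+ 2 + Gim (a s) (b s) y ^+ 2.
    apply: (@cvgD _ _ _ _ (nbhs_filter y)).
      exact: (cvg_comp _ (fun z => z ^+ 2) cre (cX 2%N _)).
    exact: (cvg_comp _ (fun z => z ^+ 2) cim (cX 2%N _)).
  exact: (cvg_comp _ (fun z => z ^+ m) cS (cX m _)).
- exact: powR_gt0.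
Qed.

(** At time 0 and [x = 0] the real part of the packet is the integral of the bump. Positivity of [E]
    also shows that [kappa] is not zero. *)
Let E_gt0 : 0 < E.
Proof.
have G0 : 0 < Gre (a 0) (b 0) 0.
  rewrite (Gre_int (ca 0) (cb 0)).
  have -> : \int[mu]_xi (a 0 xi * cos (dotp 0 xi) - b 0 xi * sin (dotp 0 xi)) = \int[mu]_xi bump xi0 r xi.
    by apply: eq_Rintegral => xi _; rewrite dotp0l /pre cos0 sin0 mul0r cos0; ring.
  have Hb := bump_cc xi0 r0; rewrite -lte_fin (RintE (cc_L1 Hb)).
  apply: (@Rint_gt0 _ _ _ xi0); [exact: cc_measurable Hb| |exact: cc_continuous|exact: bump_center].
  by move=> x; exact: bump_ge0.
rewrite -(energy 0) -[2]/((2 * 1)%:R); apply: (@Npow_gt0 0 1 0) => //.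
by rewrite sqrtr_gt0 ltr_pwDl ?sqr_ge0// exprn_gt0.
Qed.

(** The energy yields a point where [N s] is positive, hence a positive even moment of order
    [2 m > p], and interpolation bounds that moment by a multiple of the p-th one. *)
Let Ip_gt0 s p : 1 < p -> 0 < \int[mu]_x N s x `^ p.
Proof.
move=> p1; have [y Ny] : exists y, 0 < N s y.
  apply/not_existsP => H; have := E_gt0; rewrite -(energy s).
  rewrite (_ : \int[mu]_x N s x `^ 2 = \int[mu]_x (cst 0 x)).
    by rewrite Rintegral_cst//= mul0r ltxx.
  apply: eq_Rintegral => x _; have /negP := H x; rewrite -leNgt => N0.
  have -> : N s x = 0 by apply/eqP; rewrite eq_le N0 N_ge0.
  by rewrite powR0.
have p0 : 0 < p by rewrite (lt_trans ltr01).
pose m := Num.bound p; have pm : p < m%:R by exact: archi_boundP (ltW p0).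
have m0 : (0 < m)%N by rewrite -(ltr_nat R) (lt_trans p0).
have q0 : 0 <= (2 * m)%:R - p.
  rewrite subr_ge0 (le_trans (ltW pm))// ler_nat; lia.
have := Rint_powR_interp (LN s) (N_ge0 s) (NK s) q0 (ltW p1).
rewrite subrK => /(lt_le_trans (Npow_gt0 m0 Ny)) H.
rewrite lt_neqAle Rintegral_ge0 ?andbT => [|x _]; last exact: powR_ge0.
by apply/eqP => I0; move: H; rewrite -I0 mulr0 ltxx.
Qed.

Let jN (t : R) : japanese (- t) = japanese t. Proof. by rewrite /japanese normrN. Qed.

Let E_le t q p : 0 <= q -> 1 <= p -> q + p = 2 ->
  E <= Num.sqrt C `^ q / japanese t `^ (n%:R * q / 2) * \int[mu]_x N t x `^ p.
Proof.
move=> q0 p1 e; have Ee : E = \int[mu]_x N t x `^ (q + p) by rewrite e energy.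
rewrite -powRN -(KP t q0) [leLHS]Ee.
exact: (Rint_powR_interp (LN t) (N_ge0 t) (NK t)).
Qed.

Let Ip_le t q p : 0 <= q -> q + 2 = p ->
  \int[mu]_x N t x `^ p <= Num.sqrt C `^ q / japanese t `^ (n%:R * q / 2) * E.
Proof.
move=> q0 <-; rewrite -powRN -(KP t q0).
have := Rint_powR_interp (LN t) (N_ge0 t) (NK t) q0 (ler1n R 2).
by move/le_trans; apply; rewrite energy.
Qed.

Let Ip_ratio p : 1 < p -> exists2 A, 0 < A & forall t, exists s,
  A * japanese t `^ (n%:R * `|2 - p| / 2) * \int[mu]_x N s x `^ p <= \int[mu]_x N (s + t) x `^ p.
Proof.
move=> p1; have c0 : 0 < Num.sqrt C by rewrite sqrtr_gt0.
apply: (ratio_of_bounds E_gt0 c0 (fun s => Ip_gt0 s p1) j_gt0 jN) => [p2 t|p2 t].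
  by apply: E_le; rewrite ?subr_ge0 ?subrK// ltW.
by apply: Ip_le; rewrite ?subrK// subr_ge0 ltW.
Qed.

Lemma opnorm_lower p : 1 < p -> exists2 c : R, 0 < c & forall t : R,
  ((c * japanese t `^ (n%:R * `|2^-1 - p^-1|))%:E <= Lp_opnorm p (multiplier Phi t))%E.
Proof.
move=> p1; have p0 : 0 < p by rewrite (lt_trans ltr01).
have [A A0 HA] := Ip_ratio p1.
have k0 : 0 < `|k'|.
  rewrite normr_gt0 mulf_neq0//.
    by apply/eqP => k0; move: E_gt0; rewrite /E k0 mul0r ltxx.
  by rewrite invr_neq0// expf_neq0// mulf_neq0// gt_eqF// pi_gt0.
exists (`|k'| * A `^ p^-1); first by rewrite mulr_gt0// powR_gt0.
move=> t; have [s Hs] := HA t.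
have Ls u := L1_powR (LN u) (N_ge0 u) (NK u) (ltW p1).
have fE : Lp_norm p (Gc (a s) (b s)) = ((\int[mu]_x N s x `^ p) `^ p^-1)%:E.
  by apply: Lp_normE.
have TE : Lp_norm p (multiplier Phi t (Gc (a s) (b s))) =
    (`|k'| * (\int[mu]_x N (s + t) x `^ p) `^ p^-1)%:E.
  have kN x : (`|k'| * N (s + t) x) `^ p = `|k'| `^ p * N (s + t) x `^ p.
    by rewrite powRM.
  rewrite (Lp_normE (f := fun x => `|k'| * N (s + t) x) p0).
  - under eq_Rintegral do rewrite kN.
    rewrite (RintZ _ (Ls (s + t))) powRM ?powR_ge0//; last first.
      by apply: Rintegral_ge0 => x _; exact: powR_ge0.
    by rewrite -powRrM mulfV ?gt_eqF// powRr1.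
  - by move=> x; rewrite mulr_ge0.
  - by move=> x; exact: multiplier_normc.
  - by under eq_fun do rewrite kN; exact: L1Z.
exact: (opnorm_ge p1 A0 (ltW k0) (Gc_schwartz (ca s) (cb s)) fE TE (Ip_gt0 s p1) Hs).
Qed.

End lower_bound.

Theorem theorem3 (R : realType) (d : nat) (hd : (2 <= d)%N)
    (p : R) (hp : 1 < p) (Phi : 'rV[R]_d -> R)
    (smooth_Phi : smooth_on [set xi | xi != 0] Phi)
    (homogeneous_Phi : homogeneous0 Phi)
    (extremum_Phi : has_nondegenerate_local_extremum Phi) :
  exists2 c : R, 0 < c & forall t : R,
    ((c * japanese t `^ (d%:R * `|2^-1 - p^-1|))%:E
       <= Lp_opnorm p (multiplier Phi t))%E.
Proof.
(* With [d = n + 1] the charts of the sphere take values in dimension [n], and [hd] is convertible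
   to [0 < n]. *)
case: d => // n in hd Phi smooth_Phi homogeneous_Phi extremum_Phi *.
have [xi0 xi00 Hu] := exists_nondegenerate_point smooth_Phi homogeneous_Phi hd extremum_Phi.
have mPhi s : measurable_fun setT (partials s Phi).
  by apply: measurable_off0 => x x0; have [] := smooth_Phi s x x0.
have [r [C [r0 C0 BV disp]]] :=
  dispersive open_neq0 smooth_Phi xi00 Hu (mPhi [::]) (fun j => mPhi [:: j]).
have [kappa Hk] := @W_inversion R n.+1.
(* The dispersive constant is only known to be non-negative, so the positive constant [C + 1] is
   used. *)
apply: (opnorm_lower smooth_Phi r0 (ltr_wpDl C0 ltr01) BV _ Hk hp) => s x.
by rewrite (le_trans (disp s x))// lerDl.
Qed.
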